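(* Let $D$ be a strongly self-absorbing C$^*$-algebra. Then $D$ is the enforceable model of its universal theory $\mathrm{Th}_\forall(D)$ (in the language of unital C$^*$-algebras).
   Context: A (separable, unital) C$^*$-algebra $D$ is strongly self-absorbing if there is an isomorphism $\phi:D\to D\otimes D$ such that $\phi$ and $\mathrm{id}_D\otimes 1_D$ are approximately unitarily equivalent $*$-homomorphisms. Unital C$^*$-algebras are regarded as structures in a many-sorted continuous language $L$: for each $k\ge1$ a sort for the closed operator-norm ball of radius $k$ with metric $\|x-y\|$, function symbols for the $*$-algebra operations (addition, multiplication, adjoint, multiplication by scalars in $\mathbb Q(i)$), constants $0,1$ and inclusion maps between balls. $\mathrm{Th}_\forall(D)$ is the set of closed conditions $\sigma=0$ with $\sigma$ a universal $L$-sentence and $\sigma^D=0$. Game with respect to an $L$-theory $T$ (here $T=\mathrm{Th}_\forall(D)$). Fix a countable set $C$ of new constant symbols, infinitely many of each sort, and set $L(C)=L\cup C$. A restricted formula is one built using a fixed countable family of continuous connectives whose compositions are uniformly dense among all continuous connectives. A condition is a finite set $p$ of expressions $\varphi<r$, with $\varphi$ a quantifier-free restricted $L(C)$-sentence and $r\in\mathbb R$, such that $T\cup p$ is satisfiable. Two players $\forall$ and $\exists$ alternately play conditions $p_0\subseteq p_1\subseteq p_2\subseteq\cdots$ ($\forall$ moves first; each move contains the previous one) for $\omega$ steps; let $\bar p=\bigcup_i p_i$. The play is definitive if for every atomic $L(C)$-sentence $\varphi$ there is a unique real $r$ with $T\cup\bar p\models\varphi=r$; then $\bar p$ determines a prestructure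 on the algebra of closed $L(C)$-terms, whose completion is the compiled structure. A property $P$ is enforceable (with respect to $T$) if $\exists$ has a strategy guaranteeing, whatever $\forall$ plays, that the play is definitive and the compiled structure has $P$. A structure $A$ is enforceable (the enforceable model of $T$) if the property ''the $L$-reduct of the compiled structure is isomorphic to $A$'' is enforceable. *)

(* Defs.v *)
From HB Require Import structures.
From mathcomp Require Import all_boot all_order all_algebra complex.
From mathcomp Require Import all_classical all_reals topology normedtype.

Set Implicit Arguments.
Unset Strict Implicit.
Unset Printing Implicit Defensive.

Import Order.TTheory GRing.Theory Num.Theory.
Import numFieldNormedType.Exports.

Local Open Scope classical_set_scope.
Local Open Scope ring_scope.

(** * Unital C*-algebras *)

(* The norm takes values in R rather than in R[i]: the library's normed modules
   over R[i] cannot be joined with its algebras over R[i].  An [algType] is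
   nontrivial, so unital C*-algebras satisfy 1 != 0. *)
HB.mixin Record isCStar (R : realType) A & GRing.Algebra R[i] A := {
  star : A -> A;
  cnorm : A -> R;
  starK : involutive star;
  starD : {morph star : x y / x + y};
  starM : forall x y, star (x * y) = star y * star x;
  starZ : forall (z : R[i]) x, star (z *: x) = Num.conj z *: star x;
  cnorm_eq0 : forall x, cnorm x = 0 -> x = 0;
  cnormD : forall x y, cnorm (x + y) <= cnorm x + cnorm y;
  cnormZ : forall (z : R[i]) x, cnorm (z *: x) = complex.Re `|z| * cnorm x;
  cnormM : forall x y, cnorm (x * y) <= cnorm x * cnorm y;
  cnorm_star : forall x, cnorm (star x * x) = cnorm x ^+ 2;
  cnorm_complete : forall u : nat -> A,
    (forall e, 0 < e -> exists N, forall m n, (N <= m)%N -> (N <= n)%N ->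
       cnorm (u m - u n) < e) ->
    exists l, forall e, 0 < e -> exists N, forall n, (N <= n)%N ->
       cnorm (u n - l) < e
}.

#[short(type="cstarType")]
HB.structure Definition CStar (R : realType) :=
  {A of GRing.Algebra R[i] A & isCStar R A}.

Section CStarTheory.
Context {R : realType} {A : cstarType R}.
Implicit Types x y : A.

Lemma Re_norm_ge0 (z : R[i]) : 0 <= complex.Re `|z|.
Proof. by rewrite normc_def /= sqrtr_ge0. Qed.

Lemma cnorm0 : cnorm (0 : A) = 0.
Proof. by rewrite -(scale0r (0 : A)) cnormZ normr0 mul0r. Qed.

Lemma cnormN x : cnorm (- x) = cnorm x.
Proof. by rewrite -scaleN1r cnormZ normrN1 /= mul1r. Qed.

Lemma cdistC x y : cnorm (x - y) = cnorm (y - x).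
Proof. by rewrite -cnormN opprB. Qed.

Lemma cdistD y x z : cnorm (x - z) <= cnorm (x - y) + cnorm (y - z).
Proof.
have -> : x - z = (x - y) + (y - z) by rewrite addrA subrK.
exact: cnormD.
Qed.

Lemma cnorm_ge0 x : 0 <= cnorm x.
Proof.
have := cnormD x (- x); rewrite subrr cnorm0 cnormN -mulr2n.
by rewrite pmulrn_lge0.
Qed.

Lemma cnorm1_le1 : cnorm (1 : A) <= 1.
Proof.
have star1 : star (1 : A) = 1.
  by rewrite -[LHS](mulr1) -{2}(starK 1) -starM mulr1 starK.
have := cnorm_star (1 : A); rewrite star1 mulr1 => h.
rewrite leNgt; apply/negP => h1.
have h0 : 0 < cnorm (1 : A) by apply: lt_trans h1.
by move: h1; rewrite -(ltr_pM2l h0) mulr1 -expr2 -h ltxx.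
Qed.

Lemma cnorm_star_le x : cnorm x <= cnorm (star x).
Proof.
have [->|x0] := eqVneq (cnorm x) 0; first exact: cnorm_ge0.
have xp : 0 < cnorm x by rewrite lt_neqAle eq_sym x0 cnorm_ge0.
by rewrite -(ler_pM2r xp) -expr2 -cnorm_star cnormM.
Qed.

Lemma cnorm_starE x : cnorm (star x) = cnorm x.
Proof.
apply/eqP; rewrite eq_le cnorm_star_le andbT.
by have := cnorm_star_le (star x); rewrite starK.
Qed.

Lemma starB x y : star (x - y) = star x - star y.
Proof.
by rewrite starD -scaleN1r starZ rmorphN rmorph1 scaleN1r.
Qed.

Lemma cdistM x y x' y' :
  cnorm (x * y - x' * y') <= cnorm x * cnorm (y - y') + cnorm (x - x') * cnorm y'.
Proof.
have -> : x * y - x' * y' = x * (y - y') + (x - x') * y'.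
  by rewrite mulrBr mulrBl addrA subrK.
by apply: (le_trans (cnormD _ _)); apply: lerD; apply: cnormM.
Qed.

Definition unitary (u : A) : Prop := star u * u = 1 /\ u * star u = 1.

End CStarTheory.

Definition separable (R : realType) (A : cstarType R) : Prop :=
  exists d : nat -> A, forall x e, 0 < e -> exists n, cnorm (x - d n) < e.

(* Together with the type {lrmorphism A -> B} of unital algebra morphisms, this
   says that f is a unital *-homomorphism. *)
Definition star_preserving (R : realType) (A B : cstarType R) (f : A -> B) :
  Prop := forall x, f (star x) = star (f x).

Definition approx_unitarily_equivalent (R : realType) (A B : cstarType R)
    (f g : A -> B) : Prop :=
  exists u : nat -> B, (forall n, unitary (u n)) /\
    forall x, (fun n => cnorm (u n * f x * star (u n) - g x)) @ \oo --> (0 : R).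

(** * Minimal tensor products *)

Record hilbert (R : realType) := Hilbert {
  hvect :> completeNormedModType R[i];
  hdot : {dot hvect for Num.conj};
  hdot_norm : forall x : hvect, hdot x x = `|x| ^+ 2
}.

Record representation (R : realType) (A : cstarType R) (H : hilbert R) :=
  Representation {
  rep :> A -> {linear H -> H};
  rep_continuous : forall a, continuous (rep a);
  repD : forall a b x, rep (a + b) x = rep a x + rep b x;
  repZ : forall (z : R[i]) a x, rep (z *: a) x = z *: rep a x;
  repM : forall a b x, rep (a * b) x = rep a (rep b x);
  rep_star : forall a x y, hdot H (rep (star a) x) y = hdot H x (rep a y)
}.

Section MinimalTensor.
Context {R : realType}.

(* A list of pairs stands for the sum of the corresponding elementary tensors.
   This is the squared norm, in the Hilbert space tensor product of H and K, of
   the vector that s stands for. *)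
Definition tensor_sqnorm (H K : hilbert R) (s : seq (H * K)) : R[i] :=
  \sum_(u <- s) \sum_(v <- s) hdot H u.1 v.1 * hdot K u.2 v.2.

(* The vector obtained from s by applying the sum of the operators
   pi a (x) rho b, for (a, b) in t. *)
Definition tensor_apply (A B : cstarType R) (H K : hilbert R)
    (pi : representation A H) (rho : representation B K)
    (t : seq (A * B)) (s : seq (H * K)) : seq (H * K) :=
  [seq (pi x.1 u.1, rho x.2 u.2) | x <- t, u <- s].

(* The spatial norm of t is the supremum, over all representations pi of A and
   rho of B, of the operator norm of (pi (x) rho)(t); vectors in the algebraic
   tensor product of H and K suffice, since it is dense. *)
Definition spatial_norm_le (A B : cstarType R) (t : seq (A * B)) (c : R) :
  Prop :=
  forall (H K : hilbert R) (pi : representation A H) (rho : representation B K)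
    (s : seq (H * K)),
    tensor_sqnorm (tensor_apply pi rho t s) <= (c ^+ 2)%:C%C * tensor_sqnorm s.

(* E is the minimal tensor product of A and B, with i and j standing for
   a |-> a (x) 1 and b |-> 1 (x) b: the elementary tensors i a * j b span a
   dense *-subalgebra on which the norm of E is the spatial norm. *)
Definition is_min_tensor (A B E : cstarType R)
    (i : {lrmorphism A -> E}) (j : {lrmorphism B -> E}) : Prop :=
  [/\ star_preserving i, star_preserving j,
      (forall a b, i a * j b = j b * i a),
      (forall x e, 0 < e -> exists t : seq (A * B),
         cnorm (x - \sum_(p <- t) i p.1 * j p.2) < e) &
      (forall (t : seq (A * B)) c, 0 <= c ->
         cnorm (\sum_(p <- t) i p.1 * j p.2) <= c <-> spatial_norm_le t c)].

Definition strongly_self_absorbing (D : cstarType R) : Prop :=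
  separable D /\
  exists (E : cstarType R) (i j : {lrmorphism D -> E}),
    is_min_tensor i j /\
    exists phi : {lrmorphism D -> E},
      [/\ star_preserving phi, bijective phi &
          approx_unitarily_equivalent phi i].

End MinimalTensor.

(** * Continuous logic *)

#[short(type="completeMetricType")]
HB.structure Definition CompleteMetric (R : numDomainType) :=
  {M of Metric R M & Complete M}.

(* Metric signatures whose only predicate symbols are the metrics of the
   sorts. *)
Record signature (R : realType) := Signature {
  sorts : Type;
  symbol : Type;
  arg : symbol -> finType;
  dom : forall f, arg f -> sorts;
  cod : symbol -> sorts;
  diam : sorts -> R;
  modulus : symbol -> R -> R;
  modulus_gt0 : forall f e, 0 < e -> 0 < modulus f e
}.
Arguments dom {R s} f _.
Arguments cod {R s} f.

Record structure (R : realType) (L : signature R) := Structure {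
  carrier :> sorts L -> completeMetricType R;
  interp : forall f : symbol L,
    (forall i : arg f, carrier (dom f i)) -> carrier (cod f);
  mdist_diam : forall s (x y : carrier s), mdist x y <= diam s;
  interp_ucont : forall (f : symbol L) e (x y : forall i, carrier (dom f i)),
    0 < e -> (forall i, mdist (x i) (y i) < modulus f e) ->
    mdist (@interp f x) (@interp f y) <= e
}.
Arguments interp {R L} M f _ : rename.

Definition isomorphic (R : realType) (L : signature R) (M N : structure L) :
  Prop :=
  exists h : forall s, M s -> N s,
    [/\ (forall s, bijective (h s)),
        (forall s (x y : M s), mdist (h s x) (h s y) = mdist x y) &
        (forall (f : symbol L) (x : forall i, M (dom f i)),
           h _ (interp M f x) = interp N f (fun i => h _ (x i)))].

(* X, sorted by so, is a set of variables or of new constant symbols. *)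
Inductive term (R : realType) (L : signature R) (X : Type) (so : X -> sorts L) :
  sorts L -> Type :=
| Var (x : X) : term so (so x)
| App (f : symbol L) (t : forall i : arg f, term so (dom f i)) :
    term so (cod f).

Fixpoint eval (R : realType) (L : signature R) (X : Type) (so : X -> sorts L)
    (M : structure L) (v : forall x, M (so x)) s (t : term so s) : M s :=
  match t in term _ s return M s with
  | Var x => v x
  | App f t => interp M f (fun i => eval v (t i))
  end.

Record connectives (R : realType) := Connectives {
  conn : Type;
  conn_arity : conn -> nat;
  conn_fun : forall c, 'rV[R]_(conn_arity c) -> R;
  conn_continuous : forall c, continuous (@conn_fun c)
}.
Arguments conn_fun {R F} c _ : rename.

Definition all_connectives (R : realType) : connectives R :=
  {| conn := {n : nat & {u : 'rV[R]_n -> R | continuous u}};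
     conn_arity := fun c => projT1 c;
     conn_fun := fun c => sval (projT2 c);
     conn_continuous := fun c => svalP (projT2 c) |}.

Inductive composition (R : realType) (F : connectives R) (n : nat) :
  ('rV[R]_n -> R) -> Prop :=
| comp_proj (i : 'I_n) : composition F (fun x => x ord0 i)
| comp_conn (c : conn F) (g : 'I_(conn_arity c) -> 'rV[R]_n -> R) :
    (forall i, composition F (g i)) ->
    composition F (fun x => conn_fun c (\row_i g i x)).

(* Uniform density is understood on bounded boxes, as is usual for real-valued
   connectives: formulas only take values in bounded intervals. *)
Definition uniformly_dense (R : realType) (F : connectives R) : Prop :=
  forall n (u : 'rV[R]_n -> R), continuous u ->
  forall b e : R, 0 < e ->
  exists g, composition F g /\
    forall x : 'rV[R]_n, (forall i, `|x ord0 i| <= b) -> `|g x - u x| < e.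

Inductive qf_formula (R : realType) (L : signature R) (F : connectives R)
    (X : Type) (so : X -> sorts L) : Type :=
| Dist s (t u : term so s)
| Conn (c : conn F) (phi : 'I_(conn_arity c) -> qf_formula F so).

Fixpoint qf_eval (R : realType) (L : signature R) (F : connectives R)
    (X : Type) (so : X -> sorts L) (M : structure L) (v : forall x, M (so x))
    (phi : qf_formula F so) : R :=
  match phi with
  | Dist _ t u => mdist (eval v t) (eval v u)
  | Conn c phi => conn_fun c (\row_i qf_eval v (phi i))
  end.

(* The universal sentence sup_x0 ... sup_x(n-1) phi, where phi is
   quantifier-free. *)
Record universal_sentence (R : realType) (L : signature R) := Universal {
  uvars : nat;
  uvar_sort : 'I_uvars -> sorts L;
  umatrix : qf_formula (all_connectives R) uvar_sort
}.
Arguments uvar_sort {R L} u _.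

Section UniversalTheories.
Context {R : realType} {L : signature R}.

Definition universal_value (M : structure L) (sigma : universal_sentence L) :
  R := sup (range (fun v : forall i, M (uvar_sort sigma i) =>
                     qf_eval v (umatrix sigma))).

(* A set T of universal sentences stands for the set of closed conditions
   sigma = 0, for sigma in T. *)
Definition models (M : structure L) (T : set (universal_sentence L)) : Prop :=
  forall sigma, T sigma -> universal_value M sigma = 0.

Definition universal_theory (M : structure L) : set (universal_sentence L) :=
  [set sigma | universal_value M sigma = 0].

End UniversalTheories.

(** * The game *)

Section Game.
Context {R : realType} {L : signature R} (F : connectives R).
Context (C : Type) (so : C -> sorts L) (T : set (universal_sentence L)).

Definition position : Type := set (qf_formula F so * R).

(* (M, v) is an L(C)-structure, with v interpreting the constants. *)
Definition satisfies (M : structure L) (v : forall c, M (so c)) (p : position) :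
  Prop := models M T /\ forall e, p e -> qf_eval v e.1 < e.2.

Definition condition (p : position) : Prop :=
  finite_set p /\ exists (M : structure L) (v : forall c, M (so c)),
    satisfies v p.

Definition entails_dist (p : position) s (t u : term so s) (r : R) : Prop :=
  forall (M : structure L) (v : forall c, M (so c)),
    satisfies v p -> mdist (eval v t) (eval v u) = r.

Definition definitive (p : position) : Prop :=
  forall s (t u : term so s), exists! r, entails_dist p t u r.

(* (M, v) is the completion of the prestructure that p determines on the closed
   L(C)-terms; it is unique up to isomorphism. *)
Definition compiled (p : position) (M : structure L)
    (v : forall c, M (so c)) : Prop :=
  (forall s (t u : term so s),
     entails_dist p t u (mdist (eval v t) (eval v u))) /\
  (forall s (x : M s) e, 0 < e -> exists t : term so s, mdist x (eval v t) < e).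

(* In a play p, the n-th move is p n; the even moves are those of the first
   player. *)
Definition legal (p : nat -> position) (n : nat) : Prop :=
  condition (p n) /\ p n.-1 `<=` p n.

Definition follows (S : seq position -> position) (p : nat -> position) : Prop :=
  forall n, p n.*2.+1 = S (mkseq p n.*2.+1).

(* The strategy must yield a legal answer to every legal sequence of moves of
   the opponent, so that the second player cannot win by blocking the game. *)
Definition enforceable
    (P : forall M : structure L, (forall c, M (so c)) -> Prop) : Prop :=
  exists S : seq position -> position, forall p, follows S p ->
    (forall n, (forall m, (m <= n)%N -> legal p m.*2) -> legal p n.*2.+1) /\
    ((forall n, legal p n.*2) ->
     definitive (\bigcup_n p n) /\
     exists (M : structure L) (v : forall c, M (so c)),
       compiled (\bigcup_n p n) v /\ P M v).

Definition enforceable_structure (N : structure L) : Prop :=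
  enforceable (fun M _ => isomorphic M N).

End Game.

(** * The language of unital C*-algebras *)

(* The sort k stands for the closed ball of radius k + 1, for k : nat. *)
Inductive cstar_symbol : Type :=
| CZero | COne
| CAdd (k l : nat)
| CMul (k l : nat)
| CStarOp (k : nat)
(* multiplication by a + bi, into each ball that contains its range *)
| CScal (a b : rat) (k m : nat)
    of (a ^+ 2 + b ^+ 2) * k.+1%:R ^+ 2 <= m.+1%:R ^+ 2
| CIncl (k m : nat) of (k <= m)%N.

Definition cstar_arg (f : cstar_symbol) : finType :=
  match f with
  | CZero | COne => void
  | CAdd _ _ | CMul _ _ => bool
  | CStarOp _ | CScal _ _ _ _ _ | CIncl _ _ _ => unit
  end.

Definition cstar_dom (f : cstar_symbol) : cstar_arg f -> nat :=
  match f return cstar_arg f -> nat with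
  | CZero | COne => fun _ => 0%N
  | CAdd k l | CMul k l => fun i => if i then l else k
  | CStarOp k | CScal _ _ k _ _ | CIncl k _ _ => fun _ => k
  end.

(* In terms of radii, (k + l).+2 = k.+1 + l.+1 and
   (k * l + k + l).+1 = k.+1 * l.+1. *)
Definition cstar_cod (f : cstar_symbol) : nat :=
  match f with
  | CZero | COne => 0
  | CAdd k l => (k + l).+1
  | CMul k l => k * l + k + l
  | CStarOp k => k
  | CScal _ _ _ m _ | CIncl _ m _ => m
  end.

Definition cstar_modulus (R : realType) (f : cstar_symbol) (e : R) : R :=
  match f with
  | CZero | COne | CStarOp _ | CIncl _ _ _ => e
  | CAdd _ _ => e / 2
  | CMul k l => e / (k.+1 + l.+1)%:R
  | CScal _ _ _ m _ => e / m.+1%:R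
  end.

Lemma cstar_modulus_gt0 (R : realType) f (e : R) :
  0 < e -> 0 < cstar_modulus f e.
Proof. by case: f => *; rewrite //= divr_gt0. Qed.

Definition cstar_signature (R : realType) : signature R :=
  {| sorts := nat;
     symbol := cstar_symbol;
     arg := cstar_arg;
     dom := cstar_dom;
     cod := cstar_cod;
     diam := fun k => 2 * k.+1%:R;
     modulus := @cstar_modulus R;
     modulus_gt0 := @cstar_modulus_gt0 R |}.

Definition cball (R : realType) (A : cstarType R) (k : nat) : Type :=
  {x : A | cnorm x <= k.+1%:R}.

Section Ball.
Context {R : realType} {A : cstarType R}.
Implicit Types k l m : nat.

HB.instance Definition _ k := Choice.on (cball A k).

Fact cball0_subproof k : cnorm (0 : A) <= k.+1%:R.
Proof. by rewrite cnorm0. Qed.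

HB.instance Definition _ k :=
  isPointed.Build (cball A k) (exist _ 0 (cball0_subproof k)).

Definition cball_dist k (x y : cball A k) : R := cnorm (val x - val y).

Fact cball_distxx k (x : cball A k) : cball_dist x x = 0.
Proof. by rewrite /cball_dist subrr cnorm0. Qed.

Fact cball_dist_eq0 k (x y : cball A k) : cball_dist x y = 0 -> x = y.
Proof. by move/cnorm_eq0/eqP; rewrite subr_eq0 => /eqP/val_inj. Qed.

Fact cball_distC k (x y : cball A k) : cball_dist x y = cball_dist y x.
Proof. exact: cdistC. Qed.

Fact cball_distD k (y x z : cball A k) :
  cball_dist x z <= cball_dist x y + cball_dist y z.
Proof. exact: cdistD. Qed.

HB.instance Definition _ k := isMetric.Build R (cball A k)
  (@cball_distxx k) (@cball_dist_eq0 k) (@cball_distC k) (@cball_distD k).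

Lemma cball_mdistE k (x y : cball A k) : mdist x y = cnorm (val x - val y).
Proof. by []. Qed.

Fact cball_complete k (G : set_system (cball A k)) :
  ProperFilter G -> cauchy G -> cvg G.
Proof.
move=> PG /cauchyP cG.
have /choice[u uP] : forall n : nat, exists x : cball A k, G (ball x n.+1%:R^-1).
  by move=> n; apply: cG; rewrite invr_gt0.
have uD m n : cnorm (val (u m) - val (u n)) < m.+1%:R^-1 + n.+1%:R^-1.
  have [y []] := filter_ex (filterI (uP m) (uP n)).
  rewrite !ballEmdist /= !cball_mdistE => ym yn.
  by rewrite (le_lt_trans (cdistD (val y) _ _))// ltrD// cdistC.
have small (e : R) : 0 < e -> exists N, forall n, (N <= n)%N -> n.+1%:R^-1 < e.
  move=> e0; exists (Num.bound e^-1) => n Nn.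
  rewrite -[ltRHS]invrK ltf_pV2 ?posrE ?invr_gt0 ?ltr0n//.
  apply: (lt_le_trans (archi_boundP _)); first by rewrite invr_ge0 ltW.
  by rewrite ler_nat; exact: leq_trans Nn _.
have [|l lP] := @cnorm_complete R A (fun n => val (u n)).
  move=> e e0; have [N NP] := small _ (divr_gt0 e0 (ltr0n R 2)).
  exists N => m n Nm Nn; apply: (lt_trans (uD m n)).
  by rewrite (splitr e) ltrD ?NP.
have lk : cnorm l <= k.+1%:R.
  apply/ler_addgt0Pr => e e0; have [N NP] := lP _ e0.
  have -> : l = val (u N) + (l - val (u N)) by rewrite addrC subrK.
  by rewrite (le_trans (cnormD _ _))// lerD ?(svalP (u N))// cdistC ltW ?NP.
apply/cvg_ex; exists (exist _ l lk : cball A k) => B /nbhs_ballP[e /= e0 eB].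
have e2 : 0 < e / 2 by rewrite divr_gt0.
have [N NP] := small _ e2; have [N' NP'] := lP _ e2.
apply: (filterS _ (uP (maxn N N'))) => y; rewrite ballEmdist /= => uy.
apply: eB; rewrite ballEmdist /= cball_mdistE /= (splitr e).
apply: (le_lt_trans (cdistD (val (u (maxn N N'))) _ _)); rewrite ltrD//.
  by rewrite cdistC NP' ?leq_maxr.
by rewrite (lt_trans uy)// NP ?leq_maxl.
Qed.

HB.instance Definition _ k :=
  Uniform_isComplete.Build (cball A k) (@cball_complete k).

Fact cball1_subproof : cnorm (1 : A) <= 1%:R.
Proof. exact: cnorm1_le1. Qed.

Fact cballD_subproof k l (x : cball A k) (y : cball A l) :
  cnorm (val x + val y) <= (k + l).+2%:R.
Proof.
rewrite (le_trans (cnormD _ _))// -addnS -addSn natrD.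
exact: lerD (svalP x) (svalP y).
Qed.

Fact cballM_subproof k l (x : cball A k) (y : cball A l) :
  cnorm (val x * val y) <= (k * l + k + l).+1%:R.
Proof.
rewrite (le_trans (cnormM _ _))//.
have -> : ((k * l + k + l).+1 = k.+1 * l.+1)%N.
  by rewrite mulSnr mulnS addnS (addnC k).
by rewrite natrM ler_pM ?cnorm_ge0 ?(svalP x) ?(svalP y).
Qed.

Fact cball_star_subproof k (x : cball A k) : cnorm (star (val x)) <= k.+1%:R.
Proof. by rewrite cnorm_starE (svalP x). Qed.

Definition gauss_rat (a b : rat) : R[i] := (ratr a +i* ratr b)%C.

Lemma gauss_rat_norm (a b : rat) k m :
  (a ^+ 2 + b ^+ 2) * k.+1%:R ^+ 2 <= m.+1%:R ^+ 2 ->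
  complex.Re `|gauss_rat a b| * k.+1%:R <= m.+1%:R.
Proof.
rewrite -(ler_rat R) !(rmorphM, rmorphD, rmorphXn) /= !ratr_nat => h.
rewrite -(@ler_pXn2r _ 2) ?nnegrE ?mulr_ge0 ?Re_norm_ge0 ?ler0n ?sqrtr_ge0//.
rewrite exprMn (le_trans _ h)// sqr_sqrtr//.
by rewrite addr_ge0 ?sqr_ge0.
Qed.

Fact cballZ_subproof (a b : rat) k m
    (h : (a ^+ 2 + b ^+ 2) * k.+1%:R ^+ 2 <= m.+1%:R ^+ 2) (x : cball A k) :
  cnorm (gauss_rat a b *: val x) <= m.+1%:R.
Proof.
rewrite cnormZ (le_trans _ (gauss_rat_norm h))//.
by rewrite ler_wpM2l ?Re_norm_ge0 ?(svalP x).
Qed.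

Fact cball_incl_subproof k m (h : (k <= m)%N) (x : cball A k) :
  cnorm (val x) <= m.+1%:R.
Proof. by rewrite (le_trans (svalP x))// ler_nat. Qed.

End Ball.

Definition cstar_interp (R : realType) (A : cstarType R) (f : cstar_symbol) :
    (forall i : cstar_arg f, cball A (cstar_dom i)) -> cball A (cstar_cod f) :=
  match f return (forall i : cstar_arg f, cball A (cstar_dom i)) ->
                 cball A (cstar_cod f) with
  | CZero => fun _ => exist _ 0 (cball0_subproof 0)
  | COne => fun _ => exist _ 1 cball1_subproof
  | CAdd k l => fun x => exist _ (val (x false) + val (x true))
                           (cballD_subproof (x false) (x true))
  | CMul k l => fun x => exist _ (val (x false) * val (x true))
                           (cballM_subproof (x false) (x true))
  | CStarOp k => fun x => exist _ (star (val (x tt)))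
                            (cball_star_subproof (x tt))
  | CScal a b k m h => fun x => exist _ (gauss_rat a b *: val (x tt))
                                  (cballZ_subproof h (x tt))
  | CIncl k m h => fun x => exist _ (val (x tt)) (cball_incl_subproof h (x tt))
  end.

Section CStarStructure.
Context {R : realType} (A : cstarType R).

Fact cball_diam k (x y : cball A k) : mdist x y <= 2 * k.+1%:R.
Proof.
rewrite cball_mdistE (le_trans (cnormD _ _))// cnormN mulr_natl mulr2n.
exact: lerD (svalP x) (svalP y).
Qed.

Fact cstar_interp_ucont (f : cstar_symbol) (e : R)
    (x y : forall i : cstar_arg f, cball A (cstar_dom i)) :
  0 < e -> (forall i, mdist (x i) (y i) < cstar_modulus f e) ->
  mdist (cstar_interp x) (cstar_interp y) <= e.
Proof.
case: f x y => [||k l|k l|k|a b k m h|k m h] x y e0 xy; rewrite cball_mdistE /=.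
- by rewrite subrr cnorm0 ltW.
- by rewrite subrr cnorm0 ltW.
- rewrite opprD addrACA (le_trans (cnormD _ _))// (splitr e).
  exact: lerD (ltW (xy false)) (ltW (xy true)).
- rewrite (le_trans (cdistM _ _ _ _))//.
  have -> : e = k.+1%:R * (e / (k.+1 + l.+1)%:R) + (e / (k.+1 + l.+1)%:R) * l.+1%:R.
    by rewrite [X in X + _]mulrC -mulrDr -natrD divfK ?pnatr_eq0.
  apply: lerD; apply: ler_pM; rewrite ?cnorm_ge0//.
  + exact: (svalP (x false)).
  + exact: ltW (xy true).
  + exact: ltW (xy false).
  + exact: (svalP (y true)).
- by rewrite -starB cnorm_starE (ltW (xy tt)).
- rewrite -scalerBr cnormZ.
  have gm : complex.Re `|gauss_rat a b : R[i]| <= m.+1%:R.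
    rewrite (le_trans _ (gauss_rat_norm h))//.
    by rewrite ler_peMr ?Re_norm_ge0 ?ler1n.
  have -> : e = m.+1%:R * (e / m.+1%:R) by rewrite mulrC divfK ?pnatr_eq0.
  by rewrite ler_pM ?cnorm_ge0 ?Re_norm_ge0 ?(ltW (xy tt)).
- exact: ltW (xy tt).
Qed.

Definition cstar_structure : structure (cstar_signature R) :=
  @Structure R (cstar_signature R)
    (fun k : nat => (cball A k : completeMetricType R))
    (@cstar_interp R A) cball_diam cstar_interp_ucont.

End CStarStructure.

(* Main.v *)
Require Import Defs.
From HB Require Import structures.
From mathcomp Require Import all_boot all_order all_algebra complex.
From mathcomp Require Import all_classical all_reals topology normedtype.
From mathcomp Require Import sequences ring lra.

Set Implicit Arguments.
Unset Strict Implicit.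
Unset Printing Implicit Defensive.

Import Order.TTheory GRing.Theory Num.Theory.
Import numFieldNormedType.Exports.

Local Open Scope classical_set_scope.
Local Open Scope ring_scope.

(** A condition is satisfiable in a model of the universal theory of D if and
    only if it is satisfiable in D, so the whole game can be played inside D.
    The second player keeps an assignment v_n of the constants in D, with dense
    range, that satisfies the current position.  She asks for so many distances
    between closed terms to be close to their values under v_n that every other
    assignment w in D meeting her demands is, on the first N_n constants, within
    2^-n of v_n after conjugation by a unitary of D.  Whatever the opponent
    answers is satisfied by some such w, hence by a conjugate of w, which becomes
    the starting point of the next round.  The v_n then converge, and the
    compiled structure is D with the limit assignment.

    That finitely many demands suffice is a compactness argument for the fact
    that every asymptotic homomorphism w_m : D -> D is approximately inner.
    Write a |-> i a = a (x) 1 and b |-> j b = 1 (x) b for the two embeddings into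
    E = D (x) D.  Self-absorption gives i ~ j (approximate unitary equivalence).
    A unitary of E that almost conjugates i to j is almost a finite sum of
    elementary tensors a (x) b; replacing it by the sum of the w_m(a) (x) b gives
    i o w_m ~ j ~ i, provided that the norms of tensors do not increase in the
    limit.  This is where nuclearity enters: slicing such a unitary yields
    finite-rank approximations of the identity of D that factor through
    matrices, and w_m is asymptotically contractive on matrices over D. *)

(** * C*-algebras and unital *-homomorphisms *)

(** Two natural constructions are avoided. An asymptotic homomorphism is not extended to E: its
    members are not linear, and on algebraic tensors only the spatial norm is under control. Maps on
    tensors are therefore evaluated on finite lists ([theta]), identities hold up to null sequences,
    and exact unitaries are recovered by a polar decomposition. Nor is a representation theorem
    invoked: i is isometric because it is approximately conjugate to the isomorphism phi, so the
    norm of D is spatial and hence determined by representations; the vector state used for slicing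
    exists because 1 (x) 1 has nonzero spatial norm.

    The hypothesis gives phi ~ i only, and i ~ j takes a detour through mu = psi o j, where psi is
    the inverse of phi. From lam = psi o i ~ id one gets i o mu ~ j. The flip turns this into j o mu
    ~ i, so that mu o mu ~ lam ~ id. Applying mu to the first factor of i o mu ~ j yields i ~ i o mu
    o mu ~ j. *)

Section CStarBasics.
Context {R : realType} {A : cstarType R}.
Implicit Types x y z u v g c : A.

Lemma star1 : star (1 : A) = 1.
Proof. by rewrite -[LHS]mulr1 -{2}(starK 1) -starM mulr1 starK. Qed.

Lemma star0 : star (0 : A) = 0.
Proof. by rewrite -[X in star X](subrr 0) starB subrr. Qed.

Lemma star_sum I (r : seq I) (P : pred I) (F : I -> A) :
  star (\sum_(k <- r | P k) F k) = \sum_(k <- r | P k) star (F k).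
Proof. exact: (big_morph _ (@starD R A) star0). Qed.

Lemma cnorm_sum I (r : seq I) (P : pred I) (F : I -> A) :
  cnorm (\sum_(k <- r | P k) F k) <= \sum_(k <- r | P k) cnorm (F k).
Proof.
elim/big_rec2: _ => [|k y x _ xy]; first by rewrite cnorm0.
by rewrite (le_trans (cnormD _ _))// lerD2l.
Qed.

Lemma cnorm_scaleR (a : R) x : 0 <= a -> cnorm (a%:C%C *: x) = a * cnorm x.
Proof. by move=> a0; rewrite cnormZ normc_def /= expr0n addr0 sqrtr_sqr ger0_norm. Qed.

Lemma cnorm_dist x y : `|cnorm x - cnorm y| <= cnorm (x - y).
Proof.
have h1 : cnorm x <= cnorm (x - y) + cnorm y by rewrite -{1}(subrK y x) cnormD.
have h2 : cnorm y <= cnorm (y - x) + cnorm x by rewrite -{1}(subrK x y) cnormD.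
by move: h2; rewrite cdistC ler_norml; lra.
Qed.

Lemma cnorm_small0 (C : R) x : (forall e, 0 < e -> cnorm x <= C * e) -> x = 0.
Proof.
move=> h; apply: cnorm_eq0; apply/eqP; rewrite eq_le cnorm_ge0 andbT.
apply/ler_addgt0Pr => e e0; rewrite add0r.
have C1 : 0 < `|C| + 1 by rewrite ltr_wpDl.
have := h _ (divr_gt0 e0 C1) => /le_trans; apply.
rewrite mulrCA ler_piMr ?(ltW e0)// ler_pdivrMr// mul1r.
by rewrite (le_trans (ler_norm _))// lerDl.
Qed.

(** Banach's principle, relative to a set [S] that is closed under limits: [S] carries side
    properties such as size, self-adjointness and commutation over to the fixed point. *)
Lemma contraction_fixpoint (S : A -> Prop) (f : A -> A) (q K : R) :
  S 0 -> (forall x, S x -> S (f x)) -> 0 <= q -> q < 1 ->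
  (forall x, S x -> cnorm x <= K) ->
  (forall x y, S x -> S y -> cnorm (f x - f y) <= q * cnorm (x - y)) ->
  (forall (u : nat -> A) l, (forall n, S (u n)) ->
     (forall e, 0 < e -> exists n, cnorm (u n - l) < e) -> S l) ->
  exists x, S x /\ f x = x.
Proof.
move=> S0 Sf q0 q1 SK fq Scl; pose u n := iter n f 0.
have Su n : S (u n) by elim: n => //= n; exact: Sf.
have K0 : 0 <= K by rewrite -(@cnorm0 R A) SK.
have uq n k : cnorm (u (n + k)%N - u n) <= q ^+ n * K.
  elim: n => [|n IHn]; first by rewrite add0n subr0 expr0 mul1r SK.
  rewrite addSn exprS -mulrA (le_trans (fq _ _ (Su _) (Su _)))//.
  by rewrite ler_wpM2l.
have small e : 0 < e -> exists n, forall m, (n <= m)%N -> q ^+ m * K < e.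
  move=> e0.
  have : (fun n => q ^+ n * K) @ \oo --> (0 : R).
    rewrite -(mul0r K); apply: cvgMl; apply: cvg_expr.
    by rewrite ger0_norm.
  move/cvgr0Pnorm_lt => /(_ _ e0)[n _ nP]; exists n => m nm.
  by have := nP m nm; rewrite /= ger0_norm// mulr_ge0// exprn_ge0.
have [|l lP] := @cnorm_complete R A u.
  move=> e e0; have [N NP] := small _ e0; exists N => m n Nm Nn.
  wlog mn : m n Nm Nn / (n <= m)%N.
    by case/orP: (leq_total n m) => mn h; [exact: h|rewrite cdistC; exact: h].
  by rewrite -(subnKC mn) (le_lt_trans (uq _ _))// NP.
have lu e : 0 < e -> exists n, cnorm (u n - l) < e.
  by move=> /lP[N NP]; exists N; exact: NP.
have Sl : S l by apply: Scl lu.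
exists l; split=> //; apply/eqP; rewrite -subr_eq0; apply/eqP.
apply: (@cnorm_small0 2) => e e0; have [N NP] := lP _ e0.
apply: le_trans (cdistD (u N.+1) _ _) _; rewrite mulrDl mul1r lerD//.
  apply: le_trans (fq _ _ Sl (Su _)) _; rewrite -[leRHS]mul1r.
  by rewrite ler_pM ?cnorm_ge0 ?(ltW q1)// cdistC ltW ?NP.
by rewrite ltW// NP.
Qed.

Lemma comm_lim c l (u : nat -> A) : (forall n, c * u n = u n * c) ->
  (forall e, 0 < e -> exists n, cnorm (u n - l) < e) -> c * l = l * c.
Proof.
move=> cu ul; apply/eqP; rewrite -subr_eq0; apply/eqP.
apply: (@cnorm_small0 (2 * cnorm c)) => e /ul[n /ltW un].
have -> : c * l - l * c = (u n - l) * c - c * (u n - l).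
  by rewrite mulrBl mulrBr cu opprB [RHS]addrC addrA subrK.
apply: (le_trans (cnormD _ _)); rewrite cnormN.
have -> : 2 * cnorm c * e = e * cnorm c + cnorm c * e by ring.
rewrite lerD// (le_trans (cnormM _ _))//; first by rewrite ler_wpM2r ?cnorm_ge0.
by rewrite ler_wpM2l ?cnorm_ge0.
Qed.

Lemma star_lim l (u : nat -> A) : (forall n, star (u n) = u n) ->
  (forall e, 0 < e -> exists n, cnorm (u n - l) < e) -> star l = l.
Proof.
move=> su ul; apply/eqP; rewrite -subr_eq0; apply/eqP.
apply: (@cnorm_small0 2) => e /ul[n /ltW un].
rewrite mulrDl mul1r (le_trans (cdistD (u n) _ _))// lerD//.
by rewrite -{1}su -starB cnorm_starE cdistC.
Qed.

Lemma cnorm_lim K l (u : nat -> A) : (forall n, cnorm (u n) <= K) ->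
  (forall e, 0 < e -> exists n, cnorm (u n - l) < e) -> cnorm l <= K.
Proof.
move=> uK ul; apply/ler_addgt0Pr => e /ul[n /ltW un].
rewrite -(subrK (u n) l) addrC (le_trans (cnormD _ _))// lerD// cdistC//.
Qed.

(** A square root 1 - z of 1 - g amounts to a fixed point of z |-> (g + z^2) / 2. This map preserves
    the ball of radius ||g|| and contracts it by the factor ||g||. *)
Lemma sqrt_1B g : cnorm g < 1 ->
  exists z, [/\ cnorm z <= cnorm g, (1 - z) * (1 - z) = 1 - g,
    (star g = g -> star z = z) & forall c, c * g = g * c -> c * z = z * c].
Proof.
move=> g1; pose f z : A := (2^-1 : R)%:C%C *: (g + z * z).
have h0 : 0 <= 2^-1 :> R by rewrite invr_ge0.
have [|z [zg sz cz]|||z [z1 z2 z3]|x y [xg _ _] [yg _ _]|u l uS ul|z [[zg sz cz] fz]] :=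
  @contraction_fixpoint (fun z => [/\ cnorm z <= cnorm g,
    (star g = g -> star z = z) & forall c, c * g = g * c -> c * z = z * c])
    f (cnorm g) (cnorm g).
- split; first by rewrite cnorm0 cnorm_ge0.
    by rewrite star0.
  by move=> c _; rewrite mulr0 mul0r.
- split.
  + rewrite cnorm_scaleR// ler_pdivrMl// mulr_natl mulr2n.
    apply: (le_trans (cnormD _ _)); rewrite lerD// (le_trans (cnormM _ _))//.
    rewrite (le_trans (ler_pM _ _ zg zg)) ?cnorm_ge0//.
    by rewrite ler_piMr ?cnorm_ge0 ?ltW.
  + move=> sg; rewrite starZ starD starM sg sz// /f; congr (_ *: _).
    exact: conjc_real.
  + move=> c cg; rewrite -scalerAr -scalerAl mulrDr mulrDl cg; congr (_ *: (_ + _)).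
    by rewrite mulrA (cz c cg) -mulrA (cz c cg) mulrA.
- exact: cnorm_ge0.
- exact: g1.
- by [].
- rewrite /f -scalerBr cnorm_scaleR// ler_pdivrMl// opprD addrACA subrr add0r.
  apply: (le_trans (cdistM _ _ _ _)).
  have := ler_wpM2r (cnorm_ge0 (x - y)) xg.
  have := ler_wpM2r (cnorm_ge0 (x - y)) yg; lra.
- split; first by apply: cnorm_lim ul => n; case: (uS n).
    by move=> sg; apply: star_lim ul => n; case: (uS n) => _ ->.
  by move=> c cg; apply: comm_lim ul => n; case: (uS n) => _ _ ->.
- exists z; split=> //.
  have zz : z + z = g + z * z.
    rewrite -{1 2}fz /f -scalerDl -rmorphD /= -mulr2n -[_ *+ 2]mulr_natl divff ?pnatr_eq0//.
    by rewrite rmorph1 scale1r.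
  have -> : g = z + z - z * z by rewrite zz addrK.
  by rewrite mulrBr mulr1 mulrBl mul1r -addrA -opprD addrA.
Qed.

(** The Neumann series, obtained as fixed point of x |-> 1 + z x and of x |-> 1 + x z; a left and a
    right inverse coincide. *)
Lemma inv_1B z : cnorm z < 1 ->
  exists x, [/\ (1 - z) * x = 1, x * (1 - z) = 1 & (star z = z -> star x = x)].
Proof.
move=> z1; have z2 : 0 < 1 - cnorm z by rewrite subr_gt0.
have [||||||u l uS ul|x [xK fx]] := @contraction_fixpoint
    (fun x => cnorm x <= (1 - cnorm z)^-1)
    (fun x => 1 + z * x) (cnorm z) (1 - cnorm z)^-1 => //.
- by rewrite cnorm0 invr_ge0 ltW.
- move=> x xK; apply: (le_trans (cnormD _ _)).
  have -> : (1 - cnorm z)^-1 = 1 + cnorm z * (1 - cnorm z)^-1.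
    by field; rewrite subr_eq0 eq_sym lt_eqF.
  by rewrite lerD ?cnorm1_le1// (le_trans (cnormM _ _))// ler_wpM2l ?cnorm_ge0.
- exact: cnorm_ge0.
- by move=> x y _ _; rewrite opprD addrACA subrr add0r -mulrBr cnormM.
- exact: cnorm_lim ul.
have x1 : (1 - z) * x = 1 by rewrite mulrBl mul1r -{1}fx addrK.
have [||||||u l uS ul|y [yK fy]] := @contraction_fixpoint
    (fun x => cnorm x <= (1 - cnorm z)^-1)
    (fun x => 1 + x * z) (cnorm z) (1 - cnorm z)^-1 => //.
- by rewrite cnorm0 invr_ge0 ltW.
- move=> y yK; apply: (le_trans (cnormD _ _)).
  have -> : (1 - cnorm z)^-1 = 1 + (1 - cnorm z)^-1 * cnorm z.
    by field; rewrite subr_eq0 eq_sym lt_eqF.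
  by rewrite lerD ?cnorm1_le1// (le_trans (cnormM _ _))// ler_wpM2r ?cnorm_ge0.
- exact: cnorm_ge0.
- move=> y y' _ _; rewrite opprD addrACA subrr add0r -mulrBl.
  by rewrite mulrC cnormM.
- exact: cnorm_lim ul.
have y1 : y * (1 - z) = 1 by rewrite mulrBr mulr1 -{1}fy addrK.
have yx : y = x by rewrite -[y]mulr1 -x1 mulrA y1 mul1r.
exists x; split=> //; first by rewrite -yx.
move=> sz; rewrite -[LHS]mulr1 -x1 mulrA.
suff -> : star x * (1 - z) = 1 by rewrite mul1r.
by rewrite -{1}sz -star1 -starB -starM x1 star1.
Qed.

Lemma unitary_norm u : unitary u -> cnorm u <= 1.
Proof.
move=> [uu _]; rewrite -(@ler_pXn2r _ 2) ?nnegrE ?cnorm_ge0// expr1n.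
by rewrite -cnorm_star uu cnorm1_le1.
Qed.

Lemma unitary_star u : unitary u -> unitary (star u).
Proof. by move=> [u1 u2]; split; rewrite starK. Qed.

Lemma unitaryM u v : unitary u -> unitary v -> unitary (u * v).
Proof.
move=> [u1 u2] [v1 v2]; split; rewrite starM.
  by rewrite mulrA -(mulrA _ (star u)) u1 mulr1.
by rewrite mulrA -(mulrA u) v2 mulr1.
Qed.

Lemma cnorm_unitaryl u x : unitary u -> cnorm (u * x) = cnorm x.
Proof.
move=> uu; apply/eqP; rewrite eq_le; apply/andP; split.
  rewrite (le_trans (cnormM _ _))// ler_piMl ?cnorm_ge0//.
  exact: unitary_norm.
rewrite -[X in cnorm X <= _](mul1r x) -(proj1 uu) -mulrA.
rewrite (le_trans (cnormM _ _))// ler_piMl ?cnorm_ge0//.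
by apply: unitary_norm; apply: unitary_star.
Qed.

Lemma cnorm_unitaryr u x : unitary u -> cnorm (x * u) = cnorm x.
Proof.
move=> uu; rewrite -cnorm_starE starM cnorm_unitaryl ?cnorm_starE//.
exact: unitary_star.
Qed.

(** Polar decomposition: v = u |u|^-1, where |u| = 1 - z is a square root of u* u. Then v* v = 1,
    and v has a right inverse because u u* is invertible too, so v is unitary. Finally v - u = v z
    has the norm of z. *)
Lemma near_unitary u e : e < 1 -> cnorm (star u * u - 1) <= e ->
  cnorm (u * star u - 1) <= e -> exists v, unitary v /\ cnorm (v - u) <= e.
Proof.
move=> e1 u1 u2; pose g := 1 - star u * u.
have g1 : cnorm g < 1 by rewrite cdistC (le_lt_trans u1).
have sg : star g = g by rewrite /g starB starM starK star1.
have [z [zg zz /(_ sg) sz _]] := sqrt_1B g1.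
have [x [x1 x2 /(_ sz) sx]] := inv_1B (le_lt_trans zg g1).
have [|r [r1 _ _]] := @inv_1B (1 - u * star u).
  by rewrite cdistC (le_lt_trans u2).
rewrite subKr in r1.
have uu : star u * u = (1 - z) * (1 - z) by rewrite zz /g subKr.
pose v := u * x.
have v1 : star v * v = 1.
  rewrite starM sx mulrA -(mulrA x) uu !mulrA x2 mul1r x1//.
have vy : v * (1 - z) = u by rewrite -mulrA x2 mulr1.
have vr : v * ((1 - z) * star u * r) = 1 by rewrite !mulrA vy.
have v2 : v * star v = 1.
  rewrite -{1}[star v]mulr1 -vr (mulrA (star v)) v1 mul1r.
  by rewrite vr.
exists v; split=> //.
rewrite -{1}vy mulrBr mulr1 subKr.
rewrite cnorm_unitaryl//; rewrite (le_trans zg)// cdistC//.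
Qed.

End CStarBasics.

Section Homs.
Context {R : realType}.

Record star_hom (A B : cstarType R) (f : A -> B) : Prop := StarHom {
  shomD : forall x y, f (x + y) = f x + f y;
  shomZ : forall (z : R[i]) x, f (z *: x) = z *: f x;
  shomM : forall x y, f (x * y) = f x * f y;
  shom1 : f 1 = 1;
  shom_star : forall x, f (star x) = star (f x) }.

Lemma lrmorphism_star_hom (A B : cstarType R) (f : {lrmorphism A -> B}) :
  star_preserving f -> star_hom f.
Proof.
move=> sf; split=> //.
- exact: raddfD.
- by move=> z x; rewrite linearZ_LR.
- exact: rmorphM.
- exact: rmorph1.
Qed.

Section Theory.
Context (A B : cstarType R) (f : A -> B) (hf : star_hom f).

Lemma shomN x : f (- x) = - f x.
Proof. by rewrite -scaleN1r (shomZ hf) scaleN1r. Qed.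

Lemma shomB x y : f (x - y) = f x - f y.
Proof. by rewrite (shomD hf) shomN. Qed.

Lemma shom0 : f 0 = 0.
Proof. by rewrite -[X in f X](scale0r 0) (shomZ hf) scale0r. Qed.

Lemma shom_sum I (r : seq I) (P : pred I) (F : I -> A) :
  f (\sum_(k <- r | P k) F k) = \sum_(k <- r | P k) f (F k).
Proof. exact: (big_morph f (shomD hf) shom0). Qed.

Lemma shom_unitary u : unitary u -> unitary (f u).
Proof.
by move=> [u1 u2]; split; rewrite -(shom_star hf) -(shomM hf) ?u1 ?u2 (shom1 hf).
Qed.

End Theory.

Lemma shom_comp (A B C : cstarType R) (f : A -> B) (g : B -> C) :
  star_hom f -> star_hom g -> star_hom (g \o f).
Proof.
move=> hf hg; split=> /=.
- by move=> x y; rewrite (shomD hf) (shomD hg).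
- by move=> z x; rewrite (shomZ hf) (shomZ hg).
- by move=> x y; rewrite (shomM hf) (shomM hg).
- by rewrite (shom1 hf) (shom1 hg).
- by move=> x; rewrite (shom_star hf) (shom_star hg).
Qed.

End Homs.

(** * Contractivity and Hilbert space representations *)

Section Contractive.
Context {R : realType}.

Lemma conj_realC (a : R) : Num.conj (a%:C%C : R[i]) = a%:C%C.
Proof. exact: conjc_real. Qed.

(* W = h + i sqrt(1 - h^2). *)
Lemma selfadjoint_unitary (A : cstarType R) (h : A) : star h = h ->
  cnorm h < 1 -> exists W, unitary W /\ h = (2^-1 : R)%:C%C *: (W + star W).
Proof.
move=> sh h1; have hh1 : cnorm (h * h) < 1.
  by rewrite (le_lt_trans (cnormM _ _))// mulr_ilt1 ?cnorm_ge0.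
have [z [_ zz sz cz]] := sqrt_1B hh1.
have {}sz : star z = z by apply: sz; rewrite starM sh.
have {}cz : h * z = z * h by apply: cz; rewrite mulrA.
pose y := 1 - z; have sy : star y = y by rewrite starB star1 sz.
have hy : h * y = y * h by rewrite mulrBr mulrBl mulr1 mul1r cz.
have hyy : h * h + y * y = 1 by rewrite zz addrC subrK.
have ii : ('i%C * 'i%C : R[i]) = -1 by rewrite -expr2 sqr_i.
have sW : star (h + 'i%C *: y) = h - 'i%C *: y.
  rewrite starD starZ sh sy -scaleNr; congr (_ + _ *: _).
  by apply/eqP; rewrite eq_complex /= oppr0 !eqxx.
exists (h + 'i%C *: y); split; last first.
  rewrite sW addrACA subrr addr0 -mulr2n -(scaler_nat 2 h) scalerA.
  have -> : (2%:R : R[i]) = (2 : R)%:C%C by rewrite rmorph_nat.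
  by rewrite -rmorphM /= mulVf ?pnatr_eq0// scale1r.
split; rewrite sW.
  rewrite mulrDr !mulrBl -!scalerAl -!scalerAr scalerA ii scaleN1r opprK hy.
  by rewrite addrA subrK.
rewrite mulrBr !mulrDl -!scalerAl -!scalerAr scalerA ii scaleN1r hy.
by rewrite opprD opprK addrA addrK.
Qed.

(** By the C*-identity it suffices to treat self-adjoint elements. A self-adjoint strict contraction
    is the average of two unitaries, and f maps unitaries to unitaries. *)
Lemma shom_norm (A B : cstarType R) (f : A -> B) x : star_hom f ->
  cnorm (f x) <= cnorm x.
Proof.
move=> hf.
have sa h : star h = h -> cnorm h < 1 -> cnorm (f h) <= 1.
  move=> sh /(selfadjoint_unitary sh)[W [uW ->]].
  rewrite (shomZ hf) (shomD hf) cnorm_scaleR ?invr_ge0// ler_pdivrMl// mulr1.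
  apply: (le_trans (cnormD _ _)); rewrite (_ : 2 = 1 + 1)// lerD//.
    exact/unitary_norm/(shom_unitary hf).
  exact/unitary_norm/(shom_unitary hf)/unitary_star.
rewrite -(@ler_pXn2r _ 2) ?nnegrE ?cnorm_ge0// -!cnorm_star.
apply/ler_addgt0Pr => e e0; set t := _ + e.
have t0 : 0 < t by rewrite ltr_wpDl ?cnorm_ge0.
have := sa ((t^-1)%:C%C *: (star x * x)).
rewrite starZ starM starK conj_realC => /(_ erefl).
rewrite (shomZ hf) !cnorm_scaleR ?invr_ge0 ?(ltW t0)// -(shom_star hf) -(shomM hf).
by rewrite ltr_pdivrMl// ler_pdivrMl// mulr1; apply; rewrite ltrDl.
Qed.

End Contractive.

Section Hilbert.
Context {R : realType} {H : hilbert R}.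
Implicit Types (x y : H) (z : R[i]) (a : R).

Lemma hdotDl x x' y : hdot H (x + x') y = hdot H x y + hdot H x' y.
Proof. exact: linearDl. Qed.

Lemma hdotZl z x y : hdot H (z *: x) y = z * hdot H x y.
Proof. exact: linearZl_LR. Qed.

Lemma hdotZr z x y : hdot H x (z *: y) = Num.conj z * hdot H x y.
Proof. exact: linearZr_LR. Qed.

Lemma hdotC x y : hdot H y x = Num.conj (hdot H x y).
Proof. by rewrite hermC expr0 mul1r. Qed.

Lemma hdot_suml I (r : seq I) (P : pred I) (F : I -> H) y :
  hdot H (\sum_(k <- r | P k) F k) y = \sum_(k <- r | P k) hdot H (F k) y.
Proof. exact: linear_sumlz. Qed.

Lemma hdot_sumr I (r : seq I) (P : pred I) (F : I -> H) x :
  hdot H x (\sum_(k <- r | P k) F k) = \sum_(k <- r | P k) hdot H x (F k).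
Proof. exact: linear_sumr. Qed.

Definition rdot x y : R := complex.Re (hdot H x y).
Definition hsq x : R := rdot x x.

Lemma rdotDl x x' y : rdot (x + x') y = rdot x y + rdot x' y.
Proof. by rewrite /rdot hdotDl raddfD. Qed.

Lemma rdotC x y : rdot x y = rdot y x.
Proof. by rewrite /rdot (hdotC y x); case: (hdot H y x). Qed.

Lemma rdotDr x y y' : rdot x (y + y') = rdot x y + rdot x y'.
Proof. by rewrite !(rdotC x) rdotDl. Qed.

Lemma rdotZl a x y : rdot (a%:C%C *: x) y = a * rdot x y.
Proof.
rewrite /rdot hdotZl; case: (hdot H x y) => b c.
by rewrite -[LHS]/(a * b - 0 * c) mul0r subr0.
Qed.

Lemma rdotZr a x y : rdot x (a%:C%C *: y) = a * rdot x y.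
Proof. by rewrite rdotC rdotZl rdotC. Qed.

Lemma rdot_suml I (r : seq I) (P : pred I) (F : I -> H) y :
  rdot (\sum_(k <- r | P k) F k) y = \sum_(k <- r | P k) rdot (F k) y.
Proof. by rewrite /rdot hdot_suml raddf_sum. Qed.

Lemma rdot_sumr I (r : seq I) (P : pred I) (F : I -> H) x :
  rdot x (\sum_(k <- r | P k) F k) = \sum_(k <- r | P k) rdot x (F k).
Proof. by rewrite rdotC rdot_suml; apply: eq_bigr => k _; rewrite rdotC. Qed.

Lemma hdot_hsq x : hdot H x x = (hsq x)%:C%C.
Proof.
have := dnorm_ge0 (hdot H) x; rewrite lecE /= => /andP[/eqP h _].
by apply/eqP; rewrite eq_complex /= h !eqxx.
Qed.

Lemma hsq_ge0 x : 0 <= hsq x.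
Proof. by rewrite -ler0c -hdot_hsq dnorm_ge0. Qed.

Lemma hsq_eq0 x : hsq x = 0 -> x = 0.
Proof. by move=> h; apply/eqP; rewrite -(dnorm_eq0 (hdot H)) hdot_hsq h. Qed.

(** Cauchy-Schwarz for families, that is, in the direct sum of copies of H on which matrices over an
    algebra act. *)
Lemma hdots_CS (I : finType) (X Y : I -> H) :
  (\sum_k rdot (X k) (Y k)) ^+ 2 <= (\sum_k hsq (X k)) * (\sum_k hsq (Y k)).
Proof.
set p := \sum_k rdot _ _; set X2 := \sum_k hsq (X k); set Y2 := \sum_k hsq (Y k).
have X0 : 0 <= X2 by apply: sumr_ge0 => k _; exact: hsq_ge0.
have Y0 : 0 <= Y2 by apply: sumr_ge0 => k _; exact: hsq_ge0.
have key t : 0 <= X2 - 2 * t * p + t ^+ 2 * Y2.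
  rewrite [leRHS](_ : _ = \sum_k hsq (X k + (- t)%:C%C *: Y k)).
    by apply: sumr_ge0 => k _; exact: hsq_ge0.
  rewrite /X2 /p /Y2 !mulr_sumr -sumrB -big_split /=; apply: eq_bigr => k _.
  rewrite /hsq rdotDl !rdotDr !rdotZl !rdotZr (rdotC (Y k)).
  by rewrite /=; ring.
have [Yz|Yn] := eqVneq Y2 0.
  have [->|pn] := eqVneq p 0; first by rewrite expr0n mulr_ge0.
  (* For this t the quadratic takes the value -1, so a nonzero [p] is impossible. *)
  have := key ((X2 + 1) / (2 * p)); rewrite Yz mulr0 addr0.
  have -> : 2 * ((X2 + 1) / (2 * p)) * p = X2 + 1 by field.
  lra.
have Yp : 0 < Y2 by rewrite lt_neqAle eq_sym Yn.
have := key (p / Y2).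
have -> : X2 - 2 * (p / Y2) * p + (p / Y2) ^+ 2 * Y2 = X2 - p ^+ 2 / Y2 by field.
by rewrite subr_ge0 ler_pdivrMr.
Qed.

Lemma rdot_CS x y : rdot x y ^+ 2 <= hsq x * hsq y.
Proof.
by have := @hdots_CS unit (fun=> x) (fun=> y); rewrite !big_const card_unit /= !addr0.
Qed.

End Hilbert.

Section Representations.
Context {R : realType} {A : cstarType R} {H : hilbert R}.
Variable pi : representation A H.

Lemma rep_rdot a x y : rdot (pi a x) y = rdot x (pi (star a) y).
Proof. by rewrite /rdot -rep_star starK. Qed.

Lemma rep0 x : pi 0 x = 0.
Proof. by rewrite -(scale0r (0 : A)) repZ scale0r. Qed.

Lemma rep_sum I (r : seq I) (P : pred I) (F : I -> A) x :
  pi (\sum_(k <- r | P k) F k) x = \sum_(k <- r | P k) pi (F k) x.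
Proof. by apply: (big_morph (fun a => pi a x)) => [a b|]; rewrite ?repD ?rep0. Qed.

Lemma hsq_rep a x : hsq (pi a x) = rdot (pi (star a * a) x) x.
Proof. by rewrite /hsq rep_rdot -repM rdotC. Qed.

(** Representations may be degenerate: 1 acts as a projection, not necessarily as the identity. *)
Lemma hsq_rep1 x : hsq (pi 1 x) <= hsq x.
Proof.
have h : hsq (pi 1 x) = rdot (pi 1 x) x by rewrite hsq_rep star1 mulr1.
have [->|n0] := eqVneq (hsq (pi 1 x)) 0; first exact: hsq_ge0.
rewrite -(@ler_pM2l _ (hsq (pi 1 x))) ?lt_neqAle 1?eq_sym ?n0 ?hsq_ge0//.
by rewrite -expr2 {1}h rdot_CS.
Qed.

(** The argument of [shom_norm], carried out on vectors: the parallelogram law bounds an average of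
    two unitaries, and the general case follows from ||a x||^4 <= ||a* a x||^2 ||x||^2. *)
Lemma hsq_rep_le a x : hsq (pi a x) <= cnorm a ^+ 2 * hsq x.
Proof.
have un W y : unitary W -> hsq (pi W y) <= hsq y.
  move=> [uW _]; rewrite hsq_rep uW -[X in rdot (pi X _)](mulr1 1).
  by rewrite -{1}star1 -hsq_rep hsq_rep1.
have sa h y : star h = h -> cnorm h < 1 -> hsq (pi h y) <= hsq y.
  move=> sh /(selfadjoint_unitary sh)[W [uW ->]].
  have := un _ y uW; have := un _ y (unitary_star uW).
  rewrite repZ repD.
  set u := pi W y; set v := pi (star W) y.
  have := hsq_ge0 (u + (-1)%:C%C *: v); rewrite /hsq.
  rewrite !(rdotZl, rdotZr, rdotDl, rdotDr) (rdotC v u); lra.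
have {}sa t : cnorm a ^+ 2 < t -> hsq (pi a x) <= t * hsq x.
  move=> at_; have t0 : 0 < t by rewrite (le_lt_trans _ at_)// sqr_ge0.
  have := sa ((t^-1)%:C%C *: (star a * a)) x.
  rewrite starZ starM starK conj_realC => /(_ erefl).
  rewrite cnorm_scaleR ?invr_ge0 ?(ltW t0)// cnorm_star ltr_pdivrMl// mulr1.
  move=> /(_ at_); rewrite repZ /hsq rdotZl rdotZr -!/(hsq _) mulrA => h.
  have {}h : hsq (pi (star a * a) x) <= t ^+ 2 * hsq x.
    by move: h; rewrite -invfM -expr2 ler_pdivrMl ?exprn_gt0.
  rewrite -(@ler_pXn2r _ 2) ?nnegrE ?mulr_ge0 ?hsq_ge0 ?(ltW t0)//.
  rewrite hsq_rep (le_trans (rdot_CS _ _))// exprMn.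
  by rewrite (expr2 (hsq x)) mulrA ler_wpM2r ?hsq_ge0.
have [x0|xn] := eqVneq (hsq x) 0.
  have := sa (cnorm a ^+ 2 + 1); rewrite x0 !mulr0; apply; rewrite ltrDl//.
have xp : 0 < hsq x by rewrite lt_neqAle eq_sym xn hsq_ge0.
rewrite -ler_pdivrMr//; apply/ler_addgt0Pr => e e0.
by rewrite ler_pdivrMr// sa// ltrDl.
Qed.

End Representations.

(** * Tensor products of Hilbert spaces *)

Section Orthonormal.
Context {R : realType}.

Lemma big_option (V : nmodType) (I : finType) (F : option I -> V) :
  \sum_k F k = F None + \sum_k F (Some k).
Proof.
rewrite (bigD1 None)//=; congr (_ + _).
rewrite (reindex_omap Some id) => [|[]//].
by apply: eq_bigl => k; rewrite eqxx.
Qed.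

Definition orthonormal_family (H : hilbert R) (I : finType) (e : I -> H) : Prop :=
  forall k l, hdot H (e k) (e l) = (k == l)%:R.

Lemma hdot_proj (H : hilbert R) (I : finType) (e : I -> H) x l :
  orthonormal_family e ->
  hdot H (\sum_k hdot H x (e k) *: e k) (e l) = hdot H x (e l).
Proof.
move=> oe; rewrite hdot_suml (bigD1 l)//= hdotZl oe eqxx mulr1 big1 ?addr0// => k kl.
by rewrite hdotZl oe (negPf kl) mulr0.
Qed.

Lemma hdot_proj2 (H : hilbert R) (I : finType) (e : I -> H) x y :
  orthonormal_family e ->
  hdot H (x - \sum_k hdot H x (e k) *: e k) (y - \sum_k hdot H y (e k) *: e k) =
  hdot H x y - \sum_k hdot H x (e k) * Num.conj (hdot H y (e k)).
Proof.
move=> oe; set px := \sum_k _ *: _; set py := \sum_k hdot H y _ *: _.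
have -> : hdot H (x - px) (y - py) = hdot H (x - px) y.
  rewrite linearBr /= hdot_sumr big1 ?subr0// => k _.
  by rewrite hdotZr linearBl /= hdot_proj// subrr mulr0.
rewrite linearBl /= hdot_suml; congr (_ - _); apply: eq_bigr => k _.
by rewrite hdotZl -hdotC.
Qed.

Lemma gram_schmidt (H : hilbert R) (s : seq H) :
  exists (I : finType) (e : I -> H), orthonormal_family e /\
    forall x, x \in s -> x = \sum_k hdot H x (e k) *: e k.
Proof.
elim: s => [|x s [I [e [oe se]]]].
  exists void, (fun k : void => match k with end); split=> [[]|x]//.
pose r := x - \sum_k hdot H x (e k) *: e k.
have re k : hdot H r (e k) = 0 by rewrite linearBl /= hdot_proj// subrr.
have [r0|rn] := eqVneq (hsq r) 0.
  exists I, e; split=> // y; rewrite inE => /orP[/eqP ->|]; last exact: se.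
  by apply/eqP; rewrite -subr_eq0; apply/eqP; exact: hsq_eq0.
have rp : 0 < hsq r by rewrite lt_neqAle eq_sym rn hsq_ge0.
pose a := Num.sqrt (hsq r).
have a0 : a != 0 by rewrite lt0r_neq0// sqrtr_gt0.
have aa : a * a = hsq r by rewrite -expr2 sqr_sqrtr// ltW.
pose e' k := if k is Some l then e l else (a^-1)%:C%C *: r.
have ee' l : hdot H (e l) (e' None) = 0.
  by rewrite /= hdotZr (hdotC r) re conjC0 mulr0.
exists (option I), e'; split=> [[k|] [l|]|].
- exact: oe.
- by rewrite ee'.
- by rewrite /= hdotZl re mulr0.
- rewrite /= hdotZl hdotZr conj_realC hdot_hsq -!rmorphM /= -aa.
  have -> : a^-1 * (a^-1 * (a * a)) = 1 by field.
  by rewrite rmorph1.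
move=> y; rewrite inE => /orP[/eqP ->|ys]; rewrite big_option.
  have xE : x = r + \sum_k hdot H x (e k) *: e k by rewrite subrK.
  rewrite [LHS]xE; congr (_ + _).
  have -> : hdot H x (e' None) = a%:C%C.
    rewrite {1}xE hdotDl hdot_suml big1 => [|k _]; last by rewrite hdotZl ee' mulr0.
    rewrite addr0 /= hdotZr conj_realC hdot_hsq -rmorphM /= -aa.
    by rewrite mulrA mulVf// mul1r.
  by rewrite /= scalerA -rmorphM /= mulfV// scale1r.
rewrite {1}(se y ys).
have -> : hdot H y (e' None) = 0.
  by rewrite (se y ys) hdot_suml big1 // => k _; rewrite hdotZl ee' mulr0.
by rewrite scale0r add0r.
Qed.

End Orthonormal.

Section TensorNorm.
Context {R : realType}.
Implicit Types H K : hilbert R.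

Lemma hsq_sumZ H K (s : seq (H * K)) (x : K) :
  (hsq (\sum_(u <- s) hdot K u.2 x *: u.1))%:C%C =
  \sum_(u <- s) \sum_(v <- s)
    hdot H u.1 v.1 * (hdot K u.2 x * Num.conj (hdot K v.2 x)).
Proof.
rewrite -hdot_hsq hdot_suml; apply: eq_bigr => u _.
rewrite hdot_sumr; apply: eq_bigr => v _.
by rewrite hdotZl hdotZr; ring.
Qed.

(** Each second leg splits into its projection on the span of [e] and a remainder, and the cross
    terms vanish. This gives Bessel's inequality, and Parseval's identity when the remainders are
    zero. *)
Lemma bessel_defect H K (I : finType) (e : I -> K) (s : seq (H * K)) :
  orthonormal_family e ->
  tensor_sqnorm s = (\sum_l hsq (\sum_(u <- s) hdot K u.2 (e l) *: u.1))%:C%C +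
    tensor_sqnorm [seq (u.1, u.2 - \sum_k hdot K u.2 (e k) *: e k) | u <- s].
Proof.
move=> oe; rewrite rmorph_sum /=; under eq_bigr do rewrite hsq_sumZ.
rewrite /tensor_sqnorm [X in _ = X + _]exchange_big big_map -big_split /=.
apply: eq_bigr => u _; rewrite [X in _ = X + _]exchange_big big_map -big_split /=.
apply: eq_bigr => v _.
by rewrite hdot_proj2// -mulr_sumr -mulrDr addrC subrK.
Qed.

Lemma parseval H K (I : finType) (e : I -> K) (s : seq (H * K)) :
  orthonormal_family e ->
  (forall u, u \in s -> u.2 = \sum_k hdot K u.2 (e k) *: e k) ->
  tensor_sqnorm s = (\sum_l hsq (\sum_(u <- s) hdot K u.2 (e l) *: u.1))%:C%C.
Proof.
move=> oe se; rewrite (bessel_defect s oe) [X in _ + X]big1_seq ?addr0// => u /=.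
move=> /mapP[u' u's ->]; rewrite big1_seq// => v _ /=.
by rewrite -se// subrr linear0l mulr0.
Qed.

Definition tsq H K (s : seq (H * K)) : R := complex.Re (tensor_sqnorm s).

(** The double sum in [tensor_sqnorm] hides its positivity. Expanding the second legs in an
    orthonormal family turns it into a sum of squares of vectors of [H]. *)
Lemma tensor_parseval H K (s : seq (H * K)) :
  exists (I : finType) (e : I -> K), [/\ orthonormal_family e,
    (forall u, u \in s -> u.2 = \sum_k hdot K u.2 (e k) *: e k) &
    tensor_sqnorm s =
      (\sum_l hsq (\sum_(u <- s) hdot K u.2 (e l) *: u.1))%:C%C].
Proof.
have [I [e [oe se]]] := gram_schmidt [seq u.2 | u <- s].
have {}se u : u \in s -> u.2 = \sum_k hdot K u.2 (e k) *: e k.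
  by move=> us; apply: se; apply: map_f.
by exists I, e; split=> //; exact: parseval.
Qed.

Lemma tensor_sqnormE H K (s : seq (H * K)) : tensor_sqnorm s = (tsq s)%:C%C.
Proof. by rewrite /tsq; have [I [e [_ _ ->]]] := tensor_parseval s. Qed.

Lemma tsq_ge0 H K (s : seq (H * K)) : 0 <= tsq s.
Proof.
rewrite /tsq; have [I [e [_ _ ->]]] := tensor_parseval s.
by apply: sumr_ge0 => l _; exact: hsq_ge0.
Qed.

Lemma tensor_bessel H K (I : finType) (e : I -> K) (s : seq (H * K)) :
  orthonormal_family e ->
  \sum_l hsq (\sum_(u <- s) hdot K u.2 (e l) *: u.1) <= tsq s.
Proof.
by move=> oe; rewrite /tsq (bessel_defect _ oe) tensor_sqnormE /= lerDl tsq_ge0.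
Qed.

Lemma tensor_sqnorm_swap H K (s : seq (H * K)) :
  tensor_sqnorm [seq (u.2, u.1) | u <- s] = tensor_sqnorm s.
Proof.
rewrite /tensor_sqnorm big_map; apply: eq_bigr => u _.
by rewrite big_map; apply: eq_bigr => v _; rewrite mulrC.
Qed.

(** In the expansion of [tensor_parseval], the operator pi a (x) 1 acts on each coefficient in [H]
    separately. *)
Lemma tsq_rep_le (A : cstarType R) H K (pi : representation A H) a r
    (s : seq (H * K)) : 0 <= r ->
  (forall x, hsq (pi a x) <= r * hsq x) ->
  tsq [seq (pi a u.1, u.2) | u <- s] <= r * tsq s.
Proof.
move=> r0 ar; have [I [e [oe se sE]]] := tensor_parseval s.
rewrite /tsq sE (parseval oe) => [|u /mapP[v vs ->]]; last exact: (se v vs).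
rewrite /= mulr_sumr; apply: ler_sum => l _; rewrite big_map /=.
rewrite (le_trans _ (ar _))// linear_sum /= le_eqVlt; apply/orP; left; apply/eqP.
by congr hsq; apply: eq_bigr => u _; rewrite linearZ.
Qed.

End TensorNorm.

(** * The minimal tensor product *)

Section RepComp.
Context {R : realType} {A B : cstarType R} (f : A -> B) (hf : star_hom f).
Context {H : hilbert R} (pi : representation B H).

Let pif a := pi (f a).

Fact rep_comp_continuous a : continuous (pif a).
Proof. exact: rep_continuous. Qed.

Fact rep_compD a b x : pif (a + b) x = pif a x + pif b x.
Proof. by rewrite /pif (shomD hf) repD. Qed.

Fact rep_compZ z a x : pif (z *: a) x = z *: pif a x.
Proof. by rewrite /pif (shomZ hf) repZ. Qed.

Fact rep_compM a b x : pif (a * b) x = pif a (pif b x).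
Proof. by rewrite /pif (shomM hf) repM. Qed.

Fact rep_comp_star a x y : hdot H (pif (star a) x) y = hdot H x (pif a y).
Proof. by rewrite /pif (shom_star hf) rep_star. Qed.

Definition rep_comp : representation A H :=
  Representation rep_comp_continuous rep_compD rep_compZ rep_compM rep_comp_star.

End RepComp.

Section MinTensor.
Context {R : realType}.

Lemma spatial_norm_leP (A B : cstarType R) (t : seq (A * B)) c :
  spatial_norm_le t c <-> forall (H K : hilbert R) (pi : representation A H)
    (rho : representation B K) (s : seq (H * K)),
    tsq (tensor_apply pi rho t s) <= c ^+ 2 * tsq s.
Proof.
split=> h H K pi rho s; have := h H K pi rho s.
  by rewrite !tensor_sqnormE -rmorphM lecR.
by rewrite !tensor_sqnormE -rmorphM lecR.
Qed.

Lemma spatial_norm_le_swap (A B : cstarType R) (t : seq (A * B)) c :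
  spatial_norm_le t c -> spatial_norm_le [seq (p.2, p.1) | p <- t] c.
Proof.
move=> h H K pi rho s; have := h K H rho pi [seq (u.2, u.1) | u <- s].
rewrite tensor_sqnorm_swap /tensor_apply allpairs_mapr allpairs_mapl.
rewrite -tensor_sqnorm_swap; congr (_ <= _); congr tensor_sqnorm.
by rewrite map_allpairs.
Qed.

Lemma spatial_norm_le_comp (A A' B : cstarType R) (f : A -> A')
    (t : seq (A * B)) c : star_hom f ->
  spatial_norm_le t c -> spatial_norm_le [seq (f p.1, p.2) | p <- t] c.
Proof.
move=> hf h H K pi rho s; have := h H K (rep_comp hf pi) rho s.
by rewrite /tensor_apply allpairs_mapl.
Qed.

(** The norm of [c] in the algebra of matrices over [A], tested on direct sums of copies of [H]; the
    matrices themselves are never made into a C*-algebra. *)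
Definition mxbound (A : cstarType R) (I : finType) (c : I -> I -> A) (r : R) :
  Prop := forall (H : hilbert R) (pi : representation A H) (h : I -> H),
  \sum_k hsq (\sum_l pi (c k l) (h l)) <= r ^+ 2 * \sum_k hsq (h k).

Context {D E : cstarType R} {i j : {lrmorphism D -> E}}.
Hypothesis hmin : is_min_tensor i j.

Definition tensor_val (t : seq (D * D)) : E := \sum_(p <- t) i p.1 * j p.2.

Lemma hom_i : star_hom i.
Proof. by case: hmin => si _ _ _ _; exact: lrmorphism_star_hom. Qed.

Lemma hom_j : star_hom j.
Proof. by case: hmin => _ sj _ _ _; exact: lrmorphism_star_hom. Qed.

Lemma comm_ij a b : i a * j b = j b * i a.
Proof. by case: hmin. Qed.

Lemma tensor_val_dense x e : 0 < e -> exists t, cnorm (x - tensor_val t) < e.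
Proof. by case: hmin => _ _ _ h _; exact: h. Qed.

Lemma tensor_val_spatial t c : 0 <= c -> cnorm (tensor_val t) <= c <-> spatial_norm_le t c.
Proof. by case: hmin => _ _ _ _; exact. Qed.

Lemma tensor_val_spatial_norm t : spatial_norm_le t (cnorm (tensor_val t)).
Proof. by apply/tensor_val_spatial; rewrite ?cnorm_ge0. Qed.

Lemma cnorm_tensor_val_swap t :
  cnorm (tensor_val [seq (p.2, p.1) | p <- t]) <= cnorm (tensor_val t).
Proof.
by apply/tensor_val_spatial; rewrite ?cnorm_ge0//;
  apply/spatial_norm_le_swap/tensor_val_spatial_norm.
Qed.

Lemma cnorm_tensor_val_comp (f : D -> D) t : star_hom f ->
  cnorm (tensor_val [seq (f p.1, p.2) | p <- t]) <= cnorm (tensor_val t).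
Proof.
move=> hf; apply/tensor_val_spatial; rewrite ?cnorm_ge0//.
exact/spatial_norm_le_comp/tensor_val_spatial_norm.
Qed.

(** pi a (x) rho 1 is the product of pi a (x) 1 and 1 (x) rho 1, and the latter is a contraction
    even when rho is degenerate. *)
Lemma cnorm_i_le a c : 0 <= c ->
  (forall (H : hilbert R) (pi : representation D H) x,
     hsq (pi a x) <= c ^+ 2 * hsq x) ->
  cnorm (i a) <= c.
Proof.
move=> c0 h; have -> : i a = tensor_val [:: (a, 1)].
  by rewrite /tensor_val big_seq1 rmorph1 mulr1.
apply/tensor_val_spatial/spatial_norm_leP => // H K pi rho s.
(* The flips bring [rho 1] to the first leg, where [tsq_rep_le] applies. *)
have -> : tensor_apply pi rho [:: (a, 1)] s = [seq (pi a u.1, u.2) | u <-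
    [seq (u.2, u.1) | u <- [seq (rho 1 u.1, u.2) | u <- [seq (u.2, u.1) | u <- s]]]].
  by rewrite /tensor_apply /= cats0 -!map_comp.
rewrite (le_trans (tsq_rep_le _ (sqr_ge0 c) (h H pi)))// ler_wpM2l ?sqr_ge0//.
rewrite /tsq tensor_sqnorm_swap -/(tsq _) -(tensor_sqnorm_swap s) -/(tsq _).
by rewrite (le_trans (@tsq_rep_le _ _ _ _ rho 1 1 _ _ _)) ?mul1r// => x; rewrite mul1r hsq_rep1.
Qed.

(** If 1 acted as zero in every representation of [D], then 1 (x) 1 would have spatial norm 0,
    whereas 1 is not 0 in [E]. *)
Lemma unit_vector : exists (K : hilbert R) (rho : representation D K) (xi : K),
  hsq xi = 1 /\ rho 1 xi = xi.
Proof.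
apply: contrapT => no.
have rho0 (K : hilbert R) (rho : representation D K) x : rho 1 x = 0.
  apply: hsq_eq0; apply/eqP; apply: contrapT => /negP xn; apply: no.
  have xp : 0 < hsq (rho 1 x) by rewrite lt_neqAle eq_sym xn hsq_ge0.
  pose a := Num.sqrt (hsq (rho 1 x)).
  have a0 : a != 0 by rewrite lt0r_neq0// sqrtr_gt0.
  have aa : a * a = hsq (rho 1 x) by rewrite -expr2 sqr_sqrtr// ltW.
  exists K, rho, ((a^-1)%:C%C *: rho 1 x); split.
    by rewrite /hsq rdotZl rdotZr -/(hsq _) -aa; field.
  by rewrite linearZ -repM mulr1.
have : cnorm (i 1) <= 0.
  by apply: cnorm_i_le => // H pi x; rewrite rho0 expr0n mul0r /hsq /rdot linear0l.
rewrite rmorph1 => n0; have /cnorm_eq0/eqP : cnorm (1 : E) = 0.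
  by apply/eqP; rewrite eq_le n0 cnorm_ge0.
by rewrite oner_eq0.
Qed.

(** The slice map id (x) omega for the functional omega(b) = <rho(b) x, y>. *)
Definition slice (K : hilbert R) (rho : representation D K) (x y : K)
    (t : seq (D * D)) : D := \sum_(p <- t) hdot K (rho p.2 x) y *: p.1.

(** The matrix of slices is the compression of (pi (x) rho)(t) to the tensor product of [H] with the
    span of [e]: apply the operator to the sum of the h_l (x) e_l and use Bessel's inequality on the
    result. *)
Lemma slice_mxbound (K : hilbert R) (rho : representation D K) (I : finType)
    (e : I -> K) t : orthonormal_family e ->
  mxbound (fun k l => slice rho (e l) (e k) t) (cnorm (tensor_val t)).
Proof.
move=> oe H pi h; pose s := [seq (h l, e l) | l <- enum I].
have /spatial_norm_leP/(_ H K pi rho s) := tensor_val_spatial_norm t.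
have -> : tsq s = \sum_k hsq (h k).
  rewrite /tsq (parseval oe) => [|u /mapP[l _ ->]]; last first.
    rewrite /= (bigD1 l)//= oe eqxx scale1r big1 ?addr0// => k kl.
    by rewrite oe eq_sym (negPf kl) scale0r.
  rewrite /=; apply: eq_bigr => k _; rewrite big_map big_enum /= (bigD1 k)//=.
  rewrite oe eqxx scale1r big1 ?addr0// => l lk.
  by rewrite oe (negPf lk) scale0r.
apply: le_trans; apply: le_trans (tensor_bessel _ oe).
rewrite le_eqVlt; apply/orP; left; apply/eqP; apply: eq_bigr => k _; congr hsq.
rewrite /tensor_apply big_allpairs_dep /= exchange_big big_map big_enum /=.
apply: eq_bigr => l _; rewrite /slice rep_sum; apply: eq_bigr => p _.
by rewrite repZ.
Qed.

Lemma slice_norm (K : hilbert R) (rho : representation D K) (xi : K) t :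
  hsq xi = 1 -> cnorm (i (slice rho xi xi t)) <= cnorm (tensor_val t).
Proof.
move=> xi1; apply: cnorm_i_le => [|H pi x]; first exact: cnorm_ge0.
have oe : orthonormal_family (fun _ : unit => xi) by move=> [] []; rewrite hdot_hsq xi1.
by have := slice_mxbound rho t oe pi (fun _ : unit => x);
  rewrite !big_const card_unit /= !addr0.
Qed.

End MinTensor.
Arguments tensor_val {R D E} i j t.

(** * Asymptotic homomorphisms and matrix norms *)

Lemma near_all (I : finType) (P : I -> nat -> Prop) :
  (forall k, \forall m \near \oo, P k m) -> \forall m \near \oo, forall k, P k m.
Proof. by move=> h; apply: filter_forall. Qed.

Lemma near_seq (X : eqType) (F : seq X) (P : X -> nat -> Prop) :
  (forall x, x \in F -> \forall m \near \oo, P x m) ->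
  \forall m \near \oo, forall x, x \in F -> P x m.
Proof.
elim: F => [|x F IHF] h; first by near=> m.
have hx : \forall m \near \oo, P x m by apply: h; rewrite mem_head.
have hF : \forall m \near \oo, forall y, y \in F -> P y m.
  by apply: IHF => y yF; apply: h; rewrite inE yF orbT.
near=> m => y; rewrite inE => /orP[/eqP ->|]; first by near: m.
by move: y; near: m.
Unshelve. all: by end_near. Qed.

Section Asymptotics.
Context {R : realType}.
Implicit Types A B C : cstarType R.

(** Equality modulo null sequences. *)
Definition aeq B (u v : nat -> B) : Prop :=
  forall e, 0 < e -> \forall m \near \oo, cnorm (u m - v m) < e.

Definition abd B (u : nat -> B) : Prop :=
  exists K, \forall m \near \oo, cnorm (u m) <= K.

Lemma abdW B (u : nat -> B) : abd u ->
  exists2 K, 0 < K & \forall m \near \oo, cnorm (u m) <= K.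
Proof.
move=> [K uK]; exists (`|K| + 1); first by rewrite ltr_wpDl.
apply: filterS uK => m /le_trans; apply.
by rewrite (le_trans (ler_norm _))// lerDl.
Qed.

Lemma aeq_refl B (u : nat -> B) : aeq u u.
Proof. by move=> e e0; near=> m; rewrite subrr cnorm0. Unshelve. all: by end_near. Qed.

Lemma aeq_sym B (u v : nat -> B) : aeq u v -> aeq v u.
Proof.
by move=> uv e e0; near=> m; rewrite cdistC; near: m; exact: uv.
Unshelve. all: by end_near. Qed.

Lemma aeq_trans B (v u w : nat -> B) : aeq u v -> aeq v w -> aeq u w.
Proof.
move=> uv vw e e0; have e2 : 0 < e / 2 by rewrite divr_gt0.
near=> m; rewrite (le_lt_trans (cdistD (v m) _ _))// (splitr e) ltrD//.
  by near: m; exact: uv.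
by near: m; exact: vw.
Unshelve. all: by end_near. Qed.

Lemma abd_aeq B (u v : nat -> B) : aeq u v -> abd u -> abd v.
Proof.
move=> uv [K uK]; exists (K + 1); near=> m.
rewrite -(subrK (u m) (v m)) addrC (le_trans (cnormD _ _))// lerD//.
  by near: m.
by rewrite cdistC ltW//; near: m; exact: uv.
Unshelve. all: by end_near. Qed.

Lemma aeqD B (u v u' v' : nat -> B) : aeq u u' -> aeq v v' ->
  aeq (fun m => u m + v m) (fun m => u' m + v' m).
Proof.
move=> uu vv e e0; have e2 : 0 < e / 2 by rewrite divr_gt0.
near=> m; rewrite opprD addrACA (le_lt_trans (cnormD _ _))// (splitr e) ltrD//.
  by near: m; exact: uu.
by near: m; exact: vv.
Unshelve. all: by end_near. Qed.

Lemma aeqZ B (z : R[i]) (u v : nat -> B) : aeq u v ->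
  aeq (fun m => z *: u m) (fun m => z *: v m).
Proof.
move=> uv e e0; have z1 : 0 < complex.Re `|z| + 1 by rewrite ltr_wpDl ?Re_norm_ge0.
near=> m; rewrite -scalerBr cnormZ.
have : cnorm (u m - v m) < e / (complex.Re `|z| + 1).
  by near: m; apply: uv; rewrite divr_gt0.
rewrite ltr_pdivlMr// mulrC; apply: le_lt_trans.
by rewrite ler_wpM2r ?cnorm_ge0// lerDl.
Unshelve. all: by end_near. Qed.

Lemma aeqN B (u v : nat -> B) : aeq u v -> aeq (fun m => - u m) (fun m => - v m).
Proof.
by move=> uv e e0; near=> m; rewrite -opprD cnormN; near: m; exact: uv.
Unshelve. all: by end_near. Qed.

Lemma aeq_star B (u v : nat -> B) : aeq u v ->
  aeq (fun m => star (u m)) (fun m => star (v m)).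
Proof.
by move=> uv e e0; near=> m; rewrite -starB cnorm_starE; near: m; exact: uv.
Unshelve. all: by end_near. Qed.

Lemma aeqM B (u v u' v' : nat -> B) : abd u -> abd v' -> aeq u u' -> aeq v v' ->
  aeq (fun m => u m * v m) (fun m => u' m * v' m).
Proof.
move=> /abdW[K K0 uK] /abdW[L L0 vL] uu vv e e0.
have e2 : 0 < e / 2 by rewrite divr_gt0.
near=> m; rewrite (le_lt_trans (cdistM _ _ _ _))// (splitr e) ltrD//.
  have : cnorm (v m - v' m) < e / 2 / K by near: m; apply: vv; rewrite divr_gt0.
  rewrite ltr_pdivlMr// mulrC; apply: le_lt_trans.
  by rewrite ler_wpM2r ?cnorm_ge0//; near: m.
have : cnorm (u m - u' m) < e / 2 / L by near: m; apply: uu; rewrite divr_gt0.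
rewrite ltr_pdivlMr//; apply: le_lt_trans.
by rewrite ler_wpM2l ?cnorm_ge0//; near: m.
Unshelve. all: by end_near. Qed.

Lemma abdM B (u v : nat -> B) : abd u -> abd v -> abd (fun m => u m * v m).
Proof.
move=> /abdW[K K0 uK] /abdW[L L0 vL]; exists (K * L); near=> m.
rewrite (le_trans (cnormM _ _))// ler_pM ?cnorm_ge0//; by near: m.
Unshelve. all: by end_near. Qed.

Lemma abdD B (u v : nat -> B) : abd u -> abd v -> abd (fun m => u m + v m).
Proof.
move=> [K uK] [L vL]; exists (K + L); near=> m.
rewrite (le_trans (cnormD _ _))// lerD//; by near: m.
Unshelve. all: by end_near. Qed.

Lemma abd_star B (u : nat -> B) : abd u -> abd (fun m => star (u m)).
Proof.
by move=> [K uK]; exists K; near=> m; rewrite cnorm_starE; near: m.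
Unshelve. all: by end_near. Qed.

Lemma abd_cst B (x : B) : abd (fun=> x).
Proof. by exists (cnorm x); near=> m. Unshelve. all: by end_near. Qed.

Lemma aeq_sum B I (r : seq I) (F G : I -> nat -> B) :
  (forall k, aeq (F k) (G k)) ->
  aeq (fun m => \sum_(k <- r) F k m) (fun m => \sum_(k <- r) G k m).
Proof.
move=> FG; elim: r => [|k r IHr].
  by move=> e e0; near=> m; rewrite !big_nil subrr cnorm0.
apply: aeq_trans (aeq_trans (aeqD (FG k) IHr) _);
  by move=> e e0; near=> m; rewrite big_cons subrr cnorm0.
Unshelve. all: by end_near. Qed.

Lemma abd_sum B I (r : seq I) (F : I -> nat -> B) :
  (forall k, abd (F k)) -> abd (fun m => \sum_(k <- r) F k m).
Proof.
move=> Fb; elim: r => [|k r IHr].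
  by exists 0; near=> m; rewrite big_nil cnorm0.
have [K FK] := abdD (Fb k) IHr.
by exists K; near=> m; rewrite big_cons; near: m.
Unshelve. all: by end_near. Qed.

Lemma aeq_norm B (u v : nat -> B) K : aeq u v ->
  (forall e, 0 < e -> \forall m \near \oo, cnorm (u m) <= K + e) ->
  forall e, 0 < e -> \forall m \near \oo, cnorm (v m) <= K + e.
Proof.
move=> uv uK e e0; have e2 : 0 < e / 2 by rewrite divr_gt0.
near=> m; rewrite -(subrK (u m) (v m)) addrC (le_trans (cnormD _ _))//.
rewrite (splitr e) addrA lerD//; first by near: m; exact: uK.
by rewrite cdistC ltW//; near: m; exact: uv.
Unshelve. all: by end_near. Qed.

(** A unital contractive homomorphism into the bounded sequences modulo null sequences. No single
    [w m] is required to be linear or bounded. *)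
Record asymptotic_hom A B (w : nat -> A -> B) : Prop := AsymptoticHom {
  ahomD : forall x y, aeq (fun m => w m (x + y)) (fun m => w m x + w m y);
  ahomZ : forall (z : R[i]) x, aeq (fun m => w m (z *: x)) (fun m => z *: w m x);
  ahomM : forall x y, aeq (fun m => w m (x * y)) (fun m => w m x * w m y);
  ahom1 : aeq (fun m => w m 1) (fun=> 1);
  ahom_star : forall x, aeq (fun m => w m (star x)) (fun m => star (w m x));
  ahom_norm : forall x e, 0 < e ->
    \forall m \near \oo, cnorm (w m x) <= cnorm x + e }.

Lemma shom_asymptotic A B (f : A -> B) : star_hom f -> asymptotic_hom (fun=> f).
Proof.
move=> hf; split.
- by move=> x y; rewrite (shomD hf); exact: aeq_refl.
- by move=> z x; rewrite (shomZ hf); exact: aeq_refl.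
- by move=> x y; rewrite (shomM hf); exact: aeq_refl.
- by rewrite (shom1 hf); exact: aeq_refl.
- by move=> x; rewrite (shom_star hf); exact: aeq_refl.
- move=> x e e0; near=> m.
  by rewrite (le_trans (shom_norm _ hf))// lerDl ltW.
Unshelve. all: by end_near. Qed.

Lemma shom_comp_asymptotic A B C (f : B -> C) (w : nat -> A -> B) :
  star_hom f -> asymptotic_hom w -> asymptotic_hom (fun m x => f (w m x)).
Proof.
move=> hf hw.
have fa u v : aeq u v -> aeq (fun m => f (u m)) (fun m => f (v m)).
  move=> uv e e0; near=> m; rewrite -(shomB hf) (le_lt_trans (shom_norm _ hf))//.
  by near: m; exact: uv.
split.
- move=> x y; apply: aeq_trans (fa _ _ (ahomD hw x y)) _.
  by move=> e e0; near=> m; rewrite (shomD hf) subrr cnorm0.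
- move=> z x; apply: aeq_trans (fa _ _ (ahomZ hw z x)) _.
  by move=> e e0; near=> m; rewrite (shomZ hf) subrr cnorm0.
- move=> x y; apply: aeq_trans (fa _ _ (ahomM hw x y)) _.
  by move=> e e0; near=> m; rewrite (shomM hf) subrr cnorm0.
- apply: aeq_trans (fa _ _ (ahom1 hw)) _.
  by move=> e e0; near=> m; rewrite (shom1 hf) subrr cnorm0.
- move=> x; apply: aeq_trans (fa _ _ (ahom_star hw x)) _.
  by move=> e e0; near=> m; rewrite (shom_star hf) subrr cnorm0.
- move=> x e e0; near=> m; rewrite (le_trans (shom_norm _ hf))//.
  by near: m; exact: (ahom_norm hw).
Unshelve. all: by end_near. Qed.

Section Theory.
Context {A B : cstarType R} {w : nat -> A -> B} (hw : asymptotic_hom w).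

Lemma ahom_bd x : abd (w^~ x).
Proof. by exists (cnorm x + 1); apply: (ahom_norm hw). Qed.

Lemma ahom0 : aeq (w^~ 0) (fun=> 0).
Proof.
move=> e e0; near=> m; rewrite subr0.
have : cnorm (w m 0) <= cnorm (0 : A) + e / 2.
  by near: m; apply: (ahom_norm hw); rewrite divr_gt0.
move=> /le_lt_trans; apply; rewrite cnorm0 add0r ltr_pdivrMr//.
by rewrite ltr_pMr// ltr1n.
Unshelve. all: by end_near. Qed.

Lemma ahom_sum I (r : seq I) (F : I -> A) :
  aeq (fun m => w m (\sum_(k <- r) F k)) (fun m => \sum_(k <- r) w m (F k)).
Proof.
elim: r => [|k r IHr].
  move=> e e0; near=> m; rewrite !big_nil.
  by near: m; exact: ahom0.
rewrite big_cons; apply: aeq_trans (ahomD hw _ _) _.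
apply: aeq_trans (aeqD (aeq_refl _) IHr) _.
by move=> e e0; near=> m; rewrite big_cons subrr cnorm0.
Unshelve. all: by end_near. Qed.

End Theory.
End Asymptotics.

(** * Norms of matrices, computed from norms of finitely many elements *)

Section MatrixNorm.
Context {R : realType} {I : finType}.

Definition madj (A : cstarType R) (a : I -> I -> A) k l : A := star (a l k).

Definition mmul (A : cstarType R) (a b : I -> I -> A) k l : A :=
  \sum_(p <- enum I) a k p * b p l.

Fixpoint mpow2 (A : cstarType R) (a : I -> I -> A) N : I -> I -> A :=
  if N is N'.+1 then mmul (mpow2 a N') (mpow2 a N') else mmul (madj a) a.

Definition mact (A : cstarType R) (H : hilbert R) (pi : representation A H)
  (a : I -> I -> A) (h : I -> H) k : H := \sum_l pi (a k l) (h l).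

Definition fsq (H : hilbert R) (h : I -> H) : R := \sum_k hsq (h k).

Lemma fsq_ge0 (H : hilbert R) (h : I -> H) : 0 <= fsq h.
Proof. by apply: sumr_ge0 => k _; exact: hsq_ge0. Qed.

Section Fixed.
Context {A : cstarType R}.
Implicit Types a b : I -> I -> A.

Lemma mact_mmul (H : hilbert R) (pi : representation A H) a b h :
  mact pi (mmul a b) h = mact pi a (mact pi b h).
Proof.
apply/funext => k; rewrite /mact; under eq_bigr do rewrite rep_sum.
rewrite exchange_big /= big_enum; apply: eq_bigr => p _.
by rewrite linear_sum /=; apply: eq_bigr => l _; rewrite repM.
Qed.

Lemma mact_madj (H : hilbert R) (pi : representation A H) a h h' :
  \sum_k rdot (mact pi (madj a) h k) (h' k) = \sum_k rdot (h k) (mact pi a h' k).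
Proof.
rewrite /mact; under eq_bigr do rewrite rdot_suml.
rewrite exchange_big /=; apply: eq_bigr => l _; rewrite rdot_sumr.
by apply: eq_bigr => k _; rewrite rep_rdot starK.
Qed.

Lemma madjK a : madj (madj a) = a.
Proof. by apply/funext => k; apply/funext => l; rewrite /madj starK. Qed.

Lemma madj_mmul a b : madj (mmul a b) = mmul (madj b) (madj a).
Proof.
apply/funext => k; apply/funext => l; rewrite /madj /mmul star_sum.
by apply: eq_bigr => p _; rewrite starM.
Qed.

Lemma madj_mpow2 a N : madj (mpow2 a N) = mpow2 a N.
Proof. by elim: N => [|N IHN] /=; rewrite madj_mmul ?IHN ?madjK. Qed.

Lemma fsq_mact_adj (H : hilbert R) (pi : representation A H) a h :
  fsq (mact pi a h) ^+ 2 <= fsq (mact pi (mmul (madj a) a) h) * fsq h.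
Proof.
apply: le_trans (hdots_CS _ _); rewrite mact_mmul mact_madj /fsq.
by rewrite le_eqVlt; apply/orP; left; apply/eqP.
Qed.

Lemma mxbound_fsq a r : mxbound a r <->
  forall (H : hilbert R) (pi : representation A H) h,
    fsq (mact pi a h) <= r ^+ 2 * fsq h.
Proof. by []. Qed.

Lemma le_mul_of_sqr_le (x r y : R) : 0 <= x -> 0 <= r -> 0 <= y ->
  x ^+ 2 <= r ^+ 2 * y * y -> x <= r * y.
Proof.
move=> x0 r0 y0; rewrite -mulrA -expr2 -exprMn ler_pXn2r ?nnegrE//.
exact: mulr_ge0.
Qed.

(** With x = ||a* h||^2, [fsq_mact_adj] gives x^2 <= ||a a* h||^2 ||h||^2 <= r^2 x ||h||^2, and x
    cancels. *)
Lemma mxbound_adj a r : 0 <= r -> mxbound a r -> mxbound (madj a) r.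
Proof.
move=> r0 ar H pi h; rewrite -/(mact pi _ h _) -!/(fsq _).
have := fsq_mact_adj pi (madj a) h; rewrite madjK mact_mmul => h1.
have h2 := ar H pi (mact pi (madj a) h); rewrite -!/(fsq _) in h2.
have {h1 h2} := le_trans h1 (ler_wpM2r (fsq_ge0 h) h2).
rewrite -/(fsq (mact pi (madj a) h)).
set x := fsq _; set y := fsq h => hx.
have [x0|xn] := eqVneq x 0; first by rewrite x0 mulr_ge0 ?sqr_ge0 ?fsq_ge0.
have xp : 0 < x by rewrite lt_neqAle eq_sym xn fsq_ge0.
by rewrite -(ler_pM2l xp) -expr2 mulrCA mulrA.
Qed.

Lemma mxbound_mul a b r s : mxbound a r -> mxbound b s ->
  mxbound (mmul a b) (r * s).
Proof.
move=> /mxbound_fsq ar /mxbound_fsq bs; apply/mxbound_fsq => H pi h.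
rewrite mact_mmul (le_trans (ar _ _ _))// (_ : (r * s) ^+ 2 * _ = r ^+ 2 * (s ^+ 2 * fsq h)).
  by rewrite ler_wpM2l ?sqr_ge0.
by ring.
Qed.

Lemma mxbound_mpow2 a r N : 0 <= r -> mxbound a r ->
  mxbound (mpow2 a N) (r ^+ (2 ^ N.+1)).
Proof.
move=> r0 ar; elim: N => [|N IHN] /=.
  by rewrite expn1 expr2; apply: mxbound_mul => //; exact: mxbound_adj.
by rewrite expnS mul2n -addnn exprD; exact: mxbound_mul.
Qed.

Lemma hsq_sum_le (H : hilbert R) (h : I -> H) :
  hsq (\sum_k h k) <= #|I|%:R * fsq h.
Proof.
set y := \sum_k _; have [y0|yn] := eqVneq (hsq y) 0.
  by rewrite y0 mulr_ge0 ?fsq_ge0.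
have yp : 0 < hsq y by rewrite lt_neqAle eq_sym yn hsq_ge0.
have := hdots_CS h (fun=> y); rewrite -rdot_suml -/y -/(hsq y) -/(fsq h).
rewrite sumr_const -[hsq y *+ _]mulr_natl mulrA expr2 ler_pM2r//.
by rewrite mulrC.
Qed.

Lemma fsq_mact_entry (H : hilbert R) (pi : representation A H) a M h :
  0 <= M -> (forall k l, cnorm (a k l) <= M) ->
  fsq (mact pi a h) <= (#|I|%:R * M) ^+ 2 * fsq h.
Proof.
move=> M0 aM; rewrite {1}/fsq.
apply: (@le_trans _ _ (\sum_(k : I) #|I|%:R * (M ^+ 2 * fsq h))).
  apply: ler_sum => k _; rewrite (le_trans (hsq_sum_le _))// ler_wpM2l//.
  rewrite /fsq mulr_sumr; apply: ler_sum => l _.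
  rewrite (le_trans (hsq_rep_le _ _ _))// ler_wpM2r ?hsq_ge0//.
  by rewrite ler_pXn2r ?nnegrE ?cnorm_ge0.
rewrite sumr_const -[X in X <= _]mulr_natl le_eqVlt; apply/orP; left; apply/eqP.
by rewrite exprMn expr2 !mulrA.
Qed.

(* The norm of a is the 2^(N+1)-th root of that of (a* a)^(2^N), so the factor #|I|
   lost in passing from entries to the norm disappears as N grows. *)
Lemma mxbound_of_mpow2 a s M N : 0 <= s -> 0 <= M ->
  (forall k l, cnorm (mpow2 a N k l) <= M) ->
  #|I|%:R * M <= s ^+ (2 ^ N.+1) -> mxbound a s.
Proof.
move=> s0 M0 aM Ms; apply/mxbound_fsq => H pi h.
suff : fsq (mact pi (mpow2 a 0) h) <= (s ^+ 2) ^+ 2 * fsq h.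
  move=> b; apply: le_mul_of_sqr_le; rewrite ?fsq_ge0 ?sqr_ge0//.
  exact: le_trans (fsq_mact_adj pi a h) (ler_wpM2r (fsq_ge0 h) b).
have : fsq (mact pi (mpow2 a N) h) <= (s ^+ (2 ^ N.+1)) ^+ 2 * fsq h.
  rewrite (le_trans (fsq_mact_entry _ _ M0 aM))// ler_wpM2r ?fsq_ge0//.
  by rewrite ler_pXn2r ?nnegrE ?mulr_ge0 ?exprn_ge0.
(* Descent to the zeroth power: [mpow2 a N] is self-adjoint with square [mpow2 a N.+1], so each step
   halves the exponent of [s]. *)
elim: N {aM Ms} => [|N IHN]; first by rewrite expn1.
move=> b; apply: IHN; apply: le_mul_of_sqr_le; rewrite ?fsq_ge0 ?exprn_ge0//.
rewrite (le_trans (fsq_mact_adj _ _ _))// madj_mpow2 ler_wpM2r ?fsq_ge0//.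
by rewrite (le_trans b)// expnSr exprM.
Qed.

End Fixed.

(** The representations of [A] determine its norm, as in the Gelfand-Naimark theorem. *)
Definition norming (A : cstarType R) : Prop := forall (a : A) c, 0 <= c ->
  (forall (H : hilbert R) (pi : representation A H) x,
     hsq (pi a x) <= c ^+ 2 * hsq x) -> cnorm a <= c.

Lemma mxbound_entry (A : cstarType R) (a : I -> I -> A) r k l : norming A ->
  0 <= r -> mxbound a r -> cnorm (a k l) <= r.
Proof.
move=> nA r0 ar; apply: nA => // H pi x.
have := ar H pi (fun l' => if l' == l then x else 0).
have -> : \sum_l' hsq (if l' == l then x else 0) = hsq x.
  rewrite (bigD1 l)//= eqxx big1 ?addr0// => l' /negPf ->.
  by rewrite /hsq /rdot linear0l.
apply: le_trans; rewrite (bigD1 k)//= (bigD1 l)//= eqxx big1 => [|l' /negPf ->].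
  by rewrite addr0 lerDl sumr_ge0// => k' _; exact: hsq_ge0.
by rewrite linear0.
Qed.

Section Asymptotic.
Context {A B : cstarType R} {w : nat -> A -> B}.
Hypothesis hw : asymptotic_hom w.

Lemma aeq_madj (a : I -> I -> A) (b : nat -> I -> I -> B) :
  (forall k l, aeq (fun m => b m k l) (w^~ (a k l))) ->
  forall k l, aeq (fun m => madj (b m) k l) (w^~ (madj a k l)).
Proof.
move=> ab k l; apply: aeq_trans (aeq_star (ab l k)) _.
exact/aeq_sym/(ahom_star hw).
Qed.

Lemma aeq_mmul (a a' : I -> I -> A) (b b' : nat -> I -> I -> B) :
  (forall k l, aeq (fun m => b m k l) (w^~ (a k l))) ->
  (forall k l, aeq (fun m => b' m k l) (w^~ (a' k l))) ->
  forall k l, aeq (fun m => mmul (b m) (b' m) k l) (w^~ (mmul a a' k l)).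
Proof.
move=> ab ab' k l; apply: aeq_trans (aeq_sym (ahom_sum hw _ _)).
apply: aeq_sum => p; apply: aeq_trans (aeq_sym (ahomM hw _ _)).
apply: aeqM => //; last exact: ahom_bd.
exact: abd_aeq (aeq_sym (ab k p)) (ahom_bd hw _).
Qed.

Lemma aeq_mpow2 (a : I -> I -> A) (b : nat -> I -> I -> B) N :
  (forall k l, aeq (fun m => b m k l) (w^~ (a k l))) ->
  forall k l, aeq (fun m => mpow2 (b m) N k l) (w^~ (mpow2 a N k l)).
Proof.
move=> ab; elim: N => [|N IHN]; last exact: aeq_mmul.
exact: aeq_mmul (aeq_madj ab) ab.
Qed.

(** For a fixed N, the entries of [mpow2 (b m) N] follow the images under [w m] of those of
    [mpow2 a N], whose norms are at most r^(2^(N+1)). These are finitely many elements of [A], so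
    pointwise asymptotic contractivity of [w] is enough. *)
Lemma mxbound_asymptotic (a : I -> I -> A) (b : nat -> I -> I -> B) r e :
  norming A -> 0 <= r -> 0 < e -> mxbound a r ->
  (forall k l, aeq (fun m => b m k l) (w^~ (a k l))) ->
  \forall m \near \oo, mxbound (b m) (r + e).
Proof.
move=> nA r0 e0 ar ab; have re : 0 < r + e by rewrite ltr_wpDl.
(* N is chosen so large that the slack e, raised to the power 2^(N+1), absorbs the dimension factor;
   the successor keeps that factor positive when I is empty. *)
have [N rN] : exists N, #|I|.+1%:R * r ^+ (2 ^ N.+1) < (r + e) ^+ (2 ^ N.+1).
  have : (fun n => #|I|.+1%:R * (r / (r + e)) ^+ n) @ \oo --> (0 : R).
    rewrite -(mulr0 #|I|.+1%:R); apply: cvgMr; apply: cvg_expr.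
    rewrite ger0_norm; last by rewrite divr_ge0// ltW.
    by rewrite ltr_pdivrMr// mul1r ltrDl.
  move/cvgr0Pnorm_lt => /(_ 1 ltr01)[N _ NP]; exists N.
  have /NP : (N <= 2 ^ N.+1)%N by rewrite (leq_trans (leqnSn N))// ltnW// ltn_expl.
  rewrite /= ger0_norm; last by rewrite mulr_ge0// exprn_ge0// divr_ge0// ltW.
  by rewrite expr_div_n mulrA ltr_pdivrMr ?exprn_gt0// mul1r.
pose P := (2 ^ N.+1)%N; pose M := (r + e) ^+ P / #|I|.+1%:R.
have rM : r ^+ P < M by rewrite ltr_pdivlMr// mulrC.
have M0 : 0 <= M by rewrite divr_ge0// exprn_ge0// ltW.
have : \forall m \near \oo, forall k l, cnorm (mpow2 (b m) N k l) <= M.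
  apply: near_all => k; apply: near_all => l.
  have d0 : 0 < M - r ^+ P by rewrite subr_gt0.
  rewrite -(subrK (r ^+ P) M) addrC.
  apply: aeq_norm (aeq_sym (aeq_mpow2 N ab k l)) _ _ d0 => e' e'0.
  near=> m; have : cnorm (w m (mpow2 a N k l)) <= cnorm (mpow2 a N k l) + e'.
    by near: m; exact: (ahom_norm hw).
  move/le_trans; apply; rewrite lerD2r.
  by apply: mxbound_entry => //; [rewrite exprn_ge0|exact: mxbound_mpow2].
apply: filterS => m bM; apply: (@mxbound_of_mpow2 _ _ _ M N) => //; first exact: ltW.
rewrite /M mulrA ler_pdivrMr// mulrC ler_wpM2l ?exprn_ge0// ?(ltW re)//.
by rewrite ler_nat.
Unshelve. all: by end_near. Qed.

End Asymptotic.
End MatrixNorm.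

(** * Approximate unitary equivalence *)

Section UnitaryEquivalence.
Context {R : realType}.

Definition uclose (B : cstarType R) (X : eqType) (F : seq X) e (f g : X -> B) :
  Prop := exists u, unitary u /\
    forall x, x \in F -> cnorm (u * f x * star u - g x) < e.

(** Finite sets and tolerances replace the sequence of unitaries, because [transfer] yields a
    unitary for one finite set at a time. *)
Definition aue (B : cstarType R) (X : eqType) (f g : X -> B) : Prop :=
  forall (F : seq X) e, 0 < e -> uclose F e f g.

Section Theory.
Context {B : cstarType R} {X : eqType}.
Implicit Types (f g h : X -> B) (F : seq X).

Lemma uclose_sym F e f g : uclose F e f g -> uclose F e g f.
Proof.
move=> [u [uu fg]]; exists (star u); split=> [|x xF]; first exact: unitary_star.
rewrite starK -(cnorm_unitaryl _ uu) -(cnorm_unitaryr _ (unitary_star uu)).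
rewrite mulrBr mulrBl !mulrA (proj2 uu) mul1r -(mulrA (g x)) (proj2 uu) mulr1.
by rewrite cdistC; exact: fg.
Qed.

Lemma uclose_trans F e e' g f h :
  uclose F e f g -> uclose F e' g h -> uclose F (e + e') f h.
Proof.
move=> [u [uu fg]] [v [uv gh]]; exists (v * u).
split=> [|x xF]; first exact: unitaryM.
apply: (le_lt_trans (cdistD (v * g x * star v) _ _)); rewrite ltrD ?gh//.
rewrite starM; have -> : v * u * f x * (star u * star v) - v * g x * star v =
    v * (u * f x * star u - g x) * star v by rewrite mulrBr mulrBl !mulrA.
by rewrite (cnorm_unitaryr _ (unitary_star uv)) cnorm_unitaryl ?fg.
Qed.

Lemma aue_sym f g : aue f g -> aue g f.
Proof. by move=> fg F e e0; apply: uclose_sym; exact: fg. Qed.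

Lemma aue_trans g f h : aue f g -> aue g h -> aue f h.
Proof.
move=> fg gh F e e0; have e2 : 0 < e / 2 by rewrite divr_gt0.
by rewrite (splitr e); apply: uclose_trans; [exact: fg|exact: gh].
Qed.

Lemma uclose_post (B' : cstarType R) (a : B -> B') F e f g : star_hom a ->
  uclose F e f g -> uclose F e (a \o f) (a \o g).
Proof.
move=> ha [u [uu fg]]; exists (a u); split=> [|x xF]; first exact: shom_unitary.
rewrite /= -(shom_star ha) -!(shomM ha) -(shomB ha).
exact: le_lt_trans (shom_norm _ ha) (fg x xF).
Qed.

Lemma aue_post (B' : cstarType R) (a : B -> B') f g : star_hom a ->
  aue f g -> aue (a \o f) (a \o g).
Proof. by move=> ha fg F e e0; apply: uclose_post => //; exact: fg. Qed.

Lemma uclose_pre (Y : eqType) (a : Y -> X) (F : seq Y) e f g :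
  uclose (map a F) e f g -> uclose F e (f \o a) (g \o a).
Proof.
move=> [u [uu fg]]; exists u; split=> // x xF; apply: fg; exact: map_f.
Qed.

Lemma aue_pre (Y : eqType) (a : Y -> X) f g : aue f g -> aue (f \o a) (g \o a).
Proof. by move=> fg F e e0; apply: uclose_pre; exact: fg. Qed.

End Theory.
End UnitaryEquivalence.

(** * Compression of a matrix by a column *)

Section Schur.
Context {R : realType} {E : cstarType R} (nE : norming E).

Lemma fsq_rep_le (I : finType) (H : hilbert R) (pi : representation E H)
    (y : I -> E) x :
  fsq (fun k => pi (y k) x) <= cnorm (\sum_k star (y k) * y k) * hsq x.
Proof.
set s := \sum_k _; have sx : fsq (fun k => pi (y k) x) = rdot (pi s x) x.
  rewrite rep_sum rdot_suml; apply: eq_bigr => k _; exact: hsq_rep.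
apply: le_mul_of_sqr_le; rewrite ?fsq_ge0 ?cnorm_ge0 ?hsq_ge0//.
rewrite sx (le_trans (rdot_CS _ _))// ler_wpM2r ?hsq_ge0//.
exact: hsq_rep_le.
Qed.

(** For the column y this is ||y* c y|| <= ||c|| ||y||^2, with ||y||^2 = ||y* y||. Put x = Y h;
    Cauchy-Schwarz applied to ||x||^2 = <c (y h), y x> leaves a factor ||x||^2 on both sides. *)
Lemma schur_bound (I : finType) (c : I -> I -> E) (y : I -> E) r : 0 <= r ->
  mxbound c r ->
  cnorm (\sum_k \sum_l star (y k) * c k l * y l) <=
    r * cnorm (\sum_k star (y k) * y k).
Proof.
move=> r0 cr; set s := cnorm (\sum_k star (y k) * y k); set Y := \sum_k _.
have s0 : 0 <= s := cnorm_ge0 _.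
apply: nE => [|H pi h]; first by rewrite mulr_ge0.
pose x := pi Y h.
have xx : hsq x = \sum_k rdot (mact pi c (fun l => pi (y l) h) k) (pi (y k) x).
  rewrite {1}/hsq {1}/x rep_sum rdot_suml; apply: eq_bigr => k _.
  rewrite rep_sum /mact !rdot_suml; apply: eq_bigr => l _.
  by rewrite !repM rep_rdot starK.
have : hsq x ^+ 2 <= (r ^+ 2 * (s * hsq h)) * (s * hsq x).
  rewrite {1}xx (le_trans (hdots_CS _ _))// ler_pM//; try exact: fsq_ge0.
    rewrite (le_trans (cr H pi _))// ler_wpM2l ?sqr_ge0//.
    exact: fsq_rep_le.
  exact: fsq_rep_le.
rewrite -/x; have [->|xn] := eqVneq (hsq x) 0.
  by rewrite mulr_ge0 ?sqr_ge0 ?hsq_ge0.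
have xp : 0 < hsq x by rewrite lt_neqAle eq_sym xn hsq_ge0.
rewrite mulrA expr2 ler_pM2r// => /le_trans; apply.
by rewrite le_eqVlt; apply/orP; left; apply/eqP; ring.
Qed.

End Schur.

Lemma commutator_perturb (B : nzRingType) (v z a b : B) :
  v * a - b * v = (z * a - b * z) + ((v - z) * a - b * (v - z)).
Proof. by rewrite mulrBl mulrBr opprB addrACA addKr [z * a + _]addrC subrK. Qed.

(** * Transfer of intertwining unitaries through finite tensor sums *)

Section Transfer.
Context {R : realType} {D E : cstarType R} {i j : {lrmorphism D -> E}}.
Hypothesis hmin : is_min_tensor i j.

Definition tmul (A : cstarType R) (s t : seq (A * A)) : seq (A * A) :=
  [seq (p.1 * q.1, p.2 * q.2) | p <- s, q <- t].

Definition tstar (A : cstarType R) (t : seq (A * A)) : seq (A * A) :=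
  [seq (star p.1, star p.2) | p <- t].

(** The map a (x) b |-> f_m(a) g_m(b), taken on lists: since [f m] and [g m] need not be linear, it
    does not descend to tensors. *)
Definition theta (B : cstarType R) (f g : nat -> D -> B) m (t : seq (D * D)) : B :=
  \sum_(p <- t) f m p.1 * g m p.2.

(** Exact rules for [tensor_val] are read off from the asymptotic rules for [theta], applied to the
    constant sequences [i] and [j]. *)
Lemma aeq_cst (B : cstarType R) (x y : B) : aeq (fun=> x) (fun=> y) -> x = y.
Proof.
move=> xy; apply/eqP; rewrite -subr_eq0; apply/eqP; apply: (@cnorm_small0 _ _ 1) => e e0.
by have [N _ /(_ N)] := xy e e0; rewrite mul1r => h; rewrite ltW// h /=.
Qed.

Section Theta.
Context {B : cstarType R} {f g : nat -> D -> B}.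
Hypotheses (hf : asymptotic_hom f) (hg : asymptotic_hom g).
Hypothesis fg : forall a b,
  aeq (fun m => f m a * g m b) (fun m => g m b * f m a).

Lemma theta_cat m s t : theta f g m (s ++ t) = theta f g m s + theta f g m t.
Proof. by rewrite /theta big_cat. Qed.

Lemma aeq_theta_mul s t :
  aeq (fun m => theta f g m (tmul s t)) (fun m => theta f g m s * theta f g m t).
Proof.
have -> : (fun m => theta f g m s * theta f g m t) = (fun m =>
    \sum_(p <- s) \sum_(q <- t) (f m p.1 * g m p.2) * (f m q.1 * g m q.2)).
  apply/funext => m; rewrite mulr_suml; apply: eq_bigr => p _.
  by rewrite mulr_sumr.
have -> : (fun m => theta f g m (tmul s t)) = (fun m =>
    \sum_(p <- s) \sum_(q <- t) f m (p.1 * q.1) * g m (p.2 * q.2)).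
  by apply/funext => m; rewrite /theta /tmul big_allpairs_dep.
apply: aeq_sum => p; apply: aeq_sum => q.
apply: (aeq_trans (aeqM (ahom_bd hf _) (abdM (ahom_bd hg _) (ahom_bd hg _))
  (ahomM hf _ _) (ahomM hg _ _))).
have -> : (fun m => f m p.1 * f m q.1 * (g m p.2 * g m q.2)) =
    (fun m => f m p.1 * (f m q.1 * g m p.2 * g m q.2)).
  by apply/funext => m; rewrite !mulrA.
have -> : (fun m => f m p.1 * g m p.2 * (f m q.1 * g m q.2)) =
    (fun m => f m p.1 * (g m p.2 * f m q.1 * g m q.2)).
  by apply/funext => m; rewrite !mulrA.
apply: aeqM; [exact: ahom_bd| |exact: aeq_refl|].
  by apply: abdM; [apply: abdM|]; apply: ahom_bd.
by apply: aeqM; [apply: abdM| | |exact: aeq_refl]; try exact: ahom_bd; exact: fg.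
Qed.

Lemma aeq_theta_star t :
  aeq (fun m => theta f g m (tstar t)) (fun m => star (theta f g m t)).
Proof.
have -> : (fun m => star (theta f g m t)) = (fun m =>
    \sum_(p <- t) star (g m p.2) * star (f m p.1)).
  by apply/funext => m; rewrite star_sum; apply: eq_bigr => p _; rewrite starM.
have -> : (fun m => theta f g m (tstar t)) = (fun m =>
    \sum_(p <- t) f m (star p.1) * g m (star p.2)).
  by apply/funext => m; rewrite /theta big_map.
apply: aeq_sum => p; apply: aeq_trans (fg _ _) _.
by apply: aeqM; [exact: ahom_bd|apply/abd_star/ahom_bd|exact: ahom_star|exact: ahom_star].
Qed.

Lemma abd_theta t : abd (fun m => theta f g m t).
Proof. by apply: abd_sum => p; apply: abdM; exact: ahom_bd. Qed.

Lemma aeq_theta_l a : aeq (fun m => theta f g m [:: (a, 1)]) (f^~ a).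
Proof.
have -> : (fun m => theta f g m [:: (a, 1)]) = (fun m => f m a * g m 1).
  by apply/funext => m; rewrite /theta big_seq1.
have -> : f^~ a = (fun m => f m a * 1) by apply/funext => m; rewrite mulr1.
by apply: aeqM; [exact: ahom_bd|exact: abd_cst|exact: aeq_refl|exact: ahom1].
Qed.

Lemma aeq_theta_r b : aeq (fun m => theta f g m [:: (-1, b)]) (fun m => - g m b).
Proof.
have -> : (fun m => theta f g m [:: (-1, b)]) = (fun m => f m (- 1) * g m b).
  by apply/funext => m; rewrite /theta big_seq1.
have -> : (fun m => - g m b) = (fun m => (-1 *: 1) * g m b).
  by apply/funext => m; rewrite scaleN1r mulN1r.
apply: aeqM; [exact: ahom_bd|exact: ahom_bd| |exact: aeq_refl].
rewrite -scaleN1r; apply: aeq_trans (ahomZ hf _ _) _.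
exact/aeqZ/ahom1.
Qed.

(** The intertwining defect has to be presented as a list, because the norms of [theta] and
    [tensor_val] are compared on lists only. *)
Lemma aeq_theta_comm a b t :
  aeq (fun m => theta f g m (tmul t [:: (a, 1)] ++ tmul [:: (-1, b)] t))
      (fun m => theta f g m t * f m a - g m b * theta f g m t).
Proof.
have -> : (fun m => theta f g m (tmul t [:: (a, 1)] ++ tmul [:: (-1, b)] t)) =
    (fun m => theta f g m (tmul t [:: (a, 1)]) + theta f g m (tmul [:: (-1, b)] t)).
  by apply/funext => m; rewrite theta_cat.
apply: aeqD; apply: aeq_trans (aeq_theta_mul _ _) _.
  by apply: aeqM; [exact: abd_theta|exact: ahom_bd|exact: aeq_refl|exact: aeq_theta_l].
have -> : (fun m => - (g m b * theta f g m t)) = (fun m => - g m b * theta f g m t).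
  by apply/funext => m; rewrite mulNr.
by apply: aeqM; [exact: abd_theta|exact: abd_theta|exact: aeq_theta_r|exact: aeq_refl].
Qed.

Lemma aeq_theta_unit s t :
  aeq (fun m => theta f g m (tmul s t ++ [:: (-1, 1)]))
      (fun m => theta f g m s * theta f g m t - 1).
Proof.
have -> : (fun m => theta f g m (tmul s t ++ [:: (-1, 1)])) =
    (fun m => theta f g m (tmul s t) + theta f g m [:: (-1, 1)]).
  by apply/funext => m; rewrite theta_cat.
apply: aeqD; first exact: aeq_theta_mul.
exact: aeq_trans (aeq_theta_r _) (aeqN (ahom1 hg)).
Qed.

End Theta.

Let ai := shom_asymptotic (hom_i hmin).
Let aj := shom_asymptotic (hom_j hmin).
Let cij a b : aeq (fun m : nat => i a * j b) (fun=> j b * i a).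
Proof. by rewrite (comm_ij hmin); exact: aeq_refl. Qed.

Lemma tensor_val_mul s t : tensor_val i j (tmul s t) = tensor_val i j s * tensor_val i j t.
Proof. exact/aeq_cst/(aeq_theta_mul ai aj cij). Qed.

Lemma tensor_val_star t : tensor_val i j (tstar t) = star (tensor_val i j t).
Proof. exact/aeq_cst/(aeq_theta_star ai aj cij). Qed.

Lemma tensor_val_unit s t : tensor_val i j (tmul s t ++ [:: (-1, 1)]) =
  tensor_val i j s * tensor_val i j t - 1.
Proof. exact/aeq_cst/(aeq_theta_unit ai aj cij). Qed.

Lemma tensor_val_comm a b t : tensor_val i j (tmul t [:: (a, 1)] ++ tmul [:: (-1, b)] t) =
  tensor_val i j t * i a - j b * tensor_val i j t.
Proof. exact/aeq_cst/(aeq_theta_comm ai aj cij). Qed.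

(* A unitary of E is close to a finite sum of elementary tensors; the same sum
   formed with f and g is then almost unitary and still intertwines. *)
Lemma transfer (B : cstarType R) (f g : nat -> D -> B) (h k : D -> D) :
  asymptotic_hom f -> asymptotic_hom g ->
  (forall a b, aeq (fun m => f m a * g m b) (fun m => g m b * f m a)) ->
  (forall t e, 0 < e ->
     \forall m \near \oo, cnorm (theta f g m t) <= cnorm (tensor_val i j t) + e) ->
  aue (i \o h) (j \o k) -> forall (F : seq D) e, 0 < e ->
  \forall m \near \oo, uclose F e (f m \o h) (g m \o k).
Proof.
move=> hf hg fg nc hk F e e0.
have nc' s u K : aeq (fun m => theta f g m s) u -> cnorm (tensor_val i j s) <= K ->
    forall e', 0 < e' -> \forall m \near \oo, cnorm (u m) <= K + e'.
  move=> su sK; apply: aeq_norm su _ => e' e'0; near=> m.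
  have : cnorm (theta f g m s) <= cnorm (tensor_val i j s) + e' by near: m; exact: nc.
  by move/le_trans; apply; rewrite lerD2r.
(* The summand 2 pays for the two units lost when ||f m (h x)|| and ||g m (k x)|| are bounded by ||h
   x|| + 1 and ||k x|| + 1. *)
pose K := \sum_(x <- F) (cnorm (h x) + cnorm (k x)) + 2.
have FK x : x \in F -> cnorm (h x) + cnorm (k x) + 2 <= K.
  move=> xF; rewrite lerD2r (big_rem x)//= lerDl sumr_ge0// => y _.
  by rewrite addr_ge0 ?cnorm_ge0.
have K2 : 2 <= K by rewrite lerDr sumr_ge0// => y _; rewrite addr_ge0 ?cnorm_ge0.
have K0 : 0 < K by rewrite (lt_le_trans _ K2).
(* d <= 1/8 keeps the unitarity defect 3d + d below 1, as [near_unitary] demands. The final error is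
   at most (d K + d) + 4 d K, which is below e since d K <= e/8 and K >= 2. *)
pose d := Num.min (8^-1) (e / (8 * K)).
have d0 : 0 < d by rewrite lt_min invr_gt0 divr_gt0 ?mulr_gt0//= ltr0n.
have d8 : d <= 8^-1 by rewrite ge_min lexx.
have dK : d * K <= e / 8.
  rewrite -ler_pdivlMr// (_ : e / 8 / K = e / (8 * K)) ?ge_min ?lexx ?orbT//.
  by rewrite invfM mulrA.
have d4 : 3 * d + d < 1.
  have -> : 3 * d + d = 4 * d by ring.
  by rewrite mulrC -ltr_pdivlMr//; apply: le_lt_trans d8 _; rewrite mul1r ltf_pV2 ?posrE// ltr_nat.
have [z [uz zF]] := hk F d d0.
have [t zt] := tensor_val_dense hmin z d0.
set z' := tensor_val i j t in zt.
have z'z : cnorm (z' - z) <= d by rewrite cdistC ltW.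
have z'n : cnorm z' <= 1 + d.
  rewrite -(subrK z z') addrC (le_trans (cnormD _ _))// lerD//.
  exact: unitary_norm.
have dd : d * d <= d * 8^-1 by rewrite ler_wpM2l// ltW.
have sz'z : cnorm (star z' - star z) <= d by rewrite -starB cnorm_starE.
have n1 : cnorm (tensor_val i j (tmul (tstar t) t ++ [:: (-1, 1)])) <= 3 * d.
  rewrite tensor_val_unit tensor_val_star -/z' -(proj1 uz) (le_trans (cdistM _ _ _ _))//.
  rewrite cnorm_starE.
  have := ler_pM (cnorm_ge0 _) (cnorm_ge0 _) z'n z'z.
  have := ler_pM (cnorm_ge0 _) (cnorm_ge0 _) sz'z (unitary_norm uz); lra.
have n2 : cnorm (tensor_val i j (tmul t (tstar t) ++ [:: (-1, 1)])) <= 3 * d.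
  rewrite tensor_val_unit tensor_val_star -/z' -(proj2 uz) (le_trans (cdistM _ _ _ _))//.
  rewrite cnorm_starE.
  have := ler_pM (cnorm_ge0 _) (cnorm_ge0 _) z'n sz'z.
  have := ler_pM (cnorm_ge0 _) (cnorm_ge0 _) z'z (unitary_norm uz); lra.
have n3 x : x \in F -> cnorm (tensor_val i j (tmul t [:: (h x, 1)] ++ tmul [:: (-1, k x)] t))
    <= d * K.
  move=> xF; rewrite tensor_val_comm -/z'.
  rewrite (commutator_perturb _ z).
  have -> : z * i (h x) - j (k x) * z = (z * i (h x) * star z - j (k x)) * z.
    by rewrite mulrBl -[z * _ * _ * z]mulrA (proj1 uz) mulr1.
  apply: (le_trans (cnormD _ _)); rewrite (cnorm_unitaryr _ uz).
  have h1 := zF x xF.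
  have h2 : cnorm ((z' - z) * i (h x)) <= d * cnorm (h x).
    by rewrite (le_trans (cnormM _ _))// ler_pM ?cnorm_ge0// (shom_norm _ (hom_i hmin)).
  have h3 : cnorm (j (k x) * (z' - z)) <= d * cnorm (k x).
    rewrite [d * _]mulrC (le_trans (cnormM _ _))// ler_pM ?cnorm_ge0//.
    exact: (shom_norm _ (hom_j hmin)).
  have := cnormD ((z' - z) * i (h x)) (- (j (k x) * (z' - z))); rewrite cnormN.
  by have := ler_wpM2l (ltW d0) (FK x xF); move: h1 => /=; lra.
pose Z m := theta f g m t.
have aZ1 : aeq (fun m => theta f g m (tmul (tstar t) t ++ [:: (-1, 1)]))
    (fun m => star (Z m) * Z m - 1).
  apply: aeq_trans (aeq_theta_unit hf hg fg _ _) _; apply: aeqD; last exact: aeq_refl.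
  by apply: aeqM; [exact: abd_theta|exact: abd_theta|exact: aeq_theta_star|exact: aeq_refl].
have aZ2 : aeq (fun m => theta f g m (tmul t (tstar t) ++ [:: (-1, 1)]))
    (fun m => Z m * star (Z m) - 1).
  apply: aeq_trans (aeq_theta_unit hf hg fg _ _) _; apply: aeqD; last exact: aeq_refl.
  by apply: aeqM; [exact: abd_theta|exact/abd_star/abd_theta|exact: aeq_refl|exact: aeq_theta_star].
have Fnear : \forall m \near \oo, forall x, x \in F ->
    [/\ cnorm (Z m * f m (h x) - g m (k x) * Z m) <= d * K + d,
      cnorm (f m (h x)) <= cnorm (h x) + 1 & cnorm (g m (k x)) <= cnorm (k x) + 1].
  apply: near_seq => x xF; near=> m; split; near: m.
  - apply: (nc' _ _ _ (aeq_theta_comm hf hg fg _ _ _)) => //; exact: n3.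
  - exact: (ahom_norm hf).
  - exact: (ahom_norm hg).
near=> m.
have Z1 : cnorm (star (Z m) * Z m - 1) <= 3 * d + d by near: m; exact: (nc' _ _ _ aZ1).
have Z2 : cnorm (Z m * star (Z m) - 1) <= 3 * d + d by near: m; exact: (nc' _ _ _ aZ2).
have Fm : forall x, x \in F ->
    [/\ cnorm (Z m * f m (h x) - g m (k x) * Z m) <= d * K + d,
      cnorm (f m (h x)) <= cnorm (h x) + 1 & cnorm (g m (k x)) <= cnorm (k x) + 1].
  by near: m.
(* [Z m] is only almost unitary; replacing it by [V] costs at most 4d times the sizes of the
   elements intertwined. *)
have [V [uV VZ]] := near_unitary d4 Z1 Z2.
exists V; split=> // x xF /=; have [h1 h2 h3] := Fm x xF.
rewrite -(cnorm_unitaryr _ uV) mulrBl -[_ * star V * V]mulrA (proj1 uV) mulr1.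
rewrite (commutator_perturb _ (Z m)).
apply: (le_lt_trans (cnormD _ _)).
have h4 := le_trans (cnormM (V - Z m) (f m (h x))) (ler_pM (cnorm_ge0 _) (cnorm_ge0 _) VZ h2).
have h5 := le_trans (cnormM (g m (k x)) (V - Z m)) (ler_pM (cnorm_ge0 _) (cnorm_ge0 _) h3 VZ).
have := cnormD ((V - Z m) * f m (h x)) (- (g m (k x) * (V - Z m))); rewrite cnormN.
have := ler_wpM2l (ltW d0) (FK x xF).
have dK2 := ler_wpM2l (ltW d0) K2.
nra.
Unshelve. all: by end_near. Qed.

End Transfer.

(** * Strongly self-absorbing algebras *)

Section StronglySelfAbsorbing.
Context {R : realType} {D E : cstarType R} {i j : {lrmorphism D -> E}}.
Hypothesis hmin : is_min_tensor i j.
Context {phi : {lrmorphism D -> E}} {psi : E -> D}.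
Hypotheses (sphi : star_preserving phi) (phiK : cancel phi psi)
  (psiK : cancel psi phi) (phi_i : approx_unitarily_equivalent phi i).

Let hi := hom_i hmin.
Let hj := hom_j hmin.
Let hphi := lrmorphism_star_hom sphi.

Let hpsi : star_hom psi.
Proof.
split.
- by move=> x y; apply: (can_inj phiK); rewrite (shomD hphi) !psiK.
- by move=> z x; apply: (can_inj phiK); rewrite (shomZ hphi) !psiK.
- by move=> x y; apply: (can_inj phiK); rewrite (shomM hphi) !psiK.
- by apply: (can_inj phiK); rewrite (shom1 hphi) psiK.
- by move=> x; apply: (can_inj phiK); rewrite (shom_star hphi) !psiK.
Qed.

Let cnorm_psi x : cnorm (psi x) = cnorm x.
Proof.
apply/eqP; rewrite eq_le (shom_norm _ hpsi) -{1}(psiK x).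
by rewrite (shom_norm (psi x) hphi).
Qed.

Let cnorm_phi x : cnorm (phi x) = cnorm x.
Proof. by rewrite -cnorm_psi phiK. Qed.

Let aue_phi_i : aue phi i.
Proof.
move=> F e e0; have [u [uu ui]] := phi_i.
have : \forall n \near \oo, forall x, x \in F ->
    cnorm (u n * phi x * star (u n) - i x) < e.
  apply: near_seq => x _; have /cvgr0Pnorm_lt/(_ e e0) := ui x.
  by apply: filterS => n; rewrite ger0_norm ?cnorm_ge0.
by move=> [N _ /(_ N (leqnn N)) NP]; exists (u N).
Qed.

(** [phi] is isometric, since it and its inverse are contractive; conjugates of [phi x] have the
    same norm and approximate [i x]. *)
Let cnorm_i x : cnorm (i x) = cnorm x.
Proof.
apply/eqP; rewrite eq_le (shom_norm _ hi); apply/ler_addgt0Pr => e e0.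
have [u [uu /(_ x)]] := aue_phi_i [:: x] e0; rewrite mem_head => /(_ isT) ux.
have := cnorm_dist (u * phi x * star u) (i x).
rewrite (cnorm_unitaryr _ (unitary_star uu)) cnorm_unitaryl// cnorm_phi.
by rewrite ler_norml; lra.
Qed.

(** The norm of [i a] is spatial, hence controlled by the representations of [D], and [i] is
    isometric. *)
Let nD : norming D.
Proof. by move=> a c c0 h; rewrite -cnorm_i; exact: (cnorm_i_le hmin). Qed.

Let nE : norming E.
Proof.
move=> a c c0 h; rewrite -cnorm_psi; apply: nD => // H pi x.
exact: (h H (rep_comp hpsi pi) x).
Qed.

Let lam := psi \o i.
Let mu := psi \o j.

Let hmu : star_hom mu := shom_comp hj hpsi.

Let aue_id_lam : aue id lam.
Proof.
have h := aue_post hpsi aue_phi_i.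
have -> : (id : D -> D) = psi \o phi by apply/funext => x /=; rewrite phiK.
exact: h.
Qed.

(* [lam ~ id] gives [lam \o mu ~ mu]: the second and third tensor factors of
   D (x) D (x) D are equivalent.  The next lemmas move this to the factors of E. *)
Let aue_imu_j : aue (i \o mu) j.
Proof.
have := aue_post hphi (aue_pre mu aue_id_lam).
have -> : phi \o (id \o mu) = j by apply/funext => x; rewrite /= psiK.
have -> : phi \o (lam \o mu) = i \o mu by apply/funext => x; rewrite /= psiK.
exact: aue_sym.
Qed.

(** [aue_imu_j] transferred along the flip of the two factors, which is contractive because the
    spatial norm is symmetric. *)
Let aue_jmu_i : aue (j \o mu) i.
Proof.
move=> F e e0.
have := @transfer _ _ _ _ _ hmin E (fun=> j) (fun=> i) mu id
  (shom_asymptotic hj) (shom_asymptotic hi) _ _ aue_imu_j F e e0.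
case.
- by move=> a b; rewrite (comm_ij hmin); exact: aeq_refl.
- move=> t d d0; near=> m.
  have -> : theta (fun=> j) (fun=> i) m t = tensor_val i j [seq (p.2, p.1) | p <- t].
    by rewrite /theta /tensor_val big_map; apply: eq_bigr => p _; rewrite (comm_ij hmin).
  by rewrite (le_trans (cnorm_tensor_val_swap hmin t))// lerDl ltW.
- by move=> N _ /(_ N (leqnn N)).
Unshelve. all: by end_near. Qed.

Let aue_mumu_id : aue (mu \o mu) id.
Proof.
apply: aue_trans (aue_sym aue_id_lam); exact: (aue_post hpsi aue_jmu_i).
Qed.

(** [aue_imu_j] transferred along mu (x) id reads i o mu o mu ~ j, and mu o mu ~ id. *)
Let aue_i_j : aue i j.
Proof.
apply: aue_trans (aue_sym (aue_post hi aue_mumu_id)) _ => F e e0.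
have := @transfer _ _ _ _ _ hmin E (fun=> i \o mu) (fun=> j) mu id
  (shom_comp_asymptotic hi (shom_asymptotic hmu)) (shom_asymptotic hj) _ _ aue_imu_j F e e0.
case.
- by move=> a b; rewrite /= (comm_ij hmin); exact: aeq_refl.
- move=> t d d0; near=> m.
  have -> : theta (fun=> i \o mu) (fun=> j) m t = tensor_val i j [seq (mu p.1, p.2) | p <- t].
    by rewrite /theta /tensor_val big_map.
  by rewrite (le_trans (cnorm_tensor_val_comp hmin t hmu))// lerDl ltW.
- by move=> N _ /(_ N (leqnn N)).
Unshelve. all: by end_near. Qed.

(** Rearranges a compression X* a X into a sum over pairs of tensors. In [cnorm_tensor_asymptotic]
    it is used with the matrix of [rho b] and with the identity matrix. *)
Let gram_sum (I : finType) (n : I -> D * D -> R[i]) (a : I -> I -> R[i])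
    (s : seq (D * D)) (X := fun k => \sum_(p <- s) n k p *: p.1) :
  \sum_k \sum_l a k l *: (star (X k) * X l) =
  \sum_(p <- s) \sum_(q <- s)
    (\sum_k \sum_l a k l * (Num.conj (n k p) * n l q)) *: (star p.1 * q.1).
Proof.
have -> : \sum_k \sum_l a k l *: (star (X k) * X l) = \sum_k \sum_l
    \sum_(p <- s) \sum_(q <- s) (a k l * (Num.conj (n k p) * n l q)) *: (star p.1 * q.1).
  apply: eq_bigr => k _; apply: eq_bigr => l _.
  rewrite star_sum mulr_suml scaler_sumr; apply: eq_bigr => p _.
  rewrite mulr_sumr scaler_sumr; apply: eq_bigr => q _.
  by rewrite starZ -scalerAl -scalerAr !scalerA mulrA.
under eq_bigr do rewrite exchange_big /=.
rewrite exchange_big /=; apply: eq_bigr => p _.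
under eq_bigr do rewrite exchange_big /=.
rewrite exchange_big /=; apply: eq_bigr => q _.
by rewrite scaler_suml; apply: eq_bigr => k _; rewrite scaler_suml.
Qed.

(* Slicing the elementary tensors that approximate a unitary implementing
   [j ~ i] gives finite-rank maps that tend to the identity and factor through
   matrices; the norm of a matrix over D is controlled by the norms of finitely
   many elements of D. *)
Lemma cnorm_tensor_asymptotic (w : nat -> D -> D) : asymptotic_hom w ->
  forall t e, 0 < e -> \forall m \near \oo,
    cnorm (theta (fun m => i \o w m) (fun=> j) m t) <= cnorm (tensor_val i j t) + e.
Proof.
move=> hw t e e0; set r0 := cnorm _.
have r00 : 0 <= r0 := cnorm_ge0 _.
(* Total weight of the error made when each [p.2] is replaced by [T p.2]: ||w m p.1|| <= ||p.1|| + 1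
   and ||T b - b|| <= d (1 + 3 ||b||). *)
pose L := \sum_(p <- t) (cnorm p.1 + 1) * (1 + 3 * cnorm p.2).
have L0 : 0 <= L.
  by apply: sumr_ge0 => p _; rewrite mulr_ge0 ?addr_ge0 ?mulr_ge0 ?cnorm_ge0.
(* The final bound is (r0 + e/4)(1 + 4d) + d L; the last two terms of the minimum make the excess
   over r0 at most e/4 + e/2 + e/4. *)
pose d := Num.min 1 (Num.min (e / (4 * (L + 1))) (e / (8 * (r0 + e)))).
have re0 : 0 < r0 + e by rewrite ltr_wpDl.
have L1 : 0 < L + 1 by rewrite ltr_wpDl.
have d0 : 0 < d by rewrite !lt_min ltr01 !divr_gt0 ?mulr_gt0.
have d1 : d <= 1 by rewrite ge_min lexx.
have dL : d * (4 * (L + 1)) <= e.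
  by rewrite -ler_pdivlMr ?mulr_gt0// !ge_min lexx orbT.
have dr : d * (8 * (r0 + e)) <= e.
  by rewrite -ler_pdivlMr ?mulr_gt0// !ge_min lexx !orbT.
(* The element 1 joins the second legs so that [T 1], the square of the column [X], is close to
   1. *)
have [z [uz zF]] := aue_sym aue_i_j (1 :: [seq p.2 | p <- t]) d0.
have [s zs] := tensor_val_dense hmin (star z) d0.
set z' := tensor_val i j s in zs.
have z'z : cnorm (z' - star z) <= d by rewrite cdistC ltW.
have sz'z : cnorm (star z' - z) <= d by rewrite -{1}(starK z) -starB cnorm_starE.
have z'n : cnorm z' <= 2.
  rewrite -(subrK (star z) z') (le_trans (cnormD _ _))// (_ : 2 = 1 + 1)// lerD//.
      exact: le_trans z'z d1.
  exact/unitary_norm/unitary_star.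
have zb b : b \in 1 :: [seq p.2 | p <- t] ->
    cnorm (star z' * (j b * z') - i b) <= d * (1 + 3 * cnorm b).
  move=> bF; apply: (le_trans (cdistD (z * (j b * star z)) _ _)).
  have h1 := ltW (zF b bF); rewrite -mulrA in h1.
  have h2 := cdistM (star z') (j b * z') z (j b * star z).
  rewrite cnorm_starE (cnorm_unitaryr _ (unitary_star uz)) -mulrBr in h2.
  have h3 : cnorm (j b * (z' - star z)) <= cnorm b * d.
    by rewrite (le_trans (cnormM _ _))// ler_pM ?cnorm_ge0// (shom_norm _ hj).
  have h4 := ler_pM (cnorm_ge0 _) (cnorm_ge0 _) z'n h3.
  have h5 := ler_pM (cnorm_ge0 _) (cnorm_ge0 _) sz'z (shom_norm b hj).
  by rewrite mulrDr mulr1; lra.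
have [K [rho [xi [xi1 rxi]]]] := unit_vector hmin.
(* z'* (1 (x) b) z' is close to b (x) 1, whose slice at [xi] is b; hence [T] almost fixes the second
   legs. *)
pose T b := slice rho xi xi (tmul (tstar s) (tmul [:: (1, b)] s)).
have Tb b : b \in 1 :: [seq p.2 | p <- t] ->
    cnorm (T b - b) <= d * (1 + 3 * cnorm b).
  move=> /zb; apply: le_trans; rewrite -cnorm_i.
  have -> : T b - b =
      slice rho xi xi (tmul (tstar s) (tmul [:: (1, b)] s) ++ [:: (- b, 1)]).
    by rewrite /slice big_cat big_seq1 /= rxi hdot_hsq xi1 scale1r.
  apply: (le_trans (slice_norm hmin _ _ xi1)).
  rewrite /tensor_val big_cat big_seq1 -!/(tensor_val i j _) /=.
  rewrite !(tensor_val_mul hmin) (tensor_val_star hmin) -/z'.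
  rewrite [tensor_val i j [:: _]]/tensor_val big_seq1 /= (shom1 hi) (shom1 hj).
  by rewrite mul1r mulr1 (shomN hi).
(* [T b] sees [rho b] only through its compression to the span of the vectors [rho p.2 xi]: it is X*
   [rho b] X. This is the factorisation through matrices. *)
have [I [v [ov sv]]] := gram_schmidt [seq rho p.2 xi | p <- s].
pose n k (p : D * D) := hdot K (rho p.2 xi) (v k).
have nE' p : p \in s -> rho p.2 xi = \sum_k n k p *: v k.
  by move=> ps; apply: sv; apply: (map_f (fun p => rho p.2 xi)).
pose X k := \sum_(p <- s) n k p *: p.1.
have TE b : T b =
    \sum_k \sum_l hdot K (rho b (v l)) (v k) *: (star (X k) * X l).
  rewrite gram_sum /T /slice /tmul big_allpairs_dep /tstar big_map.
  apply: eq_big_seq => p ps; rewrite big_allpairs_dep big_seq1.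
  apply: eq_big_seq => q qs /=; rewrite mul1r; congr (_ *: _).
  rewrite !repM rep_star (nE' p ps) (nE' q qs) (linear_sum (rho b)) hdot_sumr.
  apply: eq_bigr => k _; rewrite hdot_suml; apply: eq_bigr => l _.
  by rewrite (linearZ_LR (rho b)) hdotZl hdotZr; ring.
have T1 : T 1 = \sum_k star (X k) * X k.
  have -> : \sum_k star (X k) * X k =
      \sum_k \sum_l (k == l)%:R *: (star (X k) * X l).
    apply: eq_bigr => k _; rewrite (bigD1 k)//= eqxx scale1r big1 ?addr0// => l kl.
    by rewrite eq_sym (negPf kl) scale0r.
  rewrite gram_sum /T /slice /tmul big_allpairs_dep /tstar big_map.
  apply: eq_big_seq => p ps; rewrite big_allpairs_dep big_seq1.
  apply: eq_big_seq => q qs /=; rewrite !mul1r; congr (_ *: _).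
  rewrite !repM rep_star (nE' p ps) (nE' q qs) hdot_sumr.
  apply: eq_bigr => k _; rewrite hdot_suml; apply: eq_bigr => l _.
  by rewrite hdotZl hdotZr ov eq_sym; ring.
(* Up to a null sequence, [w m] applied entrywise to the matrix of slices of [t], whose norm is at
   most [r0]. *)
pose C m k l := \sum_(p <- t) hdot K (rho p.2 (v l)) (v k) *: w m p.1.
have Cw k l : aeq (fun m => C m k l) (w^~ (slice rho (v l) (v k) t)).
  apply: aeq_trans (aeq_sym (ahom_sum hw _ _)).
  by apply: aeq_sum => p; exact/aeq_sym/(ahomZ hw).
have e4 : 0 < e / 4 by rewrite divr_gt0.
have Cb := mxbound_asymptotic hw nD r00 e4 (slice_mxbound hmin rho t ov) Cw.
have wb : \forall m \near \oo, forall p, p \in t -> cnorm (w m p.1) <= cnorm p.1 + 1.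
  by apply: near_seq => p _; exact: (ahom_norm hw).
near=> m.
have Cm : mxbound (C m) (r0 + e / 4) by near: m.
have wm : forall p, p \in t -> cnorm (w m p.1) <= cnorm p.1 + 1 by near: m.
(* With [T p.2] in place of [p.2] the sum becomes a compression of [C m] by the column [j (X k)], to
   which [schur_bound] applies; the second sum is the error. *)
have -> : theta (fun m => i \o w m) (fun=> j) m t =
    (\sum_k \sum_l star (j (X k)) * i (C m k l) * j (X l)) +
    \sum_(p <- t) i (w m p.1) * j (p.2 - T p.2).
  have -> : \sum_k \sum_l star (j (X k)) * i (C m k l) * j (X l) =
      \sum_(p <- t) i (w m p.1) * j (T p.2).
    rewrite [RHS](eq_bigr (fun p => \sum_k \sum_l star (j (X k)) *
        i (hdot K (rho p.2 (v l)) (v k) *: w m p.1) * j (X l))) => [|p _].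
      rewrite [RHS]exchange_big; apply: eq_bigr => k _.
      rewrite [RHS]exchange_big; apply: eq_bigr => l _.
      by rewrite (shom_sum hi) mulr_sumr mulr_suml.
    rewrite TE (shom_sum hj) mulr_sumr; apply: eq_bigr => k _.
    rewrite (shom_sum hj) mulr_sumr; apply: eq_bigr => l _.
    rewrite (shomZ hj) (shomM hj) (shom_star hj) (shomZ hi).
    rewrite -!scalerAr -scalerAl mulrA; congr (_ *: (_ * _)).
    by rewrite -(shom_star hj) (comm_ij hmin).
  rewrite -big_split /=; apply: eq_bigr => p _.
  by rewrite -mulrDr -(shomD hj) addrC subrK.
apply: (le_trans (cnormD _ _)).
have Cm' : mxbound (fun k l => i (C m k l)) (r0 + e / 4).
  by move=> H pi h; exact: (Cm H (rep_comp hi pi) h).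
have re4 : 0 <= r0 + e / 4 by rewrite addr_ge0// ltW.
have h1 := schur_bound nE (fun k => j (X k)) re4 Cm'.
have h2 : cnorm (\sum_k star (j (X k)) * j (X k)) <= 1 + d * 4.
  have -> : \sum_k star (j (X k)) * j (X k) = j (T 1).
    rewrite T1 (shom_sum hj); apply: eq_bigr => k _.
    by rewrite (shomM hj) (shom_star hj).
  rewrite (le_trans (shom_norm _ hj))// -(subrK 1 (T 1)) addrC.
  rewrite (le_trans (cnormD _ _))// lerD ?cnorm1_le1//.
  rewrite (le_trans (Tb _ (mem_head _ _)))// ler_wpM2l ?(ltW d0)//.
  by have := @cnorm1_le1 _ D; lra.
have h3 : cnorm (\sum_(p <- t) i (w m p.1) * j (p.2 - T p.2)) <= d * L.
  rewrite (le_trans (cnorm_sum _ _ _))// /L mulr_sumr big_seq [leRHS]big_seq.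
  apply: ler_sum => p pt; rewrite (le_trans (cnormM _ _))// mulrCA.
  rewrite ler_pM ?cnorm_ge0//; first by rewrite (le_trans (shom_norm _ hi)) ?wm.
  rewrite (le_trans (shom_norm _ hj))// cdistC Tb//.
  by rewrite inE (map_f (fun p => p.2) pt) orbT.
have h4 := ler_wpM2l re4 h2.
have h5 : d * (r0 + e / 4) * 8 <= e by nra.
lra.
Unshelve. all: by end_near. Qed.

(** The chain is w ~ lam o w = psi o i o w ~ psi o j ~ psi o i = lam ~ id, each link costing e/4;
    [transfer] gives the link from i o w to j. *)
Lemma asymptotic_hom_inner (w : nat -> D -> D) (F : seq D) e :
  asymptotic_hom w -> 0 < e -> \forall m \near \oo, uclose F e (w m) id.
Proof.
move=> hw e0; have e4 : 0 < e / 4 by rewrite divr_gt0.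
have step := @transfer _ _ _ _ _ hmin E (fun m => i \o w m) (fun=> j) id id
  (shom_comp_asymptotic hi hw) (shom_asymptotic hj) _ (cnorm_tensor_asymptotic hw)
  aue_i_j F _ e4.
have {}step : \forall m \near \oo, uclose F (e / 4) (i \o w m) j.
  apply: step => a b; rewrite (_ : (fun m => _) = fun m => j b * i (w m a)).
    exact: aeq_refl.
  by apply/funext => m; rewrite /= (comm_ij hmin).
apply: filterS step => m iw.
have -> : e = e / 4 + (e / 4 + (e / 4 + e / 4)) by field.
apply: (@uclose_trans _ _ _ _ _ _ (lam \o w m)).
  have := aue_pre (w m) aue_id_lam; exact.
apply: uclose_trans (uclose_post hpsi iw) _.
apply: (@uclose_trans _ _ _ _ _ _ lam).
  exact: (uclose_post hpsi (aue_sym aue_i_j F e4)).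
exact: (aue_sym aue_id_lam).
Qed.

End StronglySelfAbsorbing.

Lemma ssa_asymptotic_hom_inner (R : realType) (D : cstarType R) (w : nat -> D -> D)
    (F : seq D) e : strongly_self_absorbing D -> asymptotic_hom w -> 0 < e ->
  \forall m \near \oo, uclose F e (w m) id.
Proof.
move=> [_ [E [i [j [hmin [phi [sphi [psi phiK psiK] phi_i]]]]]]].
exact: (asymptotic_hom_inner hmin sphi phiK psiK phi_i).
Qed.

(** * Quantifier-free formulas *)

(** [List.In] is used because formulas come without a decidable equality. *)
Lemma finite_set_seq (T : Type) (A : set T) : finite_set A ->
  exists s : seq T, forall x, A x <-> List.In x s.
Proof.
move=> /(@finite_seqP {classic T})[s ->]; exists s => x /=.
elim: s => [|y s IHs] /=; first by rewrite in_nil; split.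
rewrite in_cons; split=> [/orP[/eqP ->|/IHs]|[->|/IHs xs]]; [by left|by right| |].
  by rewrite eqxx.
by rewrite xs orbT.
Qed.

Lemma finite_set_bound (T : Type) (A : set T) (P : T -> nat -> Prop) :
  finite_set A -> (forall x n m, (n <= m)%N -> P x n -> P x m) ->
  (forall x, A x -> exists n, P x n) -> exists n, forall x, A x -> P x n.
Proof.
move=> /finite_set_seq[s sA] Pm Ps.
have {Ps}Ps x : List.In x s -> exists n, P x n by move=> /sA; exact: Ps.
suff [n nP] : exists n, forall x, List.In x s -> P x n.
  by exists n => x /sA; exact: nP.
elim: s {sA} Ps => [|x s IHs] Ps; first by exists 0%N.
have [n nP] := IHs (fun y ys => Ps y (or_intror ys)).
have [m mP] := Ps x (or_introl erefl).
exists (maxn m n) => y [<-|ys]; first exact: Pm (leq_maxl _ _) mP.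
exact: Pm (leq_maxr _ _) (nP y ys).
Qed.

Lemma finType_bound (I : finType) (P : I -> nat -> Prop) :
  (forall k n m, (n <= m)%N -> P k n -> P k m) ->
  (forall k, exists n, P k n) -> exists n, forall k, P k n.
Proof.
move=> Pm Pn; have [||n nP] := @finite_set_bound I setT P _ Pm.
- exact: finite_finset.
- by move=> x _; exact: Pn.
by exists n => k; exact: nP.
Qed.

Section Logic.
Context {R : realType} {L : signature R}.

Section Support.
Context {C : countType} {so : C -> sorts L}.

Lemma eval_support s (t : term so s) : exists N, forall (M : structure L)
    (v v' : forall c, M (so c)),
  (forall c, (pickle c < N)%N -> v c = v' c) -> Defs.eval v t = Defs.eval v' t.
Proof.
elim: t => [c|f t IHt].
  by exists (pickle c).+1 => M v v' vv /=; apply: vv.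
have [||N NP] := finType_bound (P := fun i N =>
  forall (M : structure L) (v v' : forall c, M (so c)),
  (forall c, (pickle c < N)%N -> v c = v' c) -> Defs.eval v (t i) = Defs.eval v' (t i)).
- by move=> i n m nm h M v v' vv; apply: h => c cn; apply: vv; exact: leq_trans cn nm.
- exact: IHt.
exists N => M v v' vv /=; congr (interp M f).
by apply: functional_extensionality_dep => i; exact: NP.
Qed.

Lemma qf_support (F : connectives R) (phi : qf_formula F so) :
  exists N, forall (M : structure L) (v v' : forall c, M (so c)),
  (forall c, (pickle c < N)%N -> v c = v' c) -> qf_eval v phi = qf_eval v' phi.
Proof.
elim: phi => [s t u|c phi IHphi].
  have [N NP] := eval_support t; have [N' NP'] := eval_support u.
  exists (maxn N N') => M v v' vv /=; congr mdist.
    by apply: NP => c cN; apply: vv; rewrite (leq_trans cN)// leq_maxl.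
  by apply: NP' => c cN; apply: vv; rewrite (leq_trans cN)// leq_maxr.
have [||N NP] := finType_bound (P := fun i N =>
  forall (M : structure L) (v v' : forall c, M (so c)),
  (forall c, (pickle c < N)%N -> v c = v' c) ->
  qf_eval v (phi i) = qf_eval v' (phi i)).
- by move=> i n m nm h M v v' vv; apply: h => c' cn; apply: vv; exact: leq_trans cn nm.
- exact: IHphi.
exists N => M v v' vv /=; congr (conn_fun c _).
by apply/rowP => i; rewrite !mxE; exact: NP.
Qed.

Lemma position_support (F : connectives R) (p : position F so) : finite_set p ->
  exists N, forall (M : structure L) (v v' : forall c, M (so c)),
  (forall c, (pickle c < N)%N -> v c = v' c) ->
  forall e, p e -> qf_eval v e.1 = qf_eval v' e.1.
Proof.
move=> pf; have [] := finite_set_bound (A := p) (P := fun e N =>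
  forall (M : structure L) (v v' : forall c, M (so c)),
  (forall c, (pickle c < N)%N -> v c = v' c) ->
  qf_eval v e.1 = qf_eval v' e.1) pf.
- move=> e n m nm h M v v' vv; apply: h => c cn; apply: vv.
  exact: leq_trans cn nm.
- by move=> e _; exact: qf_support.
- move=> N NP; exists N => M v v' vv e pe; exact: NP.
Qed.

End Support.

Lemma composition_formula (F : connectives R) n (g : 'rV[R]_n -> R) :
  composition F g ->
  forall (X : Type) (so : X -> sorts L) (phi : 'I_n -> qf_formula F so),
  exists psi : qf_formula F so, forall (M : structure L) (v : forall x, M (so x)),
    qf_eval v psi = g (\row_i qf_eval v (phi i)).
Proof.
move=> Fg X so phi; elim: Fg => [i|c h _ IHh].
  by exists (phi i) => M v; rewrite mxE.
pose psi i := sval (cid (IHh i)).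
exists (Conn psi) => M v /=; congr conn_fun.
by apply/rowP => i; rewrite !mxE /psi; case: cid => /= q ->.
Qed.

(** Positions contain strict upper bounds only. A lower bound on a distance is an upper bound on a
    formula approximating its negative within d/3, which density provides on the box of size
    [diam s]; the threshold d/2 - r lies between the errors d/3 and d. *)
Lemma dist_position (F : connectives R) (X : Type) (so : X -> sorts L) s
    (t u : term so s) r d : uniformly_dense F -> 0 < d ->
  exists q : position F so, [/\ finite_set q,
    (forall (M : structure L) (v : forall x, M (so x)),
      mdist (Defs.eval v t) (Defs.eval v u) = r -> forall e, q e -> qf_eval v e.1 < e.2) &
    (forall (M : structure L) (v : forall x, M (so x)),
      (forall e, q e -> qf_eval v e.1 < e.2) ->
      `|mdist (Defs.eval v t) (Defs.eval v u) - r| <= d)].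
Proof.
move=> Fd d0; have d3 : 0 < d / 3 by rewrite divr_gt0.
have cn : continuous (fun x : 'rV[R]_1 => - x ord0 ord0).
  by move=> x; apply: (cvgN (@coord_continuous R 1 1 ord0 ord0 x)).
have [g [Fg gP]] := Fd 1%N _ cn (diam s) _ d3.
have [psi psiE] := composition_formula Fg (fun _ : 'I_1 => Dist F t u).
have close (M : structure L) (v : forall x, M (so x)) :
    `|qf_eval v psi + mdist (Defs.eval v t) (Defs.eval v u)| < d / 3.
  have := gP (\row_i qf_eval v (Dist F t u)); rewrite psiE mxE opprK; apply.
  move=> k; rewrite mxE /= ger0_norm ?mdist_ge0//; exact: mdist_diam.
exists [set (Dist F t u, r + d); (psi, d / 2 - r)]; split.
- by rewrite finite_setU; split; exact: finite_set1.
- move=> M v vr e [->|->] /=; first by rewrite vr ltrDl.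
  have := close M v; rewrite vr ltr_norml; lra.
- move=> M v vq; have := vq _ (or_introl erefl); have := vq _ (or_intror erefl).
  have := close M v; rewrite /= ltr_norml ler_norml; lra.
Qed.

Section Continuity.
Context {X : Type} {so : X -> sorts L} {M : structure L}.
Variables (w : nat -> forall x, M (so x)) (v : forall x, M (so x)).
Hypothesis wv : forall x e, 0 < e -> \forall n \near \oo, mdist (w n x) (v x) < e.

Lemma eval_continuous s (t : term so s) e : 0 < e ->
  \forall n \near \oo, mdist (Defs.eval (w n) t) (Defs.eval v t) < e.
Proof.
elim: t e => [x|f t IHt] e e0 /=; first exact: wv.
have e2 : 0 < e / 2 by rewrite divr_gt0.
have : \forall n \near \oo, forall i,
    mdist (Defs.eval (w n) (t i)) (Defs.eval v (t i)) < modulus f (e / 2).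
  by apply: near_all => i; apply: IHt; exact: modulus_gt0.
apply: filterS => n h; apply: (@le_lt_trans _ _ (e / 2)); first exact: interp_ucont.
by rewrite ltr_pdivrMr// ltr_pMr// ltr1n.
Qed.

Lemma qf_eval_continuous (F : connectives R) (phi : qf_formula F so) :
  (fun n => qf_eval (w n) phi) @ \oo --> qf_eval v phi.
Proof.
elim: phi => [s t u|c phi IHphi] /=.
  apply/cvgrPdist_lt => e e0; have e2 : 0 < e / 2 by rewrite divr_gt0.
  near=> n.
  have ht : mdist (Defs.eval (w n) t) (Defs.eval v t) < e / 2 by near: n; exact: eval_continuous.
  have hu : mdist (Defs.eval (w n) u) (Defs.eval v u) < e / 2 by near: n; exact: eval_continuous.
  have h1 := metric_triangle (Defs.eval (w n) t) (Defs.eval v t) (Defs.eval (w n) u).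
  have h2 := metric_triangle (Defs.eval v t) (Defs.eval v u) (Defs.eval (w n) u).
  have h3 := metric_triangle (Defs.eval v t) (Defs.eval (w n) t) (Defs.eval v u).
  have h4 := metric_triangle (Defs.eval (w n) t) (Defs.eval (w n) u) (Defs.eval v u).
  rewrite (metric_sym (Defs.eval v u)) in h2; rewrite (metric_sym (Defs.eval v t) (Defs.eval (w n) t)) in h3.
  by move: ht hu h1 h2 h3 h4; rewrite ltr_norml; lra.
apply: (cvg_comp (fun n => \row_i qf_eval (w n) (phi i))); last exact: conn_continuous.
apply/cvg_mx_entourageP => A entA.
have : \forall n \near \oo, forall i, (qf_eval v (phi i), qf_eval (w n) (phi i)) \in A.
  apply: near_all => i; have /cvg_app_entourageP/(_ A entA) := IHphi i.
  by apply: filterS => n; rewrite inE.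
by apply: filterS => n h i j; rewrite !mxE.
Unshelve. all: by end_near. Qed.

End Continuity.

Lemma eval_morphism (X : Type) (so : X -> sorts L) (M N : structure L)
    (h : forall s, M s -> N s) (v : forall x, M (so x)) :
  (forall (f : symbol L) (x : forall i, M (dom f i)),
     h _ (interp M f x) = interp N f (fun i => h _ (x i))) ->
  forall s (t : term so s), Defs.eval (fun x => h _ (v x)) t = h s (Defs.eval v t).
Proof.
move=> hf s; elim=> [x|f t IHt] //=; rewrite hf; congr (interp N f).
by apply: functional_extensionality_dep => i; exact: IHt.
Qed.

Lemma qf_eval_morphism (F : connectives R) (X : Type) (so : X -> sorts L)
    (M N : structure L) (h : forall s, M s -> N s) (v : forall x, M (so x)) :
  (forall s (x y : M s), mdist (h s x) (h s y) = mdist x y) ->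
  (forall (f : symbol L) (x : forall i, M (dom f i)),
     h _ (interp M f x) = interp N f (fun i => h _ (x i))) ->
  forall phi : qf_formula F so, qf_eval (fun x => h _ (v x)) phi = qf_eval v phi.
Proof.
move=> hd hf; elim=> [s t u|c phi IHphi] /=.
  by rewrite !(eval_morphism v hf) hd.
by congr (conn_fun c _); apply/rowP => i; rewrite !mxE.
Qed.

End Logic.

(** * Satisfiability in models of a universal theory *)

Section ConditionWitness.
Context {R : realType} {L : signature R} {C : countType} {so : C -> sorts L}.

Definition covers n (g : 'I_n -> C) (N : nat) : Prop :=
  forall c, (pickle c < N)%N -> exists i, g i = c.

Lemma coversW n (g : 'I_n -> C) N N' : (N' <= N)%N -> covers g N -> covers g N'.
Proof. by move=> NN gN c cN; apply: gN; exact: leq_trans NN. Qed.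

(** A universal sentence has finitely many variables, so terms in the constants are rewritten over a
    finite list [g] of constants containing all those that occur. *)
Lemma term_factor s (t : term so s) : exists N, forall n (g : 'I_n -> C),
  covers g N -> exists t' : term (fun i => so (g i)) s,
    forall (M : structure L) (v : forall c, M (so c)),
      Defs.eval (fun i => v (g i)) t' = Defs.eval v t.
Proof.
elim: t => [c|f t IHt].
  exists (pickle c).+1 => n g /(_ c (leqnn _))[i <-].
  by exists (Var (fun i => so (g i)) i).
have [||N NP] := finType_bound (P := fun k N => forall n (g : 'I_n -> C),
  covers g N -> exists t' : term (fun i => so (g i)) (dom f k),
    forall (M : structure L) (v : forall c, M (so c)),
      Defs.eval (fun i => v (g i)) t' = Defs.eval v (t k)).
- by move=> k n m nm h n' g gm; apply: h; exact: coversW gm.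
- exact: IHt.
exists N => n g gN; pose t' k := sval (cid (NP k n g gN)).
exists (App t') => M v /=; congr (interp M f).
apply: functional_extensionality_dep => k; rewrite /t'.
by case: cid => /= q ->.
Qed.

Lemma qf_factor (F : connectives R) (phi : qf_formula F so) :
  exists N, forall n (g : 'I_n -> C), covers g N ->
  exists phi' : qf_formula (all_connectives R) (fun i => so (g i)),
    forall (M : structure L) (v : forall c, M (so c)),
      qf_eval (fun i => v (g i)) phi' = qf_eval v phi.
Proof.
elim: phi => [s t u|c phi IHphi].
  have [N NP] := term_factor t; have [N' NP'] := term_factor u.
  exists (maxn N N') => n g gN.
  have [t' tP] := NP n g (coversW (leq_maxl _ _) gN).
  have [u' uP] := NP' n g (coversW (leq_maxr _ _) gN).
  by exists (Dist _ t' u') => M v /=; rewrite tP uP.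
have [||N NP] := finType_bound (P := fun k N => forall n (g : 'I_n -> C),
  covers g N -> exists phi' : qf_formula (all_connectives R) (fun i => so (g i)),
    forall (M : structure L) (v : forall c, M (so c)),
      qf_eval (fun i => v (g i)) phi' = qf_eval v (phi k)).
- by move=> k n m nm h n' g gm; apply: h; exact: coversW gm.
- exact: IHphi.
exists N => n g gN; pose phi' k := sval (cid (NP k n g gN)).
pose c' : conn (all_connectives R) := existT _ (conn_arity c)
  (exist _ (@conn_fun _ _ c) (@conn_continuous _ _ c)).
exists (@Conn _ _ (all_connectives R) _ _ c' phi') => M v /=; congr (conn_fun c _).
by apply/rowP => k; rewrite !mxE /phi'; case: cid => /= q ->.
Qed.

(** Positive exactly when the slack collected so far is positive and the new formula is below r. *)
Let slack_fun (r : R) (x : 'rV[R]_2) : R :=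
  Num.max 0 (Num.min (x ord0 ord_max) (r - x ord0 ord0)).

Let slack_continuous r : continuous (slack_fun r).
Proof.
move=> x; pose f (y : 'rV[R]_2) : R^o := y ord0 ord_max.
pose g (y : 'rV[R]_2) : R^o := r - y ord0 ord0.
have cf : {for x, continuous f} by exact: coord_continuous.
have cg : {for x, continuous g}.
  exact: (cvgB (cvg_cst r) (@coord_continuous R 1 2 ord0 ord0 x)).
have c0 : {for x, continuous (fun _ : 'rV[R]_2 => 0 : R^o)}.
  exact: (@cst_continuous _ _ (0 : R^o) x).
exact: (continuous_max c0 (continuous_min cf cg)).
Qed.

Let one_continuous : continuous (fun _ : 'rV[R]_0 => 1 : R).
Proof. by move=> x; exact: cst_continuous. Qed.

(** A whole position becomes one formula. Its lower bound 0 makes failure everywhere mean that it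
    vanishes identically; its upper bound 1 makes the supremum meaningful in every structure. *)
Lemma slack_formula (F : connectives R) (s : seq (qf_formula F so * R)) :
  exists N, forall n (g : 'I_n -> C), covers g N ->
  exists theta : qf_formula (all_connectives R) (fun i => so (g i)),
    (forall (M : structure L) (v : forall i, M (so (g i))),
       0 <= qf_eval v theta <= 1) /\
    forall (M : structure L) (v : forall c, M (so c)),
      0 < qf_eval (fun i => v (g i)) theta <->
      forall e, List.In e s -> qf_eval v e.1 < e.2.
Proof.
elim: s => [|[phi r] s [N NP]].
  exists 0%N => n g _.
  pose c1 : conn (all_connectives R) := 
    existT _ 0%N (exist _ (fun _ : 'rV[R]_0 => 1 : R) one_continuous).
  have phi0 : 'I_0 -> qf_formula (all_connectives R) (fun i => so (g i)) by case.
  exists (@Conn _ _ (all_connectives R) _ _ c1 phi0); split=> M v /=.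
    by rewrite ler01 lexx.
  by rewrite ltr01.
have [N' NP'] := qf_factor phi; exists (maxn N N') => n g gN.
have [th [th01 thP]] := NP n g (coversW (leq_maxl _ _) gN).
have [phi' phiP] := NP' n g (coversW (leq_maxr _ _) gN).
pose c' : conn (all_connectives R) :=
  existT _ 2%N (exist _ (slack_fun r) (@slack_continuous r)).
exists (@Conn _ _ (all_connectives R) _ _ c'
  (fun i : 'I_2 => if i == ord0 then phi' else th)); split=> M v /=.
  have := th01 M v; rewrite /slack_fun !mxE /=; move: (qf_eval v th) => a /andP[a0 a1].
  rewrite le_max lexx /= ge_max ler01 /= ge_min a1//.
rewrite /slack_fun !mxE /= phiP lt_max ltxx /= lt_min subr_gt0; split.
  by move=> /andP[/thP h1 h2] e [<-|/h1].
move=> h; apply/andP; split; last exact: (h _ (or_introl erefl)).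
by apply/thP => e es; exact: h (or_intror es).
Qed.

Lemma constants_below N : exists n (g : 'I_n -> C), injective g /\ covers g N.
Proof.
pose cs := pmap (@pickle_inv C) (iota 0 N).
have mcs c : (pickle c < N)%N -> c \in cs.
  move=> cN; rewrite mem_pmap; apply/mapP; exists (pickle c); rewrite ?pickleK_inv//.
  by rewrite mem_iota.
pose us := undup cs; exists (size us), (tnth (in_tuple us)); split.
  by apply/tuple_uniqP; exact: undup_uniq.
by move=> c /mcs; rewrite -mem_undup => /(tnthP (in_tuple us))[k ->]; exists k.
Qed.

Lemma extend_assignment (M : structure L) n (g : 'I_n -> C)
    (x : forall i, M (so (g i))) : injective g -> (forall s, inhabited (M s)) ->
  exists v : forall c, M (so c), forall i, v (g i) = x i.
Proof.
move=> gI hM.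
(* The value is transported along an equality of constants; injectivity of [g] makes it independent
   of the index. *)
have h c : exists y : M (so c), forall i (e : g i = c),
    y = eq_rect _ (fun c => M (so c)) (x i) _ e.
  have [[i gi]|no] := pselect (exists i, g i = c).
    case: _ / gi; exists (x i) => i' e.
    by have := gI _ _ e => ii; subst i'; rewrite (Prop_irrelevance e erefl).
  by have [y] := hM (so c); exists y => i e; case: no; exists i.
exists (fun c => sval (cid (h c))) => i; case: cid => y /= /(_ i erefl) -> //.
Qed.

(** If no assignment in [N] satisfied [p], the slack formula would vanish on [N], so its supremum
    being 0 would belong to the universal theory. It would then be nonpositive in every model,
    including one that satisfies [p]. *)
Lemma condition_witness (F : connectives R) (N : structure L)
    (p : position F so) : (forall s, inhabited (N s)) ->
  condition (universal_theory N) p ->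
  exists v : forall c, N (so c), forall e, p e -> qf_eval v e.1 < e.2.
Proof.
move=> hN [/finite_set_seq[s sp] [M [v [MT vp]]]].
have [K KP] := slack_formula s; have [n [g [gI gK]]] := constants_below K.
have [th [th01 thP]] := KP n g gK.
apply: contrapT => no.
pose sigma : universal_sentence L := @Universal R L n (fun i => so (g i)) th.
have : universal_theory N sigma.
  rewrite /universal_theory /= /universal_value /=.
  suff -> : range (fun x : forall i, N (so (g i)) => qf_eval x th) = [set 0].
    exact: sup1.
  apply/seteqP; split=> [y [x _ <-]|_ ->] /=.
    have [w wx] := extend_assignment x gI hN.
    have := th01 N x; rewrite le_eqVlt => /andP[/orP[/eqP //|]].
    have -> : x = fun i => w (g i) by apply: functional_extensionality_dep.
    by move=> /thP h _; case: no; exists w => e /sp; exact: h.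
  have [w _] : exists w : forall c, N (so c), True.
    by exists (fun c => sval (cid (let: inhabits y := hN (so c) in ex_intro (fun=> True) y I))).
  exists (fun i => w (g i)) => //.
  have := th01 N (fun i => w (g i)); rewrite le_eqVlt => /andP[/orP[/eqP //|]].
  by move=> /thP h _; case: no; exists w => e /sp; exact: h.
move=> /MT; rewrite /universal_value /= => sup0.
have : qf_eval (fun i => v (g i)) th <= 0.
  rewrite -[leRHS]sup0; apply: ub_le_sup; last by exists (fun i => v (g i)).
  by exists 1 => y [x _ <-]; have /andP[] := th01 M x.
by rewrite leNgt => /negP; apply; apply/thP => e /sp; exact: vp.
Qed.

End ConditionWitness.

(** * Compactness *)

Section LimitNorm.
Context {R : realType} {A : cstarType R}.
Implicit Types u v : nat -> A.

(** The limit superior of the norms is at most r. *)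
Definition limnorm_le u (r : R) : Prop :=
  forall e, 0 < e -> \forall m \near \oo, cnorm (u m) <= r + e.

Lemma limnorm_leD u v r s : limnorm_le u r -> limnorm_le v s ->
  limnorm_le (fun m => u m + v m) (r + s).
Proof.
move=> ur vs e e0; have e2 : 0 < e / 2 by rewrite divr_gt0.
near=> m; rewrite (le_trans (cnormD _ _))// (splitr e) addrACA lerD//.
  by near: m; exact: ur.
by near: m; exact: vs.
Unshelve. all: by end_near. Qed.

Lemma limnorm_leN u r : limnorm_le u r -> limnorm_le (fun m => - u m) r.
Proof.
by move=> ur e e0; near=> m; rewrite cnormN; near: m; exact: ur.
Unshelve. all: by end_near. Qed.

Lemma limnorm_leB u v r s : limnorm_le u r -> limnorm_le v s ->
  limnorm_le (fun m => u m - v m) (r + s).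
Proof. by move=> ur vs; apply: limnorm_leD => //; exact: limnorm_leN. Qed.

Lemma limnorm_le_star u r : limnorm_le u r -> limnorm_le (fun m => star (u m)) r.
Proof.
by move=> ur e e0; near=> m; rewrite cnorm_starE; near: m; exact: ur.
Unshelve. all: by end_near. Qed.

Lemma limnorm_leM u v r s : 0 <= r -> 0 <= s -> limnorm_le u r ->
  limnorm_le v s -> limnorm_le (fun m => u m * v m) (r * s).
Proof.
move=> r0 s0 ur vs e e0; have k0 : 0 < r + s + 1 by rewrite ltr_wpDl// addr_ge0.
pose d := Num.min 1 (e / (r + s + 1)).
have d0 : 0 < d by rewrite lt_min ltr01 divr_gt0.
have d1 : d <= 1 by rewrite ge_min lexx.
have de : d * (r + s + 1) <= e by rewrite -ler_pdivlMr// ge_min lexx orbT.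
near=> m; rewrite (le_trans (cnormM _ _))//.
have h1 : cnorm (u m) <= r + d by near: m; exact: ur.
have h2 : cnorm (v m) <= s + d by near: m; exact: vs.
rewrite (le_trans (ler_pM (cnorm_ge0 _) (cnorm_ge0 _) h1 h2))//.
have : d * d <= d by rewrite ler_piMr// ltW.
by move: de; rewrite !mulrDr !mulrDl; lra.
Unshelve. all: by end_near. Qed.

Lemma limnorm_leZ u r (z : R[i]) : 0 <= r -> limnorm_le u r ->
  limnorm_le (fun m => z *: u m) (complex.Re `|z| * r).
Proof.
move=> r0 ur e e0; have z1 : 0 < complex.Re `|z| + 1 by rewrite ltr_wpDl ?Re_norm_ge0.
near=> m; rewrite cnormZ.
have : cnorm (u m) <= r + e / (complex.Re `|z| + 1).
  by near: m; apply: ur; rewrite divr_gt0.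
move/(ler_wpM2l (Re_norm_ge0 z))/le_trans; apply.
rewrite mulrDr lerD2l mulrCA ler_piMr ?(ltW e0)//.
by rewrite ler_pdivrMr// mul1r lerDl.
Unshelve. all: by end_near. Qed.

Lemma limnorm_leW u r s : r <= s -> limnorm_le u r -> limnorm_le u s.
Proof.
move=> rs ur e e0; near=> m; apply: (@le_trans _ _ (r + e)); last by rewrite lerD2r.
by near: m; exact: ur.
Unshelve. all: by end_near. Qed.

Lemma limnorm_le_aeq u v (K : R) :
  (forall d, 0 < d -> d <= 1 -> limnorm_le (fun m => u m - v m) (K * d)) -> aeq u v.
Proof.
move=> h e e0; pose k := `|K| + 1; have k0 : 0 < k by rewrite ltr_wpDl.
pose d := Num.min 1 (e / (4 * k)).
have d0 : 0 < d by rewrite lt_min ltr01 divr_gt0// mulr_gt0.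
have d1 : d <= 1 by rewrite ge_min lexx.
have de : d * (4 * k) <= e by rewrite -ler_pdivlMr ?mulr_gt0// ge_min lexx orbT.
have e4 : 0 < e / 4 by rewrite divr_gt0.
near=> m; have : cnorm (u m - v m) <= K * d + e / 4 by near: m; exact: h.
move/le_lt_trans; apply.
have : K * d <= k * d.
  by rewrite ler_wpM2r ?(ltW d0)// (le_trans (ler_norm _))// lerDl.
by move: de; lra.
Unshelve. all: by end_near. Qed.

Lemma limnorm_le_eq u v r : (forall m, u m = v m) -> limnorm_le u r ->
  limnorm_le v r.
Proof. by move=> /funext ->. Qed.

Lemma limnorm_le_lim u r (K : R) : (forall d, 0 < d -> limnorm_le u (r + K * d)) ->
  limnorm_le u r.
Proof.
move=> h e e0; pose k := `|K| + 1; have k0 : 0 < k by rewrite ltr_wpDl.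
have d0 : 0 < e / (2 * k) by rewrite divr_gt0// mulr_gt0.
have e2 : 0 < e / 2 by rewrite divr_gt0.
apply: filterS (h _ d0 _ e2) => m /le_trans; apply.
suff : K * (e / (2 * k)) <= e / 2 by lra.
rewrite invfM !mulrA ler_pdivrMr// -mulrA mulrC ler_wpM2l ?(ltW e2)//.
by rewrite (le_trans (ler_norm _))// lerDl.
Qed.

(** Completeness of the bounded sequences modulo null sequences, for the seminorm given by the limit
    superior. *)
Lemma diagonal_limit (u : nat -> nat -> A) :
  (forall j k, limnorm_le (fun m => u j m - u k m) (j.+1%:R^-1 + k.+1%:R^-1)) ->
  exists U : nat -> A, forall j, limnorm_le (fun m => U m - u j m) j.+1%:R^-1.
Proof.
move=> ujk; pose good m k := (forall j, (j <= k)%N ->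
  cnorm (u k m - u j m) <= j.+1%:R^-1 + k.+1%:R^-1 + k.+1%:R^-1).
have goodnear k : \forall m \near \oo, good m k.
  have : \forall m \near \oo, forall j : 'I_k.+1,
      cnorm (u k m - u j m) <= j.+1%:R^-1 + k.+1%:R^-1 + k.+1%:R^-1.
    apply: near_all => j; have := ujk k j; rewrite [k.+1%:R^-1 + _]addrC; apply.
    by rewrite invr_gt0.
  by apply: filterS => m h j jk; exact: (h (Ordinal (jk : (j < k.+1)%N))).
(* K m is the largest k <= m whose comparisons hold at m. It exists since k = 0 always qualifies,
   and it tends to infinity since each k qualifies eventually. *)
have [K KP] : {K : nat -> nat & forall m, good m (K m) /\
    forall k, (k <= m)%N -> good m k -> (k <= K m)%N}.
  apply: (@choice _ _ (fun m K => good m K /\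
    forall k, (k <= m)%N -> good m k -> (k <= K)%N)) => m.
  have h0 : exists k, (k <= m)%N && `[< good m k >].
    exists 0%N; rewrite leq0n /=; apply/asboolP => j; rewrite leqn0 => /eqP ->.
    by rewrite subrr cnorm0 !addr_ge0 ?invr_ge0.
  have hm k : (k <= m)%N && `[< good m k >] -> (k <= m)%N by case/andP.
  case: (ex_maxnP h0 hm) => k /andP[km /asboolP gk] kmax; exists k; split=> // k' k'm gk'.
  by apply: kmax; rewrite k'm; exact/asboolP.
exists (fun m => u (K m) m) => j e e0.
pose k := maxn j (Num.bound (2 / e)).
near=> m; have [gK Kmax] := KP m.
have kK : (k <= K m)%N.
  apply: Kmax; first by near: m; exists k.
  by near: m; exact: goodnear.
have jK : (j <= K m)%N by rewrite (leq_trans _ kK)// leq_maxl.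
rewrite (le_trans (gK j jK))// -addrA lerD2l -mulr2n -[_ *+ 2]mulr_natr.
rewrite ler_pdivrMl// -ler_pdivrMr// ltW// (lt_le_trans (archi_boundP _))//.
  by rewrite divr_ge0// ltW.
by rewrite ler_nat (leq_trans _ (leqnSn _))// (leq_trans _ kK)// leq_maxr.
Unshelve. all: by end_near. Qed.

End LimitNorm.

(** * Countability of the closed terms *)

Section TermEnumeration.
Context {R : realType} {C : countType} {so : C -> sorts (cstar_signature R)}.

(** The proofs carried by [CScal] and [CIncl] are dropped: they are equations between booleans,
    hence unique. *)
Definition symbol_code (f : cstar_symbol) : nat * (rat * rat) * (nat * nat) :=
  match f with
  | CZero => (0%N, (0, 0), (0%N, 0%N))
  | COne => (1%N, (0, 0), (0%N, 0%N))
  | CAdd k l => (2%N, (0, 0), (k, l))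
  | CMul k l => (3%N, (0, 0), (k, l))
  | CStarOp k => (4%N, (0, 0), (k, 0%N))
  | CScal a b k m _ => (5%N, (a, b), (k, m))
  | CIncl k m _ => (6%N, (0, 0), (k, m))
  end.

Lemma symbol_code_inj : injective symbol_code.
Proof.
case=> [||k l|k l|k|a b k m h|k m h] [||k' l'|k' l'|k'|a' b' k' m' h'|k' m' h'] //=;
  case=> *; subst=> //; by rewrite (bool_irrelevance h h').
Qed.

Fixpoint term_code s (t : term so s) :
    GenTree.tree (C + (nat * (rat * rat) * (nat * nat))) :=
  match t with
  | Var c => GenTree.Leaf (inl c)
  | App f a => GenTree.Node 0
      (GenTree.Leaf (inr (symbol_code f)) :: [seq term_code (a k) | k <- enum (arg f)])
  end.

Lemma term_code_inj s (t : term so s) s' (t' : term so s') :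
  term_code t = term_code t' -> existT (term so) s t = existT (term so) s' t'.
Proof.
elim: t s' t' => [c|f a IHa] s' [c'|f' a'] //=; first by case=> ->.
case=> /symbol_code_inj ff; subst f' => aa.
suff -> : a = a' by [].
apply: functional_extensionality_dep => k.
have /IHa : term_code (a k) = term_code (a' k).
  have /eq_in_map := aa; apply; exact: mem_enum.
exact: (Eqdep_dec.inj_pair2_eq_dec _ PeanoNat.Nat.eq_dec).
Qed.

Definition term_pair : Type :=
  {s : sorts (cstar_signature R) & (term so s * term so s)%type}.

Lemma term_pair_enum : exists tp : nat -> option term_pair,
  forall x, exists m, tp m = Some x.
Proof.
pose code (x : term_pair) :=
  pickle (term_code (projT2 x).1, term_code (projT2 x).2).
have codeI : injective code.
  move=> [s [t u]] [s' [t' u']] /(pcan_inj pickleK)[/term_code_inj tt /term_code_inj uu].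
  have ss : s = s' := f_equal (@projT1 _ _) tt; subst s'.
  have -> := Eqdep_dec.inj_pair2_eq_dec _ PeanoNat.Nat.eq_dec _ _ _ _ tt.
  by have -> := Eqdep_dec.inj_pair2_eq_dec _ PeanoNat.Nat.eq_dec _ _ _ _ uu.
exists (fun m => if pselect (exists x, code x = m) is left h then Some (sval (cid h)) else None).
move=> x; exists (code x); case: pselect => [h|[]]; last by exists x.
by congr Some; apply: codeI; case: cid.
Qed.

End TermEnumeration.

Lemma gauss_rat_dense (R : realType) (z : R[i]) (d : R) : 0 < d ->
  exists a b : rat, complex.Re `|z - gauss_rat a b| <= d.
Proof.
move=> d0; have d2 : 0 < d / 2 by rewrite divr_gt0.
have approx (x : R) : exists a : rat, `|x - ratr a| <= d / 2.
  have [|a] := @rat_in_itvoo R (x - d / 2) (x + d / 2); first by lra.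
  by rewrite in_itv /= => /andP[h1 h2]; exists a; rewrite ler_norml; lra.
case: z => x y; have [a ax] := approx x; have [b bx] := approx y.
exists a, b; rewrite normc_def /= -(@ler_pXn2r _ 2) ?nnegrE ?sqrtr_ge0 ?(ltW d0)//.
rewrite sqr_sqrtr ?addr_ge0 ?sqr_ge0//.
have := ler_pM (normr_ge0 _) (normr_ge0 _) ax ax.
have := ler_pM (normr_ge0 _) (normr_ge0 _) bx bx.
rewrite -!expr2 !real_normK ?num_real//; nra.
Qed.

Lemma sqr_bound (x : rat) : exists n : nat, x <= n.+1%:R ^+ 2.
Proof.
exists (Num.bound `|x|); rewrite (le_trans (ler_norm _))// ltW//.
apply: (lt_le_trans (archi_boundP (normr_ge0 _))).
rewrite -natrX ler_nat (leq_trans (leqnSn _))// expnS expn1 leq_pmulr//.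
Qed.

Section Compactness.
Context {R : realType} {D : cstarType R} {C : countType}.
Context {so : C -> sorts (cstar_signature R)}.
Hypothesis hD : strongly_self_absorbing D.

Definition assignment : Type := forall c, cstar_structure D (so c).

Definition cval (v : assignment) (c : C) : D := val (v c : cball D (so c)).

Definition term_val (v : assignment) s (t : term so s) : D :=
  val (Defs.eval v t : cball D s).

Definition pair_dist (v : assignment) (x : term_pair) : R :=
  mdist (Defs.eval v (projT2 x).1) (Defs.eval v (projT2 x).2).

Definition dense_assignment (v : assignment) : Prop :=
  forall k (x : cball D k) e, 0 < e ->
    exists c, so c = k /\ cnorm (cval v c - val x) < e.

Notation tapp f := (@App R (cstar_signature R) C so f).

Definition tzero : term so 0%N := tapp CZero (fun i => match i with end).
Definition tone : term so 0%N := tapp COne (fun i => match i with end).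
Definition tadd k l (t : term so k) (u : term so l) : term so (k + l).+1 :=
  tapp (CAdd k l) (fun i => match i return term so (if i then l else k) with
                            | true => u | false => t end).
Definition tmult k l (t : term so k) (u : term so l) : term so (k * l + k + l)%N :=
  tapp (CMul k l) (fun i => match i return term so (if i then l else k) with
                            | true => u | false => t end).
Definition tadj k (t : term so k) : term so k := tapp (CStarOp k) (fun=> t).
Definition tscal a b k m h (t : term so k) : term so m := tapp (@CScal a b k m h) (fun=> t).
Definition tincl k m h (t : term so k) : term so m := tapp (@CIncl k m h) (fun=> t).

(** Along a sequence of counterexamples [w L] all distances between terms converge to those under
    [v]. So the value of a constant under [w m] depends, asymptotically, only on its value under
    [v]; by density this extends to an asymptotic homomorphism of [D], and its being approximately
    inner contradicts the choice of [w]. *)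
Lemma assignment_compact (tp : nat -> option (@term_pair R C so)) v N e :
  (forall x, exists m, tp m = Some x) -> dense_assignment v -> 0 < e ->
  exists L, forall w : assignment,
    (forall m x, (m < L)%N -> tp m = Some x ->
       `|pair_dist w x - pair_dist v x| <= L.+1%:R^-1) ->
    exists u, unitary u /\ forall c, (pickle c < N)%N ->
      cnorm (u * cval w c * star u - cval v c) < e.
Proof.
move=> tpS vdense e0; apply: contrapT => no.
have {no} : forall L, exists w : assignment,
    (forall m x, (m < L)%N -> tp m = Some x ->
       `|pair_dist w x - pair_dist v x| <= L.+1%:R^-1) /\
    ~ exists u, unitary u /\ forall c, (pickle c < N)%N ->
      cnorm (u * cval w c * star u - cval v c) < e.
  move=> L; apply: contrapT => nw; apply: no; exists L => w wv.
  by apply: contrapT => nu; apply: nw; exists w.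
move=> /choice[w wP].
have pconv x d : 0 < d -> \forall L \near \oo,
    `|pair_dist (w L) x - pair_dist v x| <= d.
  move=> d0; have [m mx] := tpS x; near=> L.
  have [wL _] := wP L; apply: (le_trans (wL m x _ mx)); first by near: L; exists m.+1.
  rewrite -[leRHS]invrK lef_pV2 ?posrE ?invr_gt0// ltW//.
  rewrite (lt_le_trans (archi_boundP _)) ?invr_ge0 ?(ltW d0)//.
  by rewrite ler_nat (leq_trans _ (leqnSn L))//; near: L; exists (Num.bound d^-1).
(* Terms of different sorts are compared after inclusion into a common ball. *)
have cross s (t : term so s) s' (t' : term so s') :
    limnorm_le (fun m => term_val (w m) t - term_val (w m) t')
      (cnorm (term_val v t - term_val v t')).
  move=> d d0; have := pconv (existT _ (maxn s s')
    (tincl (leq_maxl s s') t, tincl (leq_maxr s s') t')) d d0.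
  apply: filterS => m; rewrite /pair_dist /= !cball_mdistE /= ler_norml.
  by rewrite -/(term_val _ _); rewrite /term_val; lra.
have vD (x : D) d : 0 < d -> exists c, cnorm (x - cval v c) < d.
  move=> d0; have xk : cnorm x <= (Num.bound (cnorm x)).+1%:R.
    rewrite ltW// (lt_le_trans (archi_boundP (cnorm_ge0 x)))//.
    by rewrite ler_nat.
  have [c [_ cx]] := vdense _ (exist _ x xk : cball D _) d d0.
  by exists c; rewrite cdistC.
(* The image of x is the diagonal limit of the values under [w m] of constants whose values under
   [v] tend to x. *)
have /choice[W0 W0P] : forall x : D, exists U : nat -> D, forall c,
    limnorm_le (fun m => U m - cval (w m) c) (cnorm (x - cval v c)).
  move=> x.
  have /choice[cj cjP] : forall j : nat, exists c, cnorm (x - cval v c) < j.+1%:R^-1.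
    by move=> j; apply: vD; rewrite invr_gt0.
  have [|U UP] := @diagonal_limit _ _ (fun j m => cval (w m) (cj j)).
    move=> j k; apply: limnorm_leW (cross _ (Var so (cj j)) _ (Var so (cj k))).
    apply: le_trans (cdistD x _ _) _; apply: lerD; last exact/ltW/cjP.
    by rewrite cdistC; exact/ltW/cjP.
  exists U => c d d0.
  have d4 : 0 < d / 4 by rewrite divr_gt0.
  pose j := Num.bound (d / 4)^-1.
  have jd : j.+1%:R^-1 <= d / 4.
    rewrite -[leRHS]invrK lef_pV2 ?posrE ?invr_gt0// ltW//.
    rewrite (lt_le_trans (archi_boundP _)) ?invr_ge0 ?(ltW d4)//.
    by rewrite ler_nat.
  near=> m.
  have h1 : cnorm (U m - cval (w m) (cj j)) <= j.+1%:R^-1 + d / 4.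
    by near: m; exact: UP.
  have h2 : cnorm (cval (w m) (cj j) - cval (w m) c) <=
      cnorm (cval v (cj j) - cval v c) + d / 4.
    by near: m; exact: (cross _ (Var so (cj j)) _ (Var so c)).
  have h3 := cdistD x (cval v (cj j)) (cval v c).
  have h4 := cjP j; rewrite cdistC in h4.
  apply: le_trans (cdistD (cval (w m) (cj j)) _ _) _.
  by move: h1 h2 h3 h4 jd; set q := j.+1%:R^-1; lra.
pose W m x := W0 x m.
have WP x c : limnorm_le (fun m => W m x - cval (w m) c) (cnorm (x - cval v c)) := W0P x c.
have Wnorm x : limnorm_le (W^~ x) (cnorm x).
  move=> d d0; have d4 : 0 < d / 4 by rewrite divr_gt0.
  have [c cx] := vD x _ d4.
  have h := limnorm_leD (WP x c) (cross _ (Var so c) _ tzero).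
  near=> m.
  have : cnorm ((W m x - cval (w m) c) + (cval (w m) c - 0)) <=
      cnorm (x - cval v c) + cnorm (cval v c - 0) + d / 4 by near: m; exact: h.
  rewrite !subr0 subrK => /le_trans; apply.
  have : cnorm (cval v c) <= cnorm (cval v c - x) + cnorm x.
    by rewrite -{1}(subrK x (cval v c)) cnormD.
  by rewrite cdistC; lra.
have Wterm x s (t : term so s) :
    limnorm_le (fun m => W m x - term_val (w m) t) (cnorm (x - term_val v t)).
  apply: (@limnorm_le_lim _ _ _ _ 2) => d d0; have [c cx] := vD x _ d0.
  have h := limnorm_leD (WP x c) (cross _ (Var so c) _ t).
  apply: limnorm_leW (limnorm_le_eq _ h); last by move=> m; rewrite addrA subrK.
  have := cdistD x (cval v c) (term_val v t); rewrite (cdistC _ x).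
  by move: cx; rewrite /cval /term_val /=; lra.
have cvalnorm x c d : cnorm (x - cval v c) < d ->
    limnorm_le (fun m => cval (w m) c) (cnorm x + d).
  move=> cx; have h := cross _ (Var so c) _ tzero.
  apply: limnorm_leW (limnorm_le_eq _ h); last by move=> m; rewrite subr0.
  have := cnormD (cval v c - x) x; rewrite subrK cdistC.
  by move: cx; rewrite /cval /term_val /= subr0; lra.
have hW : asymptotic_hom W.
  split; last exact: Wnorm.
  - move=> x y; apply: (@limnorm_le_aeq _ _ _ _ 4) => d d0 d1.
    have [a ax] := vD x _ d0; have [b bx] := vD y _ d0.
    (* Both sides are compared with the value of the term a + b, on which addition is exact; the
       other operations are handled alike. *)
    have h := limnorm_leB (Wterm (x + y) _ (tadd (Var so a) (Var so b)))
      (limnorm_leD (WP x a) (WP y b)).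
    apply: limnorm_leW (limnorm_le_eq _ h); last first.
      by move=> m; rewrite [X in _ - X]addrACA -opprD opprB addrA subrK.
    have := cnormD (x - cval v a) (y - cval v b).
    by rewrite addrACA -opprD /term_val /=; move: ax bx; rewrite /cval; lra.
  - move=> z x; pose Kz := complex.Re `|z| + 1.
    apply: (@limnorm_le_aeq _ _ _ _ (2 * (cnorm x + Kz))) => d d0 d1.
    have [a ax] := vD x _ d0.
    (* The language multiplies by Gaussian rationals only, so z is first approximated by one. *)
    have [q1 [q2 qz]] : exists q1 q2 : rat, complex.Re `|z - gauss_rat q1 q2| <= d.
      exact: gauss_rat_dense.
    pose k := so a.
    have [n hn] : exists n : nat, (q1 ^+ 2 + q2 ^+ 2) * k.+1%:R ^+ 2 <= n.+1%:R ^+ 2 :> rat.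
      exact: sqr_bound.
    pose q := gauss_rat q1 q2 : R[i].
    have qn : complex.Re `|q| <= Kz.
      have := ler_normB z (z - q); rewrite subKr lecE raddfD => /andP[_ /le_trans]; apply.
      by rewrite lerD2l (le_trans qz).
    have h := limnorm_leB (Wterm (z *: x) _ (tscal hn (Var so a)))
      (limnorm_leD (limnorm_leZ (z - q) (cnorm_ge0 x) (Wnorm x))
         (limnorm_leZ q (cnorm_ge0 _) (WP x a))).
    apply: limnorm_leW (limnorm_le_eq _ h); last first.
      move=> m; rewrite scalerBl scalerBr addrA subrK.
      by rewrite opprB addrA subrK.
    have h1 : cnorm (z *: x - q *: cval v a) <=
        complex.Re `|z - q| * cnorm x + complex.Re `|q| * cnorm (x - cval v a).
      rewrite -!cnormZ (le_trans _ (cnormD _ _))// scalerBl scalerBr.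
      by rewrite addrA subrK.
    have h2 := ler_wpM2r (cnorm_ge0 x) qz.
    have h3 := ler_pM (Re_norm_ge0 q) (cnorm_ge0 _) qn (ltW ax).
    by move: h1 h2 h3; rewrite /term_val /cval /= -/q; lra.
  - move=> x y; apply: (@limnorm_le_aeq _ _ _ _ (2 * (cnorm x + cnorm y + 1))) => d d0 d1.
    have [a ax] := vD x _ d0; have [b bx] := vD y _ d0.
    have bn := limnorm_leW (lerD (lexx (cnorm y)) d1) (cvalnorm y b d bx).
    have y1 : 0 <= cnorm y + 1 by rewrite addr_ge0 ?cnorm_ge0.
    have h := limnorm_leB (Wterm (x * y) _ (tmult (Var so a) (Var so b)))
      (limnorm_leD (limnorm_leM (cnorm_ge0 _) (cnorm_ge0 _) (Wnorm x) (WP y b))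
        (limnorm_leM (cnorm_ge0 _) y1 (WP x a) bn)).
    apply: limnorm_leW (limnorm_le_eq _ h); last first.
      by move=> m; rewrite mulrBr mulrBl addrA subrK opprB addrA subrK.
    have h1 := cdistM x y (cval v a) (cval v b).
    have h2 : cnorm (cval v b) <= cnorm y + 1.
      have := cnormD (cval v b - y) y; rewrite subrK cdistC.
      by move: bx d1; lra.
    have h3 := ler_wpM2l (cnorm_ge0 x) (ltW bx).
    have h4 := ler_pM (cnorm_ge0 _) (cnorm_ge0 _) (ltW ax) h2.
    have h5 := ler_wpM2r y1 (ltW ax).
    by move: h1 h3 h4 h5; rewrite /term_val /cval /=; lra.
  - apply: (@limnorm_le_aeq _ _ _ _ 0) => d d0 d1.
    have h := Wterm 1 _ tone; rewrite /term_val /= subrr cnorm0 in h.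
    by rewrite mul0r; exact: h.
  - move=> x; apply: (@limnorm_le_aeq _ _ _ _ 2) => d d0 d1.
    have [a ax] := vD x _ d0.
    have h := limnorm_leB (Wterm (star x) _ (tadj (Var so a))) (limnorm_le_star (WP x a)).
    apply: limnorm_leW (limnorm_le_eq _ h); last first.
      by move=> m; rewrite starB opprB addrA subrK.
    by rewrite /term_val /= -starB cnorm_starE; move: ax; rewrite /cval; lra.
pose cs := pmap (@pickle_inv C) (iota 0 N).
have mcs c : (pickle c < N)%N -> c \in cs.
  move=> cN; rewrite mem_pmap; apply/mapP; exists (pickle c); rewrite ?pickleK_inv//.
  by rewrite mem_iota.
have e2 : 0 < e / 2 by rewrite divr_gt0.
have U := ssa_asymptotic_hom_inner (map (cval v) cs) hD hW e2.
have V : \forall m \near \oo, forall c, c \in cs ->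
    cnorm (W m (cval v c) - cval (w m) c) <= 0 + e / 2.
  by apply: near_seq => c _; have := WP (cval v c) c; rewrite subrr cnorm0; apply.
have [m _ mP] := filterI U V.
have [[u [uu uP]] Vm] := mP m (leqnn m).
have [_] := wP m; apply; exists u; split=> // c /mcs cN.
have h1 := Vm c cN; have h2 := uP (cval v c) (map_f (cval v) cN).
apply: (le_lt_trans (cdistD (u * W m (cval v c) * star u) _ _)).
rewrite -mulrBl -mulrBr (cnorm_unitaryr _ (unitary_star uu)) cnorm_unitaryl//.
by rewrite cdistC in h1; move: h1 h2; rewrite /=; lra.
Unshelve. all: by end_near. Qed.

End Compactness.

(** * The game *)

(** Choice with a default value, so that the strategy is a total function even on histories with
    illegal moves. *)
Definition pick_default (T : Type) (x0 : T) (P : T -> Prop) : T :=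
  if pselect (exists x, P x) is left h then sval (cid h) else x0.

Lemma pick_defaultP (T : Type) (x0 : T) (P : T -> Prop) :
  (exists x, P x) -> P (pick_default x0 P).
Proof. by move=> h; rewrite /pick_default; case: pselect => // h'; case: cid. Qed.

Lemma half_pow_small (R : realType) (e : R) : 0 < e ->
  exists N, forall n, (N <= n)%N -> (2^-1 : R) ^+ n < e.
Proof.
move=> e0; have : (fun n => (2^-1 : R) ^+ n) @ \oo --> (0 : R).
  by apply: cvg_expr; rewrite ger0_norm ?invr_ge0// invf_lt1 ?ltr1n// ltr0n.
move/cvgr0Pnorm_lt => /(_ e e0)[N _ NP]; exists N => n /NP /=.
by rewrite ger0_norm// exprn_ge0 ?invr_ge0.
Qed.

(** * Assignments of the constants in D *)

Section Witnesses.
Context {R : realType} {D : cstarType R} {C : countType}.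
Context {so : C -> sorts (cstar_signature R)} {F : connectives R}.

Local Notation assignment := (@assignment R D C so).
Local Notation position := (position F so).

Definition zero_assignment : assignment :=
  fun c => (exist _ 0 (cball0_subproof (so c)) : cball D (so c)).

Definition holds (v : assignment) (p : position) : Prop :=
  forall e, p e -> qf_eval v e.1 < e.2.

Local Notation theory := (universal_theory (cstar_structure D)).

Lemma condition_holds (p : position) : condition theory p -> exists v, holds v p.
Proof.
move=> cp; have [|v vp] := @condition_witness _ _ _ _ _ (cstar_structure D) p _ cp.
  by move=> k; constructor; exact: (exist _ 0 (cball0_subproof k) : cball D k).
by exists v.
Qed.

Lemma holds_condition (v : assignment) (p : position) :
  finite_set p -> holds v p -> condition theory p.
Proof. by move=> fp vp; split=> //; exists (cstar_structure D), v; split. Qed.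

Lemma conjugate_assignment (u : D) (v : assignment) : unitary u ->
  exists v' : assignment, (forall c, cval v' c = u * cval v c * star u) /\
    forall p : position, holds v p -> holds v' p.
Proof.
move=> uu; have nu k (x : cball D k) : cnorm (u * val x * star u) <= k.+1%:R.
  by rewrite (cnorm_unitaryr _ (unitary_star uu)) cnorm_unitaryl// (svalP x).
pose h k (x : cstar_structure D k) : cstar_structure D k :=
  (exist (fun y : D => cnorm y <= k.+1%:R) _ (nu k x) : cball D k).
exists (fun c => h _ (v c)); split=> // p vp e pe.
rewrite qf_eval_morphism; first exact: vp.
- move=> k x y; rewrite !cball_mdistE /= -mulrBl -mulrBr.
  by rewrite (cnorm_unitaryr _ (unitary_star uu)) cnorm_unitaryl.
- case=> [||k l|k l|k|a b k m hm|k m hm] x; apply: val_inj => /=.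
  + by rewrite mulr0 mul0r.
  + by rewrite mulr1 (proj2 uu).
  + by rewrite mulrDr mulrDl.
  + by rewrite -!mulrA (mulrA (star u) u) (proj1 uu) mul1r.
  + by rewrite !starM starK mulrA.
  + by rewrite -scalerAr -scalerAl.
  + by [].
Qed.

Lemma dense_sequences : separable D -> exists d : forall k, nat -> cball D k,
  forall k (x : cball D k) e, 0 < e -> exists n, cnorm (val (d k n) - val x) < e.
Proof.
move=> [s sD].
(* A point of the dense sequence may lie outside the ball, so a nearby point of the ball is picked;
   the default 0 stands in where there is none. *)
pose d k n : cball D k := let i := odflt (0, 0)%N (unpickle n) in
  pick_default (exist _ 0 (cball0_subproof k))
    (fun y : cball D k => cnorm (val y - s i.1) < i.2.+1%:R^-1).
exists d => k x e e0; pose m := Num.bound (2 / e).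
have [n sn] : exists n, cnorm (val x - s n) < m.+1%:R^-1.
  by apply: sD; rewrite invr_gt0.
exists (pickle (n, m)); rewrite /d pickleK /=.
set y := pick_default _ _.
have yP : cnorm (val y - s n) < m.+1%:R^-1.
  by apply: (@pick_defaultP _ _ (fun y : cball D k => cnorm (val y - s n) < m.+1%:R^-1)); exists x.
apply: le_lt_trans (cdistD (s n) _ _) _; rewrite (cdistC (s n)).
have : m.+1%:R^-1 <= e / 2.
  rewrite -[leRHS]invrK lef_pV2 ?posrE ?invr_gt0 ?divr_gt0// invf_div ltW//.
  rewrite (lt_le_trans (archi_boundP _)) ?divr_ge0 ?(ltW e0)//.
  by rewrite ler_nat.
by move: yP sn; set q := m.+1%:R^-1; lra.
Qed.

Lemma dense_extension (v : assignment) (N : nat) : separable D ->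
  (forall k, infinite_set [set c | so c = k]) ->
  exists v' : assignment, dense_assignment v' /\
    forall c, (pickle c < N)%N -> v' c = v c.
Proof.
move=> /dense_sequences[d dP] hC.
have far k n : exists c, so c = k /\ (n <= pickle c)%N.
  apply: contrapT => no; apply: (hC k).
  apply: (@sub_finite_set _ _ (@pickle C @^-1` `I_n)); last first.
    apply: finite_preimage; last exact: finite_II.
    by move=> x y _ _; exact: (pcan_inj pickleK).
  move=> c /= ck; rewrite /= ltnNge; apply/negP => nc; apply: no; by exists c.
have /choice[f fP] : forall k, exists f : nat -> C,
    injective f /\ forall i, so (f i) = k /\ (N <= pickle (f i))%N.
  move=> k; have /choice[g gP] := far k.
  (* Each constant is taken beyond the code of its predecessor, so the codes increase strictly and
     avoid those below [N]. *)
  pose fix f i := if i is i'.+1 then g (pickle (f i')).+1 else g N.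
  have fS i : (pickle (f i) < pickle (f i.+1))%N by have [_] := gP (pickle (f i)).+1.
  have fmono i j : (i < j)%N -> (pickle (f i) < pickle (f j))%N.
    elim: j => // j IHj; rewrite ltnS leq_eqVlt => /orP[/eqP ->|/IHj h]; first exact: fS.
    exact: ltn_trans h (fS j).
  exists f; split=> [i j ij|i].
    by case: (ltngtP i j) => // /fmono; rewrite ij ltnn.
  split; first by case: i => [|i]; [have [] := gP N|have [] := gP (pickle (f i)).+1].
  by elim: i => [|i IHi]; [have [] := gP N|exact: leq_trans IHi (ltnW (fS i))].
pose rank c := pick_default 0%N (fun i => f (so c) i = c).
exists (fun c => if (pickle c < N)%N then v c else d (so c) (rank c)); split; last first.
  by move=> c ->.
move=> k x e e0; have [i di] := dP k x e e0.
have [fI /(_ i)[sk Nk]] := fP k; exists (f k i); split=> //.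
rewrite /cval ltnNge Nk /=.
have -> : rank (f k i) = i.
  apply: fI; have := @pick_defaultP _ 0%N (fun j => f (so (f k i)) j = f k i).
  by rewrite -/(rank _) sk; apply; exists i.
have -> // : val (d (so (f k i)) i) = val (d k i) by rewrite sk.
Qed.

End Witnesses.

Section Game.
Context {R : realType} {D : cstarType R} {F : connectives R} {C : countType}.
Context {so : C -> sorts (cstar_signature R)}.
Hypotheses (hD : strongly_self_absorbing D) (Fdense : uniformly_dense F).
Hypothesis hC : forall k, infinite_set [set c | so c = k].
Variables (d : forall k, nat -> cball D k) (tp : nat -> option (@term_pair R C so)).
Hypothesis dP : forall k (x : cball D k) e, 0 < e ->
  exists n, cnorm (val (d k n) - val x) < e.
Hypothesis tpP : forall x, exists m, tp m = Some x.

Local Notation assignment := (@assignment R D C so).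
Local Notation position := (position F so).
Local Notation theory := (universal_theory (cstar_structure D)).
Local Notation radius n := ((2^-1 : R) ^+ n).

(** The invariant after round n. [good_next] is the stability gained from compactness and links the
    rounds, [good_dist] makes the play definitive, and [good_dense] makes the limit assignment
    dense. *)
Record good (n : nat) (v : assignment) (q : position) (N : nat) : Prop := Good {
  good_finite : finite_set q;
  good_holds : holds v q;
  good_dense : forall k i, (k <= n)%N -> (i <= n)%N -> exists c,
    [/\ so c = k, (pickle c < N)%N & cnorm (cval v c - val (d k i)) < radius n];
  good_dist : forall m x, (m < n)%N -> tp m = Some x ->
    forall (M : structure (cstar_signature R)) (v' : forall c, M (so c)),
      (forall e, q e -> qf_eval v' e.1 < e.2) ->
      `|mdist (Defs.eval v' (projT2 x).1) (Defs.eval v' (projT2 x).2) -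
        pair_dist v x| <= n.+1%:R^-1;
  good_next : forall p, q `<=` p -> condition theory p -> exists v1, holds v1 p /\
    forall c, (pickle c < N)%N -> cnorm (cval v1 c - cval v c) < radius n }.

(** [step_margin] sharpens each strict bound of the opponent, so that it survives the passage to the
    limit; [step_n] ensures that every constant is eventually among those under control. *)
Record step (n : nat) (p : position) (v1 : assignment) (N0 : nat)
    (v : assignment) (q : position) (N : nat) : Prop := Step {
  step_sub : p `<=` q;
  step_le : (N0 <= N)%N;
  step_n : (n <= N)%N;
  step_agree : forall c, (pickle c < N0)%N -> cval v c = cval v1 c;
  step_margin : forall e, p e -> exists r, r < e.2 /\ q (e.1, r);
  step_good : good n v q N }.

Lemma radius_gt0 n : 0 < radius n.
Proof. by rewrite exprn_gt0// invr_gt0. Qed.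

Lemma step_exists n p v1 N0 : finite_set p -> holds v1 p ->
  exists v q N, step n p v1 N0 v q N.
Proof.
move=> fp v1p; have [Np NpP] := position_support fp.
(* Constants with codes below [N0] are settled, and [p] depends only on those below [Np]; all others
   are free to be made dense. *)
have [v [vdense vv1]] := dense_extension v1 (maxn N0 Np) hD.1 hC.
have vp : holds v p.
  move=> e pe; rewrite (NpP _ v v1)//; first exact: v1p.
  by move=> c cN; apply: vv1; rewrite (leq_trans cN)// leq_maxr.
have [||Nd NdP] := finType_bound (P := fun (ki : 'I_n.+1 * 'I_n.+1) Nd => exists c,
    [/\ so c = ki.1, (pickle c < Nd)%N & cnorm (cval v c - val (d ki.1 ki.2)) < radius n]).
- by move=> ki a b ab [c [sc ca cd]]; exists c; split=> //; exact: leq_trans ab.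
- move=> ki; have [c [sc cd]] := vdense ki.1 (d ki.1 ki.2) _ (radius_gt0 n).
  by exists (pickle c).+1, c.
pose N := maxn (maxn N0 n) Nd.
have [L LP] := assignment_compact hD N tpP vdense (radius_gt0 n).
(* [n] serves [good_dist] and [L], the number of demands from compactness, serves [good_next]. *)
pose K := maxn n L; pose dK : R := K.+1%:R^-1.
have dK0 : 0 < dK by rewrite invr_gt0.
have cons m : exists q : position, [/\ finite_set q, holds v q &
    forall x, tp m = Some x ->
    forall (M : structure (cstar_signature R)) (v' : forall c, M (so c)),
      (forall e, q e -> qf_eval v' e.1 < e.2) ->
      `|mdist (Defs.eval v' (projT2 x).1) (Defs.eval v' (projT2 x).2) -
        pair_dist v x| <= dK].
  case: (tp m) => [x|]; last by exists set0; split.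
  have [q [fq vq qP]] :=
    dist_position (projT2 x).1 (projT2 x).2 (pair_dist v x) Fdense dK0.
  exists q; split=> // [|_ [<-]]; [exact: vq|exact: qP].
have /choice[Q QP] := cons.
(* The midpoint lies above the value under [v], so [v] satisfies the answer, and below the
   opponent's bound. *)
pose margin := [set (e.1, (qf_eval v e.1 + e.2) / 2) | e in p].
pose q : position := p `|` margin `|` \bigcup_(m in `I_K) Q m.
have marginP e : p e -> qf_eval v e.1 < (qf_eval v e.1 + e.2) / 2 < e.2.
  by move=> /vp pe; rewrite ltr_pdivlMr// ltr_pdivrMr//; lra.
have vq : holds v q.
  move=> e [[|[e' pe' <-]]|[m _]]; [exact: vp| |have [_ vQ _] := QP m; exact: vQ].
  by have /andP[] := marginP e' pe'.
exists v, q, N; split.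
- by move=> e pe; left; left.
- by rewrite /N !leq_max leqnn.
- by rewrite /N !leq_max leqnn orbT.
- by move=> c cN; rewrite /cval vv1// (leq_trans cN)// leq_maxl.
- move=> e pe; exists ((qf_eval v e.1 + e.2) / 2).
  have /andP[_ ->] := marginP e pe; split=> //; left; right; by exists e.
split=> //.
- rewrite !finite_setU; split; first by split=> //; exact: finite_image.
  by apply: bigcup_finite => [|m _]; [exact: finite_II|have [] := QP m].
- move=> k i kn i_n.
  have [c [sc cN cd]] := NdP (Ordinal (kn : (k < n.+1)%N), Ordinal (i_n : (i < n.+1)%N)).
  by exists c; split=> //; rewrite (leq_trans cN)// leq_maxr.
- move=> m x mn mx M v' v'q; have [_ _ /(_ x mx M v')] := QP m.
  move=> h; apply: le_trans (h _) _.
    by move=> e Qe; apply: v'q; right; exists m => //=; rewrite /K leq_max mn.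
  by rewrite lef_pV2 ?posrE// ler_nat ltnS leq_maxl.
(* Any [w] in [D] satisfying the opponent's reply still meets the demands, so some conjugate of it
   is close to [v] and satisfies the reply as well. *)
move=> p' qp' /condition_holds[w wp'].
have [|u [uu uP]] := LP w.
  move=> m x mL mx; have [_ _ /(_ x mx _ w)] := QP m.
  move=> h; apply: le_trans (h _) _.
    by move=> e Qe; apply/wp'/qp'; right; exists m => //=; rewrite /K leq_max mL orbT.
  by rewrite lef_pV2 ?posrE// ler_nat ltnS leq_maxr.
have [w' [w'E w'p]] := @conjugate_assignment _ _ _ _ F u w uu.
by exists w'; split; [exact: w'p|move=> c cN; rewrite w'E; exact: uP].
Qed.

Definition state : Type := assignment * position * nat.

Let state0 : state := (zero_assignment, set0, 0%N).

Definition next_state (n : nat) (p : position) (v1 : assignment) (N0 : nat) : state :=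
  pick_default state0 (fun st => step n p v1 N0 st.1.1 st.1.2 st.2).

Definition next_witness (n : nat) (p : position) (st : state) : assignment :=
  pick_default zero_assignment (fun v1 => holds v1 p /\
    forall c, (pickle c < st.2)%N -> cnorm (cval v1 c - cval st.1.1 c) < radius n).

Fixpoint run (pe : nat -> position) (n : nat) : state :=
  match n with
  | 0 => next_state 0 (pe 0%N) (pick_default zero_assignment (fun v => holds v (pe 0%N))) 0
  | n'.+1 => let st := run pe n' in
      next_state n (pe n) (next_witness n' (pe n) st) st.2
  end.

Lemma eq_run pe pe' n : (forall k, (k <= n)%N -> pe k = pe' k) ->
  run pe n = run pe' n.
Proof.
elim: n => [|n IHn] h /=; first by rewrite h.
by rewrite (IHn (fun k kn => h k (leqW kn))) (h n.+1 (leqnn _)).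
Qed.

(** A history of length 2n + 1 has the opponent's moves at its even places; all earlier rounds are
    recomputed from them. *)
Definition strategy (h : seq position) : position :=
  (run (fun k => nth set0 h k.*2) (size h)./2).1.2.

Section Play.
Variable p : nat -> position.
Hypothesis pS : follows strategy p.

Let st n := run (fun k => p k.*2) n.
Let v n : assignment := (st n).1.1.
Let q n : position := (st n).1.2.
Let N n : nat := (st n).2.

Let oddE n : p n.*2.+1 = q n.
Proof.
rewrite pS /strategy size_mkseq /=.
have -> : uphalf n.*2 = n by rewrite uphalf_double.
congr ((_ : state).1.2); apply: eq_run => k kn.
by rewrite nth_mkseq// ltnS leq_double.
Qed.

Let witness n : assignment :=
  if n is n'.+1 then next_witness n' (p n.*2) (st n')
  else pick_default zero_assignment (fun v => holds v (p 0%N)).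

Let N0 n := if n is n'.+1 then N n' else 0%N.

Let witnessP n : legal theory p n.*2 ->
  (forall n', n = n'.+1 -> good n' (v n') (q n') (N n')) ->
  holds (witness n) (p n.*2) /\
  forall n', n = n'.+1 -> forall c, (pickle c < N n')%N ->
    cnorm (cval (witness n) c - cval (v n') c) < radius n'.
Proof.
case: n => [|n] [cp sub] gd.
  split=> //; apply: (pick_defaultP zero_assignment (P := fun v => holds v (p 0%N))).
  exact: condition_holds.
have [w wP] : exists v1, holds v1 (p n.+1.*2) /\
    forall c, (pickle c < N n)%N -> cnorm (cval v1 c - cval (v n) c) < radius n.
  apply: (good_next (gd n erefl)) => //; rewrite -oddE; exact: sub.
have [h1 h2] := pick_defaultP zero_assignment (P := fun v1 => holds v1 (p n.+1.*2) /\
    forall c, (pickle c < N n)%N -> cnorm (cval v1 c - cval (v n) c) < radius n)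
    (ex_intro _ w wP).
by split=> // n' [<-].
Qed.

Let stepP n : (forall m, (m <= n)%N -> legal theory p m.*2) ->
  step n (p n.*2) (witness n) (N0 n) (v n) (q n) (N n).
Proof.
elim: n => [|n IHn] lg; last have IH := IHn (fun m mn => lg m (leqW mn)).
  have [h _] := witnessP (lg 0%N (leqnn 0)) (fun n' (e : 0%N = n'.+1) => ltac:(by [])).
  have [w [q' [N' s]]] := step_exists 0 0 (lg 0%N (leqnn 0)).1.1 h.
  exact: (pick_defaultP state0 (P := fun st => step _ _ _ _ st.1.1 st.1.2 st.2)
    (ex_intro _ (w, q', N') s)).
have [|h _] := witnessP (lg n.+1 (leqnn _)); first by move=> n' [<-]; exact: step_good IH.
have [w [q' [N' s]]] := step_exists n.+1 (N n) (lg n.+1 (leqnn _)).1.1 h.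
exact: (pick_defaultP state0 (P := fun st => step _ _ _ _ st.1.1 st.1.2 st.2)
  (ex_intro _ (w, q', N') s)).
Qed.

Lemma strategy_legal n : (forall m, (m <= n)%N -> legal theory p m.*2) ->
  legal theory p n.*2.+1.
Proof.
move=> /stepP s; rewrite /legal oddE; split; last exact: step_sub s.
exact: holds_condition (good_finite (step_good s)) (good_holds (step_good s)).
Qed.

Hypothesis lg : forall n, legal theory p n.*2.

Let S n := stepP (fun m (_ : (m <= n)%N) => lg m).
Let G n := step_good (S n).

Let N_mono m n : (m <= n)%N -> (N m <= N n)%N.
Proof.
elim: n => [|n IHn]; first by rewrite leqn0 => /eqP ->.
rewrite leq_eqVlt => /orP[/eqP ->//|]; rewrite ltnS => /IHn/leq_trans; apply.
exact: step_le (S n.+1).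
Qed.

Let v_step n c : (pickle c < N n)%N -> cnorm (cval (v n.+1) c - cval (v n) c) < radius n.
Proof.
move=> cN; rewrite (step_agree (S n.+1))//.
have [|_ h] := witnessP (lg n.+1); first by move=> n' [<-]; exact: G.
exact: (h n erefl).
Qed.

(** The right-hand side is the geometric sum of the radii of rounds m to n - 1. *)
Let v_close m n c : (pickle c < N m)%N -> (m <= n)%N ->
  cnorm (cval (v n) c - cval (v m) c) <= 2 * radius m - 2 * radius n.
Proof.
move=> cN; elim: n => [|n IHn]; first by rewrite leqn0 => /eqP ->; rewrite !subrr cnorm0.
rewrite leq_eqVlt => /orP[/eqP <-|]; first by rewrite !subrr cnorm0.
rewrite ltnS => mn; apply: (le_trans (cdistD (cval (v n) c) _ _)).
have h1 := IHn mn; have h2 := v_step (leq_trans cN (N_mono mn)).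
rewrite exprS; lra.
Qed.

Let limit_ex c : exists l : cball D (so c), forall n, (pickle c < N n)%N ->
  cnorm (val l - cval (v n) c) <= 2 * radius n.
Proof.
have cN n : (pickle c < n)%N -> (pickle c < N n)%N.
  by move=> cn; rewrite (leq_trans cn)// (step_n (S n)).
have [|l lP] := @cnorm_complete R D (fun n => cval (v n) c).
  move=> e e0; have [K KP] := half_pow_small (divr_gt0 e0 (ltr0n R 4)).
  exists (maxn K (pickle c).+1) => m n.
  rewrite !geq_max => /andP[Km cm] /andP[Kn cn].
  wlog mn : m n Km cm Kn cn / (m <= n)%N.
    move=> h; case/orP: (leq_total m n) => mn; first exact: h.
    by rewrite cdistC; exact: h.
  rewrite cdistC (le_lt_trans (v_close (cN _ cm) mn))//.
  have := KP m Km; have := radius_gt0 n; lra.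
have lk : cnorm l <= (so c).+1%:R.
  apply: (@cnorm_lim _ _ _ _ (fun n => cval (v n) c)) => [n|e /lP[K KP]].
    exact: (svalP (v n c : cball D (so c))).
  by exists K; exact: KP.
exists (exist _ l lk) => n cn /=; apply/ler_addgt0Pr => e e0; have [K KP] := lP e e0.
have h1 := KP _ (leq_maxl K n); have h2 := v_close cn (leq_maxr K n).
rewrite cdistC in h1; apply: (le_trans (cdistD (cval (v (maxn K n)) c) _ _)).
have := radius_gt0 (maxn K n); lra.
Qed.

Let vlim : assignment := fun c => sval (cid (limit_ex c)).

Let vlim_close n c : (pickle c < N n)%N ->
  cnorm (cval vlim c - cval (v n) c) <= 2 * radius n.
Proof. by rewrite /cval /vlim; case: cid => /= l; exact. Qed.

Let vlim_cvg c e : 0 < e -> \forall n \near \oo, mdist (v n c) (vlim c) < e.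
Proof.
move=> e0; have [K KP] := half_pow_small (divr_gt0 e0 (ltr0n R 4)).
exists (maxn K (pickle c).+1) => // n /=; rewrite geq_max => /andP[Kn cn].
rewrite cball_mdistE cdistC; have := vlim_close (leq_trans cn (step_n (S n))).
rewrite /cval => /le_lt_trans; apply; have := KP n Kn; lra.
Qed.

Let p_mono m n : (m <= n)%N -> p m `<=` p n.
Proof.
elim: n => [|n IHn]; first by rewrite leqn0 => /eqP ->.
rewrite leq_eqVlt => /orP[/eqP ->//|]; rewrite ltnS => /IHn h; apply: (subset_trans h).
have [b] : exists k, n = k.*2 \/ n = k.*2.+1.
  exists n./2; rewrite -{1 3}(odd_double_half n); case: odd; [by right|by left].
case=> ->; first by rewrite oddE; exact: step_sub (S b).
by have [_] := lg b.+1.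
Qed.

(** A bound in [p k] also lies in the opponent's move [p k.*2]. The answer contains a strictly
    smaller bound, which all later [v m] satisfy; in the limit it becomes a weak inequality, still
    below the original bound. *)
Let vlim_holds : holds vlim (\bigcup_n p n).
Proof.
move=> e [k _ pe]; have pe2 : p k.*2 e by apply: (p_mono _ pe); rewrite -addnn leq_addr.
have [r [re qr]] := step_margin (S k) pe2.
apply: le_lt_trans re; apply/ler_addgt0Pr => t t0.
have /cvgrPdist_lt/(_ t t0)[K _ KP] := @qf_eval_continuous _ _ _ _ _ _ _ vlim_cvg F e.1.
pose m := maxn K k; have := KP m (leq_maxl K k).
have qm : q m (e.1, r).
  rewrite -oddE; apply: (@p_mono k.*2.+1); last by rewrite oddE.
  by rewrite ltnS leq_double leq_maxr.
have := good_holds (G m) qm; rewrite /= ltr_norml; lra.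
Qed.

(** The n-th answer forces the distance to within 1/(n+1) of its value under [v n], in every
    structure satisfying it, and these values converge to the one under [vlim]. *)
Let vlim_entails s (t u : term so s) :
  entails_dist theory (\bigcup_n p n) t u (mdist (Defs.eval vlim t) (Defs.eval vlim u)).
Proof.
move=> M v' [_ v'p]; have [m mx] := tpP (existT _ s (t, u)).
apply/eqP; rewrite -subr_eq0 -normr_le0; apply/ler_addgt0Pr => e e0; rewrite add0r.
have e2 : 0 < e / 2 by rewrite divr_gt0.
have /cvgrPdist_lt/(_ _ e2)[K _ KP] := @qf_eval_continuous _ _ _ _ _ _ _ vlim_cvg F (Dist F t u).
pose n := maxn (maxn K m.+1) (Num.bound (e / 2)^-1).
have h1 : `|mdist (Defs.eval vlim t) (Defs.eval vlim u) - pair_dist (v n) (existT _ s (t, u))| < e / 2.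
  by apply: (KP n); rewrite /= /n !leq_max leqnn.
have h2 : `|mdist (Defs.eval v' t) (Defs.eval v' u) - pair_dist (v n) (existT _ s (t, u))| <= n.+1%:R^-1.
  apply: (good_dist (G n) _ mx); first by rewrite /n !leq_max leqnn orbT.
  by move=> e' qe'; apply: v'p; exists n.*2.+1 => //; rewrite oddE.
have h3 : n.+1%:R^-1 <= e / 2.
  rewrite -[leRHS]invrK lef_pV2 ?posrE ?invr_gt0// ltW//.
  rewrite (lt_le_trans (archi_boundP _)) ?invr_ge0 ?(ltW e2)//.
  by rewrite ler_nat (leq_trans _ (leqnSn n))// leq_maxr.
by move: h1 h2 h3; set k := n.+1%:R^-1; rewrite ltr_norml !ler_norml; lra.
Qed.

Let vlim_dense s (x : cstar_structure D s) e : 0 < e ->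
  exists t : term so s, mdist x (Defs.eval vlim t) < e.
Proof.
move=> e0; have e2 : 0 < e / 2 by rewrite divr_gt0.
have [i di] := dP (x : cball D s) e2.
(* Three radii are spent: one between the point [d s i] and the constant in round n, and two for its
   later movement. They total less than e/2. *)
have [K KP] := half_pow_small (divr_gt0 e0 (ltr0n R 6)).
pose n := maxn K (maxn s i).
have [||c [sc cN cd]] := good_dense (G n) (k := s) (i := i).
- by rewrite /n !leq_max leqnn orbT.
- by rewrite /n !leq_max leqnn !orbT.
have h := vlim_close cN; have h' := KP n (leq_maxl _ _); subst s.
exists (Var so c); rewrite -[mdist _ _]/(cnorm (val (x : cball D (so c)) - cval vlim c)).
apply: le_lt_trans (cdistD (val (d (so c) i)) _ _) _; rewrite cdistC.
apply: le_lt_trans (lerD (lexx _) (cdistD (cval (v n) c) _ _)) _.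
rewrite cdistC in h; rewrite cdistC in cd.
by move: h h' cd di; lra.
Qed.

Lemma strategy_wins : definitive theory (\bigcup_n p n) /\
  exists (M : structure (cstar_signature R)) (w : forall c, M (so c)),
    compiled theory (\bigcup_n p n) w /\ isomorphic M (cstar_structure D).
Proof.
split=> [s t u|].
  exists (mdist (Defs.eval vlim t) (Defs.eval vlim u)); split; first exact: vlim_entails.
  (* Uniqueness: [D] with the limit assignment is itself a model of the whole play, so it realises
     every entailed value. *)
  by move=> r; apply; split=> //; exact: vlim_holds.
exists (cstar_structure D), vlim; split; first by split; [exact: vlim_entails|exact: vlim_dense].
exists (fun _ => id); split=> // s; exists id; exact: (fun=> erefl).
Qed.

End Play.
End Game.

Theorem theorem5p4 (R : realType) (D : cstarType R)
    (hD : strongly_self_absorbing D)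
    (F : connectives R) (hFcountable : countable [set: conn F])
    (hFdense : uniformly_dense F)
    (C : countType) (so : C -> sorts (cstar_signature R))
    (hC : forall s, infinite_set [set c | so c = s]) :
  enforceable_structure F so (universal_theory (cstar_structure D))
    (cstar_structure D).
Proof.
have [d dP] := dense_sequences hD.1; have [tp tpP] := @term_pair_enum R C so.
exists (strategy d tp) => p pS; split.
  by move=> n; exact: (strategy_legal hD hFdense hC tpP pS).
by move=> lg; exact: (strategy_wins hD hFdense hC dP tpP pS lg).
Qed.
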